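(* Let $n\ge 3$, let $A\subset\mathbb{C}^n$ be a non-degenerate quadratic hypersurface, and let $E=\overset{\vee}{\mathbb{CP}^n}\setminus(\overset{\vee}{A}\cup\overset{\ast}{A})$ be the space of affine hyperplanes in $\mathbb{C}^n$ that are in general position with respect to $A$. Then the fundamental group $\pi_1(E)$ is generated by three elements $\alpha,\beta,\kappa$ with defining relations $\kappa\alpha=\beta\kappa$ and $\kappa^2=1$; that is, $\pi_1(E)\cong\langle \alpha,\beta,\kappa \mid \kappa\alpha=\beta\kappa,\ \kappa^2=1\rangle$.
   Context: $\mathbb{CP}^{n-1}_\infty=\mathbb{CP}^n\setminus\mathbb{C}^n$ is the hyperplane at infinity of the projective closure $\mathbb{CP}^n$ of $\mathbb{C}^n$, and a bar denotes closure in $\mathbb{CP}^n$. A non-degenerate quadratic hypersurface $A\subset\mathbb{C}^n$ is the zero set of a polynomial of degree $2$ such that $\overline{A}$ is smooth in $\mathbb{CP}^n$ and intersects $\mathbb{CP}^{n-1}_\infty$ transversally (e.g. $z_1^2+\dots+z_n^2=1$). $\overset{\vee}{\mathbb{CP}^n}$ is the space of all hyperplanes in $\mathbb{CP}^n$ (the dual projective space); affine hyperplanes $L\subset\mathbb{C}^n$ are identified with their closures. A hyperplane $L\subset\mathbb{C}^n$ is asymptotic for $A$ if $\overline{L}\cap\mathbb{CP}^{n-1}_\infty$ is tangent to $\overline{A}\cap\mathbb{CP}^{n-1}_\infty$. $\overset{\vee}{A}\subset\overset{\vee}{\mathbb{CP}^n}$ is the set of hyperplanes tangent to $A$ at some point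 of $\mathbb{C}^n$; $\overset{\ast}{A}\subset\overset{\vee}{\mathbb{CP}^n}$ is the set consisting of all hyperplanes asymptotic for $A$ together with the hyperplane at infinity $\mathbb{CP}^{n-1}_\infty$. $L$ is in general position with respect to $A$ if it is neither tangent to $A$ at a point of $\mathbb{C}^n$ nor asymptotic for $A$. *)

(* Defs.v *)
From HB Require Import structures.
From mathcomp Require Import all_boot all_order all_algebra generic_quotient.
From mathcomp Require Import complex.
(* The notations of mpoly clash with those of mathcomp-analysis. *)
From mathcomp Require Import -(notations) mpoly.
From mathcomp Require Import all_classical all_reals topology normedtype homotopy.
From mathcomp Require Import ring lra.
Import Order.TTheory GRing.Theory Num.Theory.
Import numFieldNormedType.Exports.
Set Implicit Arguments. Unset Strict Implicit. Unset Printing Implicit Defensive.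
Local Open Scope classical_set_scope.
Local Open Scope ring_scope.
Local Open Scope quotient_scope.

Section Interval.
Variable R : realType.

Definition unit_interval : Type := (`[0, 1]%classic : set R).
HB.instance Definition _ :=
  Topological.copy unit_interval (set_type (`[0, 1]%classic : set R)).

Definition ui_val (s : unit_interval) : R := set_val s.

Lemma ui_ge0 s : 0 <= ui_val s.
Proof. by have := set_valP s; rewrite /= in_itv /= => /andP[]. Qed.
Lemma ui_le1 s : ui_val s <= 1.
Proof. by have := set_valP s; rewrite /= in_itv /= => /andP[]. Qed.

Lemma ui_clamp_subproof (x : R) :
  Num.max 0 (Num.min 1 x) \in (`[0, 1]%classic : set R).
Proof.
by rewrite inE /= in_itv /= le_max lexx /= ge_max ler01 ge_min lexx.
Qed.

Definition ui_clamp (x : R) : unit_interval := SigSub (ui_clamp_subproof x).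

Lemma ui_clampE x : ui_val (ui_clamp x) = Num.max 0 (Num.min 1 x).
Proof. by []. Qed.

Lemma ui_clampK x : 0 <= x <= 1 -> ui_val (ui_clamp x) = x.
Proof. by case/andP=> h0 h1; rewrite ui_clampE min_r // max_r. Qed.

Lemma ui_valI : injective ui_val.
Proof. by move=> [x xP] [y yP]; rewrite /ui_val /= => e; exact/val_inj. Qed.

Lemma ui_valK : cancel ui_val ui_clamp.
Proof. by move=> s; apply: ui_valI; rewrite ui_clampK // ui_ge0 ui_le1. Qed.

Lemma ui_zero_one : ui_clamp 0 != ui_clamp 1.
Proof.
apply/eqP => /(congr1 ui_val); rewrite !ui_clampK ?lexx ?ler01 // => /eqP.
by rewrite eq_sym oner_eq0.
Qed.

HB.instance Definition _ := isBiPointed.Build unit_interval ui_zero_one.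

Lemma ui_val0 : ui_val zero = 0.
Proof. by rewrite /zero /= ui_clampK // lexx ler01. Qed.
Lemma ui_val1 : ui_val one = 1.
Proof. by rewrite /one /= ui_clampK // lexx ler01. Qed.

Lemma ui_clamp_le0 x : x <= 0 -> ui_clamp x = zero.
Proof.
move=> x0; apply: ui_valI; rewrite ui_val0 ui_clampE max_l //.
by rewrite ge_min x0 orbT.
Qed.
Lemma ui_clamp_ge1 x : 1 <= x -> ui_clamp x = one.
Proof. by move=> x1; apply: ui_valI; rewrite ui_val1 ui_clampE min_l // max_r. Qed.

Lemma ui_val_continuous : continuous ui_val.
Proof. exact: (@initial_continuous _ _ set_val). Qed.

Lemma ui_clamp_continuous : continuous ui_clamp.
Proof.
apply: (@continuous_comp_initial _ _ _ (set_val : unit_interval -> R)).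
move=> x; apply: (@continuous_max _ _ (cst 0) (fun x : R => Num.min 1 x)).
  exact: cvg_cst.
by apply: (@continuous_min _ _ (cst 1) id); [exact: cvg_cst | exact: cvg_id].
Qed.

Lemma paste_continuous (T X : topologicalType) (a : T -> R) (u v : T -> X) (c : R) :
  continuous a -> continuous u -> continuous v ->
  (forall t, a t = c -> u t = v t) ->
  continuous (fun t => if a t <= c then u t else v t).
Proof.
move=> ca cu cv uv t U /=; case: (ltgtP (a t) c) => act.
- move=> Uu; have : nbhs t (u @^-1` U) by exact: cu.
  have : nbhs t (a @^-1` [set x | x < c]) by apply: ca; exact: lt_nbhsl.
  by apply: filterS2 => s /= /ltW ->.
- move=> Uv; have : nbhs t (v @^-1` U) by exact: cv.
  have : nbhs t (a @^-1` [set x | c < x]) by apply: ca; exact: lt_nbhsr.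
  by apply: filterS2 => s /=; case: ltgtP.
- move=> Uu; have nu : nbhs t (u @^-1` U) by exact: cu.
  have : nbhs t (v @^-1` U) by apply: cv; rewrite -uv.
  by apply: filterS2 nu => s /=; case: ifP.
Qed.

End Interval.

Section FundamentalGroup.
Variables (R : realType) (X : topologicalType) (x0 : X).
Local Notation I := (unit_interval R).

Definition loop := {path I from x0 to x0 in X}.

Definition mk_loop (f : I -> X) (cf : continuous f) (f0 : f zero = x0)
  (f1 : f one = x0) : loop := [the {path I from x0 to x0 in X} of mk_path cf f0 f1].

(* Homotopy relative to the endpoints; [I * I] is (path variable, time). *)
Definition loop_homotopy (f g : loop) (H : I * I -> X) : Prop :=
  [/\ continuous H,
      (forall s, H (s, zero) = f s),
      (forall s, H (s, one) = g s) &
      (forall t, H (zero, t) = x0 /\ H (one, t) = x0)].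

Definition loop_homotopic : rel loop :=
  fun f g => `[< exists H, loop_homotopy f g H >].

Lemma ui_cont_fst : continuous (fun st : I * I => ui_val st.1).
Proof. by move=> st; apply: (continuous_comp cvg_fst (@ui_val_continuous R _)). Qed.
Lemma ui_cont_snd : continuous (fun st : I * I => ui_val st.2).
Proof. by move=> st; apply: (continuous_comp cvg_snd (@ui_val_continuous R _)). Qed.

Lemma comp_clamp (T Y : topologicalType) (h : I -> Y) (a : T -> R) :
  continuous h -> continuous a -> continuous (fun t => h (ui_clamp (a t))).
Proof.
move=> ch ca t; apply: (@continuous_comp _ _ _ (fun t => ui_clamp (a t)) h);
  last exact: ch.
apply: (@continuous_comp _ _ _ a (@ui_clamp R)); first exact: ca.
exact: (@ui_clamp_continuous R (a t)).
Qed.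

Lemma comp_clamp2 (T Y : topologicalType) (H : I * I -> Y) (a b : T -> R) :
  continuous H -> continuous a -> continuous b ->
  continuous (fun t => H (ui_clamp (a t), ui_clamp (b t))).
Proof.
move=> cH ca cb t.
apply: (@continuous2_cvg _ _ _ _ (nbhs t) _ (fun t => ui_clamp (a t))
  (fun t => ui_clamp (b t)) (fun x y => H (x, y))).
- rewrite (_ : (fun z : I * I => H (z.1, z.2)) = H); last by apply/funext => -[].
  exact: cH.
- by apply: (@comp_clamp _ _ id); [move=> ?; exact: cvg_id|exact: ca].
- by apply: (@comp_clamp _ _ id); [move=> ?; exact: cvg_id|exact: cb].
Qed.

Lemma loop_cont (f : loop) : continuous f.
Proof. exact: cts_fun. Qed.
Lemma loop0 (f : loop) : f zero = x0. Proof. exact: path_zero. Qed.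
Lemma loop1 (f : loop) : f one = x0. Proof. exact: path_one. Qed.

Lemma rcontD (T : topologicalType) (a b : T -> R) :
  continuous a -> continuous b -> continuous (fun t => a t + b t).
Proof. by move=> ca cb t; apply: continuousD; [exact: ca | exact: cb]. Qed.
Lemma rcontM (T : topologicalType) (a b : T -> R) :
  continuous a -> continuous b -> continuous (fun t => a t * b t).
Proof. by move=> ca cb t; apply: continuousM; [exact: ca | exact: cb]. Qed.
Lemma rcontN (T : topologicalType) (a : T -> R) :
  continuous a -> continuous (fun t => - a t).
Proof. by move=> ca t; apply: continuousN; exact: ca. Qed.
Lemma rcontC (T : topologicalType) (c : R) : continuous (fun _ : T => c).
Proof. by move=> t; exact: cvg_cst. Qed.
Lemma rcontmin (T : topologicalType) (a b : T -> R) :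
  continuous a -> continuous b -> continuous (fun t => Num.min (a t) (b t)).
Proof. by move=> ca cb t; apply: continuous_min; [exact: ca | exact: cb]. Qed.
Lemma rcontmax (T : topologicalType) (a b : T -> R) :
  continuous a -> continuous b -> continuous (fun t => Num.max (a t) (b t)).
Proof. by move=> ca cb t; apply: continuous_max; [exact: ca | exact: cb]. Qed.

Local Ltac rcont := repeat first
  [ exact: ui_cont_fst | exact: ui_cont_snd | exact: ui_val_continuous
  | exact: rcontC
  | apply: rcontD | apply: rcontN | apply: rcontM | apply: rcontmin | apply: rcontmax ].

Lemma loop_reparam (p f g : loop) (phi psi : I -> R) :
  continuous phi -> continuous psi ->
  phi zero = psi zero -> phi one = psi one ->
  (forall s, f s = p (ui_clamp (phi s))) ->
  (forall s, g s = p (ui_clamp (psi s))) ->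
  loop_homotopic f g.
Proof.
move=> cphi cpsi e0 e1 fE gE; apply/asboolP.
exists (fun st => p (ui_clamp (phi st.1 + ui_val st.2 * (psi st.1 - phi st.1)))).
split.
- apply: comp_clamp; first exact: loop_cont.
  have cfst (h : I -> R) : continuous h -> continuous (fun st : I * I => h st.1).
    by move=> ch st; apply: (continuous_comp cvg_fst (ch _)).
  by have := cfst _ cphi; have := cfst _ cpsi => c1 c2; repeat first
    [exact: c1 | exact: c2 | progress rcont].
- by move=> s /=; rewrite ui_val0 mul0r addr0 fE.
- by move=> s /=; rewrite ui_val1 mul1r gE; congr (p (ui_clamp _)); ring.
- move=> t /=; rewrite -e0 -e1 !subrr !mulr0 !addr0 -fE -fE.
  by rewrite loop0 loop1.
Qed.

Lemma loop_homotopic_equiv : equiv_class_of loop_homotopic.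
Proof.
split.
- move=> f; apply: (@loop_reparam f _ _ (@ui_val R) (@ui_val R)) => //;
    try exact: ui_val_continuous; by move=> s; rewrite ui_valK.
- have sym f g : loop_homotopic f g -> loop_homotopic g f.
    move=> /asboolP[H [cH H0 H1 He]]; apply/asboolP.
    exists (fun st => H (ui_clamp (ui_val st.1), ui_clamp (1 - ui_val st.2))).
    split.
    + by apply: comp_clamp2 => //; rcont.
    + by move=> s /=; rewrite ui_val0 subr0 ui_valK (@ui_clamp_ge1 R 1).
    + by move=> s /=; rewrite ui_val1 subrr ui_valK (@ui_clamp_le0 R 0).
    + by move=> t /=; rewrite !ui_valK; exact: He.
  by move=> f g; apply/idP/idP; exact: sym.
- move=> g f h /asboolP[H [cH H0 H1 He]] /asboolP[K [cK K0 K1 Ke]]; apply/asboolP.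
  exists (fun st => if ui_val st.2 <= 2^-1
     then H (ui_clamp (ui_val st.1), ui_clamp (2 * ui_val st.2))
     else K (ui_clamp (ui_val st.1), ui_clamp (2 * ui_val st.2 - 1))).
  split.
  + apply: paste_continuous; [by rcont|by apply: comp_clamp2 => //; rcont..|].
    move=> st ->; rewrite (@ui_clamp_ge1 R (2 * _)); last by lra.
    rewrite (@ui_clamp_le0 R (_ - 1)); last by lra.
    by rewrite ui_valK; rewrite H1 K0.
  + move=> s /=; rewrite ui_val0 ui_valK ifT; last by lra.
    by rewrite ui_clamp_le0 ?H0 //; lra.
  + move=> s /=; rewrite ui_val1 ui_valK ifF; last by apply/negbTE; rewrite -ltNge; lra.
    by rewrite ui_clamp_ge1 ?K1 //; lra.
  + by move=> t /=; rewrite !ui_valK; case: ifP => _; [exact: He | exact: Ke].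
Qed.

Canonical loop_homotopic_equiv_rel := EquivRelPack loop_homotopic_equiv.

Definition const_loop : loop :=
  @mk_loop (cst x0) (@cst_continuous _ _ x0) erefl erefl.

Definition loop_cat_fun (f g : I -> X) (s : I) : X :=
  if ui_val s <= 2^-1 then f (ui_clamp (2 * ui_val s))
  else g (ui_clamp (2 * ui_val s - 1)).

Lemma loop_cat_continuous (f g : loop) : continuous (loop_cat_fun f g).
Proof.
apply: paste_continuous; [by rcont|by apply: comp_clamp; [exact: loop_cont|rcont]..|].
move=> s ->; rewrite (@ui_clamp_ge1 R (2 * _)); last by lra.
by rewrite ui_clamp_le0 ?loop0 ?loop1 //; lra.
Qed.

Lemma loop_cat0 (f g : loop) : loop_cat_fun f g zero = x0.
Proof.
rewrite /loop_cat_fun ui_val0 ifT; last by lra.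
by rewrite ui_clamp_le0 ?loop0 //; lra.
Qed.

Lemma loop_cat1 (f g : loop) : loop_cat_fun f g one = x0.
Proof.
rewrite /loop_cat_fun ui_val1 ifF; last by apply/negbTE; rewrite -ltNge; lra.
by rewrite ui_clamp_ge1 ?loop1 //; lra.
Qed.

Definition loop_cat (f g : loop) : loop :=
  mk_loop (@loop_cat_continuous f g) (loop_cat0 f g) (loop_cat1 f g).

Lemma loop_rev_continuous (f : loop) :
  continuous (fun s : I => f (ui_clamp (1 - ui_val s))).
Proof. by apply: comp_clamp; [exact: loop_cont|rcont]. Qed.

Lemma loop_rev0 (f : loop) : f (ui_clamp (1 - ui_val zero)) = x0.
Proof. by rewrite ui_val0 subr0 ui_clamp_ge1 ?loop1. Qed.

Lemma loop_rev1 (f : loop) : f (ui_clamp (1 - ui_val one)) = x0.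
Proof. by rewrite ui_val1 subrr ui_clamp_le0 ?loop0. Qed.

Definition loop_rev (f : loop) : loop :=
  mk_loop (@loop_rev_continuous f) (loop_rev0 f) (loop_rev1 f).

Lemma loop_cat_homotopic f f' g g' :
  loop_homotopic f f' -> loop_homotopic g g' ->
  loop_homotopic (loop_cat f g) (loop_cat f' g').
Proof.
move=> /asboolP[H [cH H0 H1 He]] /asboolP[K [cK K0 K1 Ke]]; apply/asboolP.
exists (fun st => if ui_val st.1 <= 2^-1
   then H (ui_clamp (2 * ui_val st.1), ui_clamp (ui_val st.2))
   else K (ui_clamp (2 * ui_val st.1 - 1), ui_clamp (ui_val st.2))).
split.
+ apply: paste_continuous; [by rcont|by apply: comp_clamp2 => //; rcont..|].
  move=> st ->; rewrite (@ui_clamp_ge1 R (2 * _)); last by lra.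
    rewrite (@ui_clamp_le0 R (_ - 1)); last by lra.
  by rewrite ui_valK (proj2 (He _)) (proj1 (Ke _)).
+ by move=> s /=; rewrite ui_valK H0 K0.
+ by move=> s /=; rewrite ui_valK H1 K1.
+ move=> t /=; rewrite ui_val0 ui_val1 ifT; last by lra.
  rewrite ifF; last by apply/negbTE; rewrite -ltNge; lra.
  rewrite (@ui_clamp_le0 R (2 * _)); last by lra.
  rewrite (@ui_clamp_ge1 R (_ - 1)); last by lra.
  by rewrite (proj2 (Ke _)) (proj1 (He _)).
Qed.

Lemma loop_rev_homotopic f f' :
  loop_homotopic f f' -> loop_homotopic (loop_rev f) (loop_rev f').
Proof.
move=> /asboolP[H [cH H0 H1 He]]; apply/asboolP.
exists (fun st => H (ui_clamp (1 - ui_val st.1), ui_clamp (ui_val st.2))).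
split.
+ by apply: comp_clamp2 => //; rcont.
+ by move=> s /=; rewrite ui_valK H0.
+ by move=> s /=; rewrite ui_valK H1.
+ move=> t /=; rewrite ui_val0 ui_val1 subr0 subrr (ui_clamp_ge1 (lexx 1)) (ui_clamp_le0 (lexx 0)).
  by rewrite (proj1 (He _)) (proj2 (He _)).
Qed.


Let assoc_phi (x : R) := Num.min (2 * x) (Num.min (x + 4^-1) ((x + 1) / 2)).

Lemma loop_catA f g h :
  loop_homotopic (loop_cat f (loop_cat g h)) (loop_cat (loop_cat f g) h).
Proof.
have phi1 x : x <= 4^-1 -> assoc_phi x = 2 * x.
  by move=> hx; rewrite /assoc_phi /Order.min; case: ifP => //; case: ifP => _; lra.
have phi2 x : 4^-1 <= x -> x <= 2^-1 -> assoc_phi x = x + 4^-1.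
  move=> h1 h2; rewrite /assoc_phi (_ : Num.min (x + _) _ = x + 4^-1).
    by apply: min_r; lra.
  by apply: min_l; lra.
have phi3 x : 2^-1 <= x -> assoc_phi x = (x + 1) / 2.
  move=> h1; rewrite /assoc_phi (_ : Num.min (x + _) _ = (x + 1) / 2).
    by apply: min_r; lra.
  by apply: min_r; lra.
apply: (@loop_reparam (loop_cat f (loop_cat g h)) _ _ (@ui_val R)
  (fun s => assoc_phi (ui_val s))).
- by rcont.
- by rewrite /assoc_phi; rcont.
- by rewrite ui_val0 phi1; lra.
- by rewrite ui_val1 phi3; lra.
- by move=> s; rewrite ui_valK.
move=> s; have := ui_ge0 s; have := ui_le1 s.
rewrite [LHS]/(loop_cat_fun (loop_cat_fun f g) h s).
rewrite [RHS]/(loop_cat_fun f (loop_cat_fun g h) _).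
rewrite /loop_cat_fun; set x := ui_val s => s1 s0.
have cK (y : R) : 0 <= y -> y <= 1 -> ui_val (ui_clamp y) = y.
  by move=> y0 y1; rewrite ui_clampK // y0.
have [xh|xh] := leP x (2^-1).
  rewrite (cK (2 * x)); [|lra..].
  have [xq|xq] := leP x (4^-1).
    rewrite phi1 // (cK (2 * x)); [|lra..].
    by rewrite !ifT //; lra.
  rewrite phi2; [|lra..].
  rewrite (cK (x + _)); [|lra..].
  rewrite ifF; last by apply/negbTE; rewrite -ltNge; lra.
  rewrite ifF; last by apply/negbTE; rewrite -ltNge; lra.
  rewrite (cK (2 * _ - 1)); [|lra..].
  rewrite ifT; last by lra.
  by congr (g (ui_clamp _)); lra.
rewrite phi3; last by lra.
rewrite (cK ((x + 1) / 2)); [|lra..].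
rewrite ifF; last by apply/negbTE; rewrite -ltNge; lra.
rewrite (cK (2 * _ - 1)); [|lra..].
rewrite ifF; last by apply/negbTE; rewrite -ltNge; lra.
by congr (h (ui_clamp _)); lra.
Qed.

Lemma loop_cat1l f : loop_homotopic (loop_cat const_loop f) f.
Proof.
apply: (@loop_reparam f _ _ (fun s => Num.max 0 (2 * ui_val s - 1)) (@ui_val R)).
- by rcont.
- by rcont.
- by rewrite ui_val0 max_l; lra.
- by rewrite ui_val1 max_r; lra.
- move=> s; rewrite [LHS]/(loop_cat_fun (cst x0) f s) /loop_cat_fun /=.
  case: leP => hs; last by rewrite max_r //; lra.
  rewrite max_l; last by lra.
  by rewrite (ui_clamp_le0 (lexx 0)) loop0.
- by move=> s; rewrite ui_valK.
Qed.

Lemma loop_cat1r f : loop_homotopic (loop_cat f const_loop) f.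
Proof.
apply: (@loop_reparam f _ _ (fun s => Num.min 1 (2 * ui_val s)) (@ui_val R)).
- by rcont.
- by rcont.
- by rewrite ui_val0 min_r; lra.
- by rewrite ui_val1 min_l; lra.
- move=> s; rewrite [LHS]/(loop_cat_fun f (cst x0) s) /loop_cat_fun /=.
  case: leP => hs; first by rewrite min_r //; lra.
  rewrite min_l; last by lra.
  by rewrite (ui_clamp_ge1 (lexx 1)) loop1.
- by move=> s; rewrite ui_valK.
Qed.

Lemma loop_catV f : loop_homotopic (loop_cat f (loop_rev f)) const_loop.
Proof.
apply: (@loop_reparam f _ _
  (fun s => Num.min (2 * ui_val s) (2 - 2 * ui_val s)) (fun=> 0)).
- by rcont.
- by rcont.
- by rewrite ui_val0 min_l; lra.
- by rewrite ui_val1 min_r; lra.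
- move=> s; have := ui_ge0 s; have := ui_le1 s => s1 s0.
  rewrite [LHS]/(loop_cat_fun f (fun s => f (ui_clamp (1 - ui_val s))) s).
  rewrite /loop_cat_fun; case: leP => hs; first by rewrite min_l //; lra.
  rewrite min_r; last by lra.
  rewrite (@ui_clampK R (_ - 1)); last by apply/andP; split; lra.
  by congr (f (ui_clamp _)); lra.
- by move=> s; rewrite (ui_clamp_le0 (lexx 0)) loop0.
Qed.

Lemma loop_revK f : loop_rev (loop_rev f) = f.
Proof.
apply/path_eqP => s; have := ui_ge0 s; have := ui_le1 s => s1 s0.
rewrite [LHS]/(f (ui_clamp (1 - ui_val (ui_clamp (1 - ui_val s))))).
rewrite ui_clampK; last by apply/andP; split; lra.
by rewrite subKr ui_valK.
Qed.

Lemma loop_Vcat f : loop_homotopic (loop_cat (loop_rev f) f) const_loop.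
Proof. by rewrite -{2}[f]loop_revK; exact: loop_catV. Qed.

(* Homotopy classes of loops [0, 1] -> X based at [x0], under concatenation;
   the product [a * b] runs through [a] first. *)
Definition fundamental_group : Type := {eq_quot loop_homotopic}.
HB.instance Definition _ := Choice.on fundamental_group.

Local Notation cls := (\pi_({eq_quot loop_homotopic}) : loop -> fundamental_group).

Definition fundamental_group_one : fundamental_group := cls const_loop.
Definition fundamental_group_mul (a b : fundamental_group) : fundamental_group := cls (loop_cat (repr a) (repr b)).
Definition fundamental_group_inv (a : fundamental_group) : fundamental_group := cls (loop_rev (repr a)).

Lemma clsP f g : loop_homotopic f g <-> cls f = cls g.
Proof. by split; [move/eqmodP | move=> e; apply/eqmodP]. Qed.

Lemma fundamental_group_ind (P : fundamental_group -> Prop) : (forall f, P (cls f)) -> forall a, P a.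
Proof. by move=> h a; rewrite -[a]reprK. Qed.

Lemma repr_cls f : loop_homotopic (repr (cls f)) f.
Proof. by apply/clsP; rewrite reprK. Qed.

Lemma loop_homotopicxx f : loop_homotopic f f.
Proof. by case: loop_homotopic_equiv. Qed.

Lemma fundamental_group_mulE f g : fundamental_group_mul (cls f) (cls g) = cls (loop_cat f g).
Proof. by apply/clsP/loop_cat_homotopic; exact: repr_cls. Qed.

Lemma fundamental_group_invE f : fundamental_group_inv (cls f) = cls (loop_rev f).
Proof. by apply/clsP/loop_rev_homotopic; exact: repr_cls. Qed.

Lemma fundamental_group_mulA : associative fundamental_group_mul.
Proof.
elim/fundamental_group_ind=> f; elim/fundamental_group_ind=> g; elim/fundamental_group_ind=> h.
by rewrite !fundamental_group_mulE; apply/clsP/loop_catA.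
Qed.

Lemma fundamental_group_mul1g : left_id fundamental_group_one fundamental_group_mul.
Proof. by elim/fundamental_group_ind=> f; rewrite fundamental_group_mulE; apply/clsP/loop_cat1l. Qed.

Lemma fundamental_group_mulg1 : right_id fundamental_group_one fundamental_group_mul.
Proof. by elim/fundamental_group_ind=> f; rewrite fundamental_group_mulE; apply/clsP/loop_cat1r. Qed.

Lemma fundamental_group_mulVg : left_inverse fundamental_group_one fundamental_group_inv fundamental_group_mul.
Proof. by elim/fundamental_group_ind=> f; rewrite fundamental_group_invE fundamental_group_mulE; apply/clsP/loop_Vcat. Qed.

Lemma fundamental_group_mulgV : right_inverse fundamental_group_one fundamental_group_inv fundamental_group_mul.
Proof. by elim/fundamental_group_ind=> f; rewrite fundamental_group_invE fundamental_group_mulE; apply/clsP/loop_catV. Qed.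

HB.instance Definition _ := isGroup.Build fundamental_group
  fundamental_group_mulA fundamental_group_mul1g fundamental_group_mulg1 fundamental_group_mulVg fundamental_group_mulgV.

End FundamentalGroup.

(* The group < S | lhs = rhs, (lhs, rhs) in rels >: words in the letters s
   (encoded (s, false)) and s^-1 (encoded (s, true)), modulo the smallest
   congruence that contains the free cancellations and the relations. *)
Section Presentation.
Variable S : choiceType.

Definition word := seq (S * bool).

Definition letter (s : S) : S * bool := (s, false).
Definition letter_inv (x : S * bool) : S * bool := (x.1, ~~ x.2).
Definition word_inv (w : word) : word := rev (map letter_inv w).

Variable rels : seq (word * word).

Inductive word_cong : word -> word -> Prop :=
| WordRefl w : word_cong w w
| WordSym u v : word_cong u v -> word_cong v u
| WordTrans v u w : word_cong u v -> word_cong v w -> word_cong u w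
| WordCat u u' v v' :
    word_cong u u' -> word_cong v v' -> word_cong (u ++ v) (u' ++ v')
| WordCancel x : word_cong [:: x; letter_inv x] [::]
| WordRel u v : (u, v) \in rels -> word_cong u v.

Definition word_eqv : rel word := fun u v => `[< word_cong u v >].

Lemma word_eqv_equiv : equiv_class_of word_eqv.
Proof.
split.
- by move=> w; apply/asboolP; exact: WordRefl.
- by move=> u v; apply/asboolP/asboolP; exact: WordSym.
- by move=> v u w /asboolP uv /asboolP vw; apply/asboolP; exact: WordTrans uv vw.
Qed.

Canonical word_eqv_equiv_rel := EquivRelPack word_eqv_equiv.

Definition presented_group : Type := {eq_quot word_eqv}.
HB.instance Definition _ := Choice.on presented_group.

Definition word_class (w : word) : presented_group := \pi_({eq_quot word_eqv}) w.

Definition presented_one : presented_group := word_class [::].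
Definition presented_mul (a b : presented_group) : presented_group :=
  word_class (repr a ++ repr b).
Definition presented_inv (a : presented_group) : presented_group :=
  word_class (word_inv (repr a)).

Lemma word_classP u v : word_cong u v <-> word_class u = word_class v.
Proof.
split=> [uv|e]; last first.
  by have /asboolP : word_eqv u v by apply/eqmodP.
by have /eqmodP : word_eqv u v by apply/asboolP.
Qed.

Lemma presented_group_ind (P : presented_group -> Prop) :
  (forall w, P (word_class w)) -> forall a, P a.
Proof. by move=> h a; rewrite -[a]reprK; exact: h. Qed.

Lemma repr_word_class w : word_cong (repr (word_class w)) w.
Proof. by apply/word_classP; rewrite /word_class reprK. Qed.

Lemma letter_invK : involutive letter_inv.
Proof. by case=> s b; rewrite /letter_inv /= negbK. Qed.

Lemma word_inv_cons x w : word_inv (x :: w) = word_inv w ++ [:: letter_inv x].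
Proof. by rewrite /word_inv /= rev_cons cats1. Qed.

Lemma word_invK : involutive word_inv.
Proof.
by move=> w; rewrite /word_inv map_rev revK -map_comp map_id_in // => x _ /=;
  exact: letter_invK.
Qed.

Lemma word_cat_inv w : word_cong (w ++ word_inv w) [::].
Proof.
elim: w => [|x w IH]; first exact: WordRefl.
rewrite word_inv_cons -cat1s -!catA (catA w).
apply: WordTrans (WordCancel x).
rewrite -[X in word_cong _ X]cat1s; apply: WordCat; first exact: WordRefl.
by rewrite -[X in word_cong _ X]cat0s; apply: WordCat => //; exact: WordRefl.
Qed.

Lemma presented_mulE u v :
  presented_mul (word_class u) (word_class v) = word_class (u ++ v).
Proof. by apply/word_classP; apply: WordCat; exact: repr_word_class. Qed.

Lemma presented_mulA : associative presented_mul.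
Proof.
elim/presented_group_ind=> u; elim/presented_group_ind=> v.
by elim/presented_group_ind=> w; rewrite !presented_mulE catA.
Qed.

Lemma presented_mul1g : left_id presented_one presented_mul.
Proof. by elim/presented_group_ind=> u; rewrite presented_mulE. Qed.

Lemma presented_mulg1 : right_id presented_one presented_mul.
Proof. by elim/presented_group_ind=> u; rewrite presented_mulE cats0. Qed.

Lemma presented_mulgV : right_inverse presented_one presented_inv presented_mul.
Proof.
move=> a; rewrite -{1}[a]reprK -[\pi _]/(word_class _) presented_mulE.
by apply/word_classP; exact: word_cat_inv.
Qed.

Lemma presented_mulVg : left_inverse presented_one presented_inv presented_mul.
Proof.
move=> a; rewrite -{2}[a]reprK -[\pi _]/(word_class _) presented_mulE.
by apply/word_classP; rewrite -{2}[repr a]word_invK; exact: word_cat_inv.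
Qed.

HB.instance Definition _ := isGroup.Build presented_group
  presented_mulA presented_mul1g presented_mulg1 presented_mulVg presented_mulgV.

End Presentation.

Variant generator := Alpha | Beta | Kappa.
HB.instance Definition _ := gen_eqMixin generator.
HB.instance Definition _ := gen_choiceMixin generator.

(* < alpha, beta, kappa | kappa alpha = beta kappa, kappa^2 = 1 > *)
Definition quadric_group : Type :=
  presented_group
    [:: ([:: letter Kappa; letter Alpha], [:: letter Beta; letter Kappa]);
        ([:: letter Kappa; letter Kappa], [::])].
HB.instance Definition _ := Group.on quadric_group.

(* The projectivization of the space of p x q matrices: nonzero matrices up to
   scaling, with the quotient topology. *)
Section Projectivization.
Variables (C : numClosedFieldType) (p q : nat).

Definition nonzero_mx : Type := ([set v | v != 0] : set 'M[C]_(p, q)).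
HB.instance Definition _ := Topological.copy nonzero_mx
  (set_type ([set v | v != 0] : set 'M[C]_(p, q))).

Definition mx_of_nonzero (v : nonzero_mx) : 'M[C]_(p, q) := set_val v.

Definition proportional : rel nonzero_mx := fun u v =>
  `[< exists c : C, mx_of_nonzero v = c *: mx_of_nonzero u >].

Lemma nonzero_mxP (v : nonzero_mx) : mx_of_nonzero v != 0.
Proof. exact: (set_valP v). Qed.

Lemma proportional_equiv : equiv_class_of proportional.
Proof.
split.
- by move=> v; apply/asboolP; exists 1; rewrite scale1r.
- have sym u v : proportional u v -> proportional v u.
    move=> /asboolP[c e]; apply/asboolP; exists c^-1.
    have c0 : c != 0.
      by apply/eqP => c0; have := nonzero_mxP v; rewrite e c0 scale0r eqxx.
    by rewrite e scalerA mulVf // scale1r.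
  by move=> u v; apply/idP/idP; exact: sym.
- move=> v u w /asboolP[c e] /asboolP[d e']; apply/asboolP; exists (d * c).
  by rewrite e' e scalerA.
Qed.

Canonical proportional_equiv_rel := EquivRelPack proportional_equiv.

Definition projectivization : Type := quotient_topology {eq_quot proportional}.
HB.instance Definition _ := Topological.copy projectivization
  (quotient_topology {eq_quot proportional}).

Definition proj_class (v : 'M[C]_(p, q)) (v0 : v != 0) : projectivization :=
  \pi_({eq_quot proportional}) (SigSub (mem_set (v0 : [set v | v != 0] v))).

(* A choice of homogeneous coordinates, well defined up to a nonzero scalar;
   every use below is invariant under rescaling. *)
Definition hcoord (x : projectivization) : 'M[C]_(p, q) :=
  mx_of_nonzero (repr (x : {eq_quot proportional})).

End Projectivization.

Lemma proj_class_hcoord (C : numClosedFieldType) p q (v : 'M[C]_(p, q)) (v0 : v != 0) :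
  exists2 c : C, c != 0 & hcoord (proj_class v0) = c *: v.
Proof.
set u : nonzero_mx C p q := SigSub (mem_set (v0 : [set v | v != 0] v)).
have /eqmodP/asboolP[c e] : repr (proj_class v0 : {eq_quot @proportional C p q}) = u %[mod {eq_quot @proportional C p q}].
  by rewrite reprK.
have c0 : c != 0.
  by apply/eqP => c0; have := nonzero_mxP u; rewrite e c0 scale0r eqxx.
exists c^-1; first by rewrite invr_eq0.
by rewrite -[RHS]/(c^-1 *: mx_of_nonzero u) e scalerA mulVf // scale1r.
Qed.

Lemma hcoord_eq (C : numClosedFieldType) p q (x y : projectivization C p q) (c : C) :
  hcoord y = c *: hcoord x -> x = y.
Proof.
move=> e; rewrite -[x](@reprK _ {eq_quot @proportional C p q}) -[y](@reprK _ {eq_quot @proportional C p q}).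
by apply/eqmodP/asboolP; exists c.
Qed.

Section ProjectiveGeometry.
Variables (C : numClosedFieldType) (n : nat).

(* CP^n and its dual: points are rows [x_0 : ... : x_n], hyperplanes are
   columns. The affine chart is x_0 = 1. *)
Definition CP := projectivization C 1 (1 + n).
Definition dualCP := projectivization C (1 + n) 1.

Lemma affine_point_subproof (z : 'rV[C]_n) : row_mx (1%:M : 'M[C]_1) z != 0.
Proof.
apply/eqP => /matrixP/(_ 0 (lshift n 0)).
by rewrite row_mxEl !mxE eqxx => /eqP; rewrite oner_eq0.
Qed.

Definition affine_point (z : 'rV[C]_n) : CP := proj_class (affine_point_subproof z).

Definition CPinf : set CP := ~` range affine_point.

Lemma Hinf_subproof : col_mx (1%:M : 'M[C]_1) (0 : 'cV[C]_n) != 0.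
Proof.
apply/eqP => /matrixP/(_ (lshift n 0) 0).
by rewrite col_mxEu !mxE eqxx => /eqP; rewrite oner_eq0.
Qed.

(* The hyperplane x_0 = 0. *)
Definition Hinf : dualCP := proj_class Hinf_subproof.

(* The vector hyperplane of C^(n+1) over [L]; it is also the affine cone over
   the tangent space of [L] at each of its points. *)
Definition hyperplane_cone (L : dualCP) : set 'rV[C]_(1 + n) :=
  [set v | v *m hcoord L = 0].

Definition hyperplane_points (L : dualCP) : set CP :=
  [set x | hyperplane_cone L (hcoord x)].

End ProjectiveGeometry.

Lemma hyperplane_points_Hinf (C : numClosedFieldType) n :
  hyperplane_points (Hinf C n) = @CPinf C n.
Proof.
have [c c0 cE] := proj_class_hcoord (Hinf_subproof C n).
have hE (v : 'rV[C]_(1 + n)) : hyperplane_cone (Hinf C n) v <-> lsubmx v = 0.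
  rewrite /hyperplane_cone /= /Hinf cE -scalemxAr -[v in v *m _]hsubmxK mul_row_col mulmx0 mulmx1 addr0.
  split=> [/eqP|->]; last by rewrite scaler0.
  by rewrite scaler_eq0 (negbTE c0) => /eqP.
apply/seteqP; split=> x /=.
  move=> /hE x0 [z _ zx].
  have [d d0 dE] := proj_class_hcoord (affine_point_subproof z).
  move: x0; rewrite -zx /affine_point dE => /matrixP/(_ 0 0).
  by rewrite [LHS]mxE mxE row_mxEl !mxE eqxx mulr1 => /eqP; rewrite (negbTE d0).
move=> nx; apply/hE/matrixP => i j; rewrite !ord1 [RHS]mxE.
apply: contrapT => /eqP x0; apply: nx.
pose a := lsubmx (hcoord x) 0 0.
exists (a^-1 *: rsubmx (hcoord x)) => //.
have [d d0 dE] := proj_class_hcoord (affine_point_subproof (a^-1 *: rsubmx (hcoord x))).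
apply: (@hcoord_eq _ _ _ _ _ (a / d)).
rewrite /affine_point dE scalerA divfK // scale_row_mx scalerA divff // scale1r.
rewrite scalemx1 -[LHS]hsubmxK; congr row_mx.
by rewrite [LHS]mx11_scalar.
Qed.

Section Quadrics.
Variables (C : numClosedFieldType) (n : nat).

(* The kernel of the differential of [g] at [x]. For [g] homogeneous this is
   the affine cone over the embedded tangent space of {g = 0}. *)
Definition tangent_space k (g : mpoly k C) (x : 'rV[C]_k) : set 'rV[C]_k :=
  [set v | \sum_(i < k) meval (x 0) (mderiv i g) * v 0 i = 0].

Definition homogenization (f : mpoly n C) : mpoly (1 + n) C :=
  \sum_(m <- msupp f) mcoeff m f *:
    (mpolyX C (mnm1 (lshift n 0)) ^+ ((msize f).-1 - mdeg m) *
     \prod_(i < n) mpolyX C (mnm1 (rshift 1 i)) ^+ m i).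

Lemma homogenization_affine (f : mpoly n C) (z : 'rV[C]_n) :
  meval (row_mx (1%:M : 'M[C]_1) z 0) (homogenization f) = meval (z 0) f.
Proof.
rewrite /homogenization [in LHS]raddf_sum /= [in RHS](mpolyE f) [in RHS]raddf_sum /=.
apply: eq_bigr => m _; rewrite !mevalZ mevalM rmorphXn /= mevalXU row_mxEl !mxE eqxx expr1n mul1r.
congr (_ * _); rewrite mevalX rmorph_prod /=; apply: eq_bigr => i _.
by rewrite rmorphXn /= mevalXU row_mxEr.
Qed.

Variable f : mpoly n C.

Definition zero_set : set 'rV[C]_n := [set z | meval (z 0) f = 0].

Definition zero_closure : set (CP C n) := closure (@affine_point C n @` zero_set).

(* The Jacobian criterion for the equation of the closure; in particular the
   equation is reduced, which excludes the square of a linear polynomial. *)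
Definition smooth_closure : Prop :=
  forall x, zero_closure x ->
    exists i, meval (hcoord x 0) (mderiv i (homogenization f)) != 0.

Definition closure_transversal_at_infinity : Prop :=
  forall x, zero_closure x -> CPinf x ->
  forall v, exists u w,
    [/\ tangent_space (homogenization f) (hcoord x) u,
        hyperplane_cone (Hinf C n) w & v = u + w].

(* [msize] is the degree plus one. *)
Definition nondegenerate_quadric : Prop :=
  [/\ msize f = 3, smooth_closure & closure_transversal_at_infinity].

(* The hyperplanes tangent to the zero set at a point of C^n; [row_mx 0 w] is
   the direction [w] of C^n. *)
Definition tangent_hyperplanes : set (dualCP C n) :=
  [set L | exists z : 'rV[C]_n,
    [/\ zero_set z, hyperplane_points L (affine_point z) &
        tangent_space f z = [set w | hyperplane_cone L (row_mx 0 w)]]].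

(* Tangency in CP^n_infinity of the traces of [L] and of the closure: a common
   point at which the tangent spaces of the traces are equal. *)
Definition asymptotic_hyperplanes : set (dualCP C n) :=
  [set L | L <> Hinf C n /\ exists x,
    [/\ zero_closure x, CPinf x, hyperplane_points L x &
        tangent_space (homogenization f) (hcoord x) `&` hyperplane_cone (Hinf C n)
        = hyperplane_cone L `&` hyperplane_cone (Hinf C n)]].

Definition general_position : set (dualCP C n) :=
  ~` (tangent_hyperplanes `|` (asymptotic_hyperplanes `|` [set Hinf C n])).

End Quadrics.

(* Main.v *)
(* Translate the quadric to its centre and diagonalise its quadratic part: in
   suitable coordinates A is {z_1^2 + ... + z_n^2 = 1}, and the hyperplane
   {u . z = tau} is tangent to A iff tau^2 = u . u <> 0, asymptotic iff
   u . u = 0 <> u. Normalising u . u = 1, which leaves the sign of (tau, u) free,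
   E becomes the quotient of (C minus {1, -1}) x S by (tau, u) |-> (- tau, - u),
   where S = {u . u = 1} is the complex sphere. S is simply connected for n >= 3,
   being a homotopy retract of the punctured R^n. Hence pi_1(E)
   is an extension of Z/2, generated by a path from u to - u in S, by the free
   group on the loops alpha and beta around 1 and -1, which the involution
   exchanges. The isomorphism is obtained by evaluating the generators on explicit
   loops; its inverse is the holonomy of a local system of torsors under
   < alpha, beta, kappa > given by transition functions between charts. *)
Require Import Defs.
From HB Require Import structures.
From mathcomp Require Import all_boot all_order all_algebra generic_quotient.
From mathcomp Require Import complex.
From mathcomp Require Import -(notations) mpoly.
From mathcomp Require Import all_classical all_reals topology normedtype homotopy.
From mathcomp Require Import realfun.
From mathcomp Require Import zify ring lra.
Import Order.TTheory GRing.Theory Num.Theory.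
Import numFieldNormedType.Exports.
Set Implicit Arguments. Unset Strict Implicit. Unset Printing Implicit Defensive.
Local Open Scope classical_set_scope.
Local Open Scope ring_scope.
Local Open Scope quotient_scope.

(** * Homotopy classes of paths *)

(** Two things need proof: that no further relation holds, and that every loop is a word in the
    generators. Both come from comparing two families over the same charts: the transition
    functions, with values in the presented group, and the classes of standard paths from the base
    point to the points of a chart. By [over_agree] the second family changes by the image of the
    first under the evaluation map [phi]. Continuing along a loop [a] then gives [a = phi (psi a)],
    with [psi] the holonomy, so [psi] is injective; it is onto because each element is realised by a
    loop. The topology that enters is the convexity of five cells of the plane, the simple
    connectedness of S, which makes the choice of paths in S irrelevant, and subdivision of
    intervals and squares. Paths are total maps on the real line with values in a set [A] and with
    their endpoints in the type, so that classes form a groupoid. The price is [pcast], for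
    endpoints that are equal but not convertible. *)

Section HeineBorelInduction.
Variable R : realType.

(** Compactness of the unit interval in the form used throughout, for a relation that is additive
    and holds on short intervals. The supremum of the [s] with [P 0 s] is attained, and it cannot be
    less than 1 because [P] continues past it. *)
Lemma interval_induction (P : R -> R -> Prop) :
  (forall a b c, 0 <= a -> a <= b -> b <= c -> c <= 1 -> P a b -> P b c -> P a c) ->
  (forall x, 0 <= x <= 1 -> exists2 e : R, 0 < e &
     forall a b, x - e < a -> a <= b -> b < x + e -> 0 <= a -> b <= 1 -> P a b) ->
  P 0 1.
Proof.
move=> Padd Ploc.
pose S : set R := [set s | 0 <= s <= 1 /\ P 0 s].
have S0 : S 0.
  have [e e0 He] := Ploc 0 (introT andP (conj (lexx 0) ler01)).
  by split; [rewrite lexx ler01 | apply: He; lra].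
have Sub : ubound S 1 by move=> s [/andP[]].
have hS : has_sup S by split; [exists 0 | exists 1].
have m0 : 0 <= sup S by apply: ub_le_sup => //; exists 1.
have m1 : sup S <= 1 by apply: ge_sup => //; exists 0.
have [e e0 He] := Ploc (sup S) (introT andP (conj m0 m1)).
have [s Ss es] := sup_adherent e0 hS.
have sm : s <= sup S by apply: ub_le_sup => //; exists 1.
have [/andP[s0 s1] Ps] := Ss.
have up b : sup S <= b -> b < sup S + e -> b <= 1 -> P 0 b.
  by move=> h1 h2 h3; apply: (Padd _ s) => //; [lra | apply: He; lra].
have [m1'|m1'] := ltP (sup S) 1; last by apply: up; lra.
pose b := Num.min 1 (sup S + e / 2).
have b1 : b <= 1 by rewrite ge_min lexx.
have bm : sup S < b by rewrite lt_min m1' /=; lra.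
have be : b < sup S + e by rewrite gt_min; apply/orP; right; lra.
suff : S b by move=> /(ub_le_sup (ex_intro _ 1 Sub)); lra.
by split; [lra | apply: up => //; lra].
Qed.

End HeineBorelInduction.

Section Clamp.
Context {R : realType}.

(** Retraction of the line onto the unit interval: data meaningful only over the interval become
    total by composition with it. *)
Definition clamp (s : R) : R := Num.max 0 (Num.min 1 s).

Lemma clampK s : 0 <= s <= 1 -> clamp s = s.
Proof. by case/andP=> h0 h1; rewrite /clamp min_r // max_r. Qed.

Lemma clamp_in s : 0 <= clamp s <= 1.
Proof. by rewrite /clamp le_max lexx /= ge_max ler01 ge_min lexx. Qed.

Lemma clamp0 : clamp 0 = 0. Proof. by rewrite clampK // lexx ler01. Qed.
Lemma clamp1 : clamp 1 = 1. Proof. by rewrite clampK // lexx ler01. Qed.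

Lemma clamp_cont : continuous clamp.
Proof. by apply: rcontmax; [exact: rcontC | apply: rcontmin; [exact: rcontC | move=> ?; exact: cvg_id]]. Qed.

End Clamp.

Section PathClasses.
Context {R : realType} {X : topologicalType}.
Implicit Types (A : set X) (x y z : X).

(** Total maps avoid subspaces and dependent domains; only the restriction to the unit interval
    matters for the homotopy class. With the endpoints as parameters, composability is a matter of
    typing. *)
Record path_in A x y := PathIn {
  path_fun :> R -> X;
  path_cont : continuous path_fun;
  path_val : forall s, A (path_fun s);
  path_src : path_fun 0 = x;
  path_tgt : path_fun 1 = y }.

(** The boundary conditions concern the unit square only, so paths that agree on the unit interval
    are homotopic. Continuity and membership in [A] are asked on the whole plane, which keeps
    pasting free of side conditions. *)
Definition path_homotopic A (p q : R -> X) := exists H : R * R -> X,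
  [/\ continuous H, forall w, A (H w),
      forall s, 0 <= s <= 1 -> H (s, 0) = p s,
      forall s, 0 <= s <= 1 -> H (s, 1) = q s &
      forall t, 0 <= t <= 1 -> H (0, t) = p 0 /\ H (1, t) = p 1].

Definition cat_fun (p q : R -> X) (s : R) := if s <= 2^-1 then p (2 * s) else q (2 * s - 1).

Lemma cat_fun0 p q : cat_fun p q 0 = p 0.
Proof. by rewrite /cat_fun invr_ge0 ler0n mulr0. Qed.

Lemma cat_fun1 p q : cat_fun p q 1 = q 1.
Proof. by rewrite /cat_fun ifF; [congr q; lra | apply/negbTE; rewrite -ltNge; lra]. Qed.

End PathClasses.

Arguments path_cont {R X A x y} p.
Arguments path_val {R X A x y} p s.
Arguments path_src {R X A x y} p.
Arguments path_tgt {R X A x y} p.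

Section RealContinuity.
Context {R : realType} {T : topologicalType}.

Lemma cont_comp (X Y : topologicalType) (p : X -> Y) (a : T -> X) :
  continuous p -> continuous a -> continuous (fun t => p (a t)).
Proof. by move=> cp ca t; apply: continuous_comp; [exact: ca|exact: cp]. Qed.

Lemma cont_comp_at (X Y : topologicalType) (A : set X) (p : X -> Y) (a : T -> X) :
  {in A, continuous p} -> (forall t, A (a t)) -> continuous a ->
  continuous (fun t => p (a t)).
Proof.
by move=> cp Aa ca t; apply: continuous_comp; [exact: ca|apply: cp; exact/mem_set].
Qed.

Lemma rcontB (a b : T -> R) :
  continuous a -> continuous b -> continuous (fun t => a t - b t).
Proof. by move=> ca cb t; apply: continuousB; [exact: ca | exact: cb]. Qed.

Lemma cont_pair (X Y : topologicalType) (a : T -> X) (b : T -> Y) :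
  continuous a -> continuous b -> continuous (fun t => (a t, b t)).
Proof. by move=> ca cb t; apply: cvg_pair; [exact: ca|exact: cb]. Qed.

End RealContinuity.

Lemma cont_fst (T U : topologicalType) : continuous (@fst T U).
Proof. by move=> z; exact: cvg_fst. Qed.

Lemma cont_snd (T U : topologicalType) : continuous (@snd T U).
Proof. by move=> z; exact: cvg_snd. Qed.

Lemma cont_id (T : topologicalType) : continuous (fun t : T => t).
Proof. by move=> ?; exact: cvg_id. Qed.

Ltac rcont := lazymatch goal with
  | |- forall _, continuous_at _ ?f =>
    first [assumption | lazymatch f with
    | (fun x => x) => exact: cont_id
    | @fst _ _ => exact: cont_fst
    | @snd _ _ => exact: cont_snd
    | (fun _ => ?c) => exact: cst_continuous
    | (fun x => (@?a x, @?b x)) => apply: (@cont_pair _ _ _ a b); rcont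
    | (fun x => GRing.add (@?a x) (GRing.opp (@?b x))) => apply: (@rcontB _ _ a b); rcont
    | (fun x => GRing.add (@?a x) (@?b x)) => apply: (@rcontD _ _ a b); rcont
    | (fun x => GRing.opp (@?a x)) => apply: (@rcontN _ _ a); rcont
    | (fun x => GRing.mul (@?a x) (@?b x)) => apply: (@rcontM _ _ a b); rcont
    | (fun x => Order.max (@?a x) (@?b x)) => apply: (@rcontmax _ _ a b); rcont
    | (fun x => Order.min (@?a x) (@?b x)) => apply: (@rcontmin _ _ a b); rcont
    | (fun x => fst (@?a x)) => apply: (@cont_comp _ _ _ fst a); [exact: cont_fst|rcont]
    | (fun x => snd (@?a x)) => apply: (@cont_comp _ _ _ snd a); [exact: cont_snd|rcont]
    | (fun x => ?h (@?a x)) => apply: (@cont_comp _ _ _ h a); [first [assumption | exact: clamp_cont] | rcont]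
    | _ => idtac
    end]
  | _ => idtac
  end.

Section PathGroupoid.
Context {R : realType} {X : topologicalType}.
Implicit Types (A : set X) (x y z : X) (p q r : R -> X).

Lemma cat_continuous p q :
  continuous p -> continuous q -> p 1 = q 0 -> continuous (cat_fun p q).
Proof.
move=> cp cq pq; apply: paste_continuous; rcont.
by move=> s ->; rewrite (_ : 2 * _ = 1) ?subrr //; lra.
Qed.

Lemma cat_val A p q : (forall s, A (p s)) -> (forall s, A (q s)) ->
  forall s, A (cat_fun p q s).
Proof. by move=> Ap Aq s; rewrite /cat_fun; case: ifP. Qed.

(** The straight-line homotopy takes place in the parameter of [r] and therefore never leaves [A].
    The groupoid laws are instances of this. *)
Lemma path_homotopic_reparam A p q r (phi psi : R -> R) :
  continuous r -> (forall s, A (r s)) -> continuous phi -> continuous psi ->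
  phi 0 = psi 0 -> phi 1 = psi 1 ->
  (forall s, 0 <= s <= 1 -> p s = r (phi s)) ->
  (forall s, 0 <= s <= 1 -> q s = r (psi s)) ->
  path_homotopic A p q.
Proof.
move=> cr Ar cphi cpsi e0 e1 pE qE.
exists (fun st => r (phi st.1 + st.2 * (psi st.1 - phi st.1))); split => /=.
- have c1 : continuous (fun st : R * R => phi st.1) by rcont.
  have c2 : continuous (fun st : R * R => psi st.1) by rcont.
  by rcont.
- by [].
- by move=> s /pE ->; rewrite mul0r addr0.
- by move=> s /qE ->; rewrite mul1r; congr r; ring.
- move=> t _; rewrite -e0 -e1 !subrr !mulr0 !addr0 !pE ?lexx ?ler01 //.
Qed.

Lemma path_homotopic_refl A p :
  continuous p -> (forall s, A (p s)) -> path_homotopic A p p.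
Proof.
by move=> cp Ap; apply: (@path_homotopic_reparam _ _ _ p id id) => //; exact: cont_id.
Qed.

Lemma path_homotopic_ends A p q : path_homotopic A p q -> p 0 = q 0 /\ p 1 = q 1.
Proof.
case=> H [_ _ _ H1 He]; rewrite -!H1 ?lexx ?ler01 //.
by have [] := He 1 (introT andP (conj ler01 (lexx 1))).
Qed.

Lemma path_homotopic_sym A p q : path_homotopic A p q -> path_homotopic A q p.
Proof.
move=> h; have [e0 e1] := path_homotopic_ends h; case: h => H [cH AH H0 H1 He].
exists (fun st => H (st.1, 1 - st.2)); split => //=.
- by rcont.
- by move=> s hs; rewrite subr0 H1.
- by move=> s hs; rewrite subrr H0.
- by move=> t ht; rewrite -e0 -e1; apply: He; lra.
Qed.

Lemma path_homotopic_trans A q p r :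
  path_homotopic A p q -> path_homotopic A q r -> path_homotopic A p r.
Proof.
move=> h; have [e0 e1] := path_homotopic_ends h.
case: h => H [cH AH H0 H1 He] [K [cK AK K0 K1 Ke]].
exists (fun st => if st.2 <= 2^-1 then H (clamp st.1, 2 * st.2)
                  else K (clamp st.1, 2 * st.2 - 1)).
split => /=.
- apply: paste_continuous; first by rcont.
  + by rcont.
  + by rcont.
  + move=> st ->; rewrite (_ : 2 * _ = 1); last by lra.
    by rewrite subrr H1 ?clamp_in // K0 ?clamp_in.
- by move=> w; case: ifP.
- by move=> s hs; rewrite invr_ge0 ler0n mulr0 clampK // H0.
- move=> s hs; rewrite ifF; last by apply/negbTE; rewrite -ltNge; lra.
  by rewrite (_ : 2 * 1 - 1 = 1) ?clampK ?K1 //; lra.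
- move=> t ht; rewrite !clampK ?lexx ?ler01 //; case: leP => h.
    by apply: He; lra.
  by rewrite e0 e1; apply: Ke; lra.
Qed.

Lemma cat_homotopic A p p' q q' : p 1 = q 0 ->
  path_homotopic A p p' -> path_homotopic A q q' ->
  path_homotopic A (cat_fun p q) (cat_fun p' q').
Proof.
move=> pq [H [cH AH H0 H1 He]] [K [cK AK K0 K1 Ke]].
exists (fun st => if st.1 <= 2^-1 then H (2 * st.1, clamp st.2)
                  else K (2 * st.1 - 1, clamp st.2)).
split => /=.
- apply: paste_continuous; first by rcont.
  + by rcont.
  + by rcont.
  + move=> st ->; rewrite (_ : 2 * _ = 1); last by lra.
    by rewrite subrr; have [_ ->] := He _ (clamp_in st.2); have [-> _] := Ke _ (clamp_in st.2).
- by move=> w; case: ifP.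
- move=> s hs; rewrite clampK ?lexx ?ler01 // /cat_fun; case: leP => h.
    by rewrite H0 //; lra.
  by rewrite K0 //; lra.
- move=> s hs; rewrite clampK ?lexx ?ler01 // /cat_fun; case: leP => h.
    by rewrite H1 //; lra.
  by rewrite K1 //; lra.
- move=> t ht; rewrite clampK // /cat_fun invr_ge0 ler0n mulr0.
  rewrite !ifF; [|by apply/negbTE; rewrite -ltNge; lra..].
  rewrite (_ : 2 * 1 - 1 = 1) ; last by lra.
  by have [-> _] := He _ ht; have [_ ->] := Ke _ ht.
Qed.

Lemma rev_homotopic A p q : path_homotopic A p q ->
  path_homotopic A (fun s => p (1 - s)) (fun s => q (1 - s)).
Proof.
move=> [H [cH AH H0 H1 He]]; exists (fun st => H (1 - st.1, st.2)); split => //=.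
- by rcont.
- by move=> s hs; rewrite H0 //; lra.
- by move=> s hs; rewrite H1 //; lra.
- by move=> t ht; rewrite subr0 subrr; have [-> ->] := He _ ht.
Qed.

Lemma eq_homotopic A p q : continuous p -> (forall s, A (p s)) ->
  (forall s, 0 <= s <= 1 -> p s = q s) -> path_homotopic A p q.
Proof.
move=> cp Ap pq; apply: (@path_homotopic_reparam _ _ _ p id id) => //;
  try exact: cont_id; by move=> s /pq.
Qed.

Lemma cat_comp p (a b : R -> R) s :
  cat_fun (fun s => p (a s)) (fun s => p (b s)) s =
  p (if s <= 2^-1 then a (2 * s) else b (2 * s - 1)).
Proof. by rewrite /cat_fun; case: ifP. Qed.

(** Both factors run along one path [p], so their concatenation is again a reparametrisation of [p].
    This covers the unit and inverse laws and the subdivision [psub_cat]. *)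
Lemma cat_reparam A p (a b c : R -> R) :
  continuous p -> (forall s, A (p s)) ->
  continuous a -> continuous b -> continuous c ->
  a 0 = c 0 -> a 1 = b 0 -> b 1 = c 1 ->
  path_homotopic A (cat_fun (fun s => p (a s)) (fun s => p (b s))) (fun s => p (c s)).
Proof.
move=> cp Ap ca cb cc e0 e01 e1.
have -> : cat_fun (fun s => p (a s)) (fun s => p (b s)) =
    fun s => p (if s <= 2^-1 then a (2 * s) else b (2 * s - 1)).
  by apply/funext => s; exact: cat_comp.
apply: (@path_homotopic_reparam _ _ _ p
  (fun s => if s <= 2^-1 then a (2 * s) else b (2 * s - 1)) c) => //.
- apply: paste_continuous; rcont.
  by move=> s ->; rewrite (_ : 2 * _ = 1) ?subrr //; lra.
- by rewrite invr_ge0 ler0n mulr0.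
- by rewrite ifF; [rewrite -e1; congr b; lra|apply/negbTE; rewrite -ltNge; lra].
Qed.

End PathGroupoid.

Section PathQuotient.
Context {R : realType} {X : topologicalType}.
Implicit Types (A : set X) (x y z : X).

HB.instance Definition _ A x y := gen_eqMixin (@path_in R X A x y).
HB.instance Definition _ A x y := gen_choiceMixin (@path_in R X A x y).

Definition path_eqv A x y : rel (@path_in R X A x y) :=
  fun p q => `[< path_homotopic A p q >].

Lemma path_eqv_equiv A x y : equiv_class_of (@path_eqv A x y).
Proof.
split.
- by move=> p; apply/asboolP/path_homotopic_refl; [exact: path_cont|exact: path_val].
- by move=> p q; apply/asboolP/asboolP; exact: path_homotopic_sym.
- move=> q p r /asboolP pq /asboolP qr; apply/asboolP.
  exact: path_homotopic_trans pq qr.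
Qed.

Canonical path_eqv_equiv_rel A x y := EquivRelPack (@path_eqv_equiv A x y).

Definition pi1 A x y : Type := {eq_quot (@path_eqv A x y)}.

Definition pcls A x y (p : @path_in R X A x y) : pi1 A x y :=
  \pi_({eq_quot (@path_eqv A x y)}) p.

Lemma pclsP A x y (p q : path_in A x y) : path_homotopic A p q <-> pcls p = pcls q.
Proof.
split=> [h|e]; first by apply/eqmodP/asboolP.
by have /eqmodP/asboolP := e.
Qed.

Lemma pcls_surj A x y (a : pi1 A x y) : exists p, a = pcls p.
Proof. by exists (repr a); rewrite -[LHS]reprK. Qed.

Lemma eq_pcls A x y (p q : path_in A x y) :
  (forall s, 0 <= s <= 1 -> p s = q s) -> pcls p = pcls q.
Proof.
by move=> h; apply/pclsP/eq_homotopic; [exact: path_cont|exact: path_val|].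
Qed.

Lemma pcls_repr A x y (a : pi1 A x y) :
  pcls (repr (a : {eq_quot (@path_eqv A x y)})) = a.
Proof. exact: reprK. Qed.

End PathQuotient.

Arguments pi1 R {X} A x y.

Section PathOperations.
Context {R : realType} {X : topologicalType} {A : set X}.
Implicit Types x y z w : X.
Local Notation path_in := (@path_in R X A).
Local Notation pi1 := (@pi1 R X A).

Definition pcat x y z (p : path_in x y) (q : path_in y z) : path_in x z.
Proof.
exists (cat_fun p q).
- apply: cat_continuous; [exact: path_cont|exact: path_cont|].
  by rewrite path_tgt path_src.
- by apply: cat_val; exact: path_val.
- by rewrite cat_fun0 path_src.
- by rewrite cat_fun1 path_tgt.
Defined.

Definition prev x y (p : path_in x y) : path_in y x.
Proof.
exists (fun s => p (1 - s)).
- by have := path_cont p => cp; rcont.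
- by move=> s; exact: path_val.
- by rewrite subr0 path_tgt.
- by rewrite subrr path_src.
Defined.

Definition pcst x (Ax : A x) : path_in x x :=
  @PathIn R X A x x (fun=> x) (@cst_continuous _ _ x) (fun=> Ax) erefl erefl.

Definition pmul x y z (a : pi1 x y) (b : pi1 y z) : pi1 x z :=
  pcls (pcat (repr a) (repr b)).
Definition pinv x y (a : pi1 x y) : pi1 y x := pcls (prev (repr a)).
Definition pone x (Ax : A x) : pi1 x x := pcls (pcst Ax).

Lemma pmulE x y z (p : path_in x y) (q : path_in y z) :
  pmul (pcls p) (pcls q) = pcls (pcat p q).
Proof.
apply/pclsP; apply: cat_homotopic; first by rewrite path_tgt path_src.
all: by apply/pclsP; rewrite pcls_repr.
Qed.

Lemma pinvE x y (p : path_in x y) : pinv (pcls p) = pcls (prev p).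
Proof. by apply/pclsP; apply: rev_homotopic; apply/pclsP; rewrite pcls_repr. Qed.

Lemma pmulA x y z w (a : pi1 x y) (b : pi1 y z) (c : pi1 z w) :
  pmul a (pmul b c) = pmul (pmul a b) c.
Proof.
have [p ->] := pcls_surj a; have [q ->] := pcls_surj b; have [r ->] := pcls_surj c.
rewrite !pmulE; apply/pclsP => /=.
have cp := path_cont p; have cq := path_cont q; have cr := path_cont r.
(* The three paths in succession over [0, 3]; both bracketings are reparametrisations of [g]. *)
pose g s := if s <= 1 then p s else if s <= 2 then q (s - 1) else r (s - 2).
have cg : continuous g.
  apply: paste_continuous; rcont.
    apply: paste_continuous; rcont.
    move=> s ->; rewrite (_ : 2 - 1 = 1) ?subrr ?path_tgt ?path_src //; lra.
  by move=> s ->; rewrite ifT ?subrr ?path_tgt ?path_src //; lra.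
have Ag s : A (g s) by rewrite /g; do 2?case: ifP => _; exact: path_val.
have pE s : 0 <= s <= 1 -> g s = p s by move=> hs; rewrite /g ifT //; lra.
have qE s : 0 <= s <= 1 -> g (s + 1) = q s.
  move=> hs; rewrite /g; case: leP => h1; last by rewrite ifT ?addrK //; lra.
  have -> : s = 0 by lra.
  by rewrite add0r path_tgt path_src.
have rE s : 0 <= s <= 1 -> g (s + 2) = r s.
  move=> hs; rewrite /g ifF; last by apply/negbTE; rewrite -ltNge; lra.
  case: leP => h1; last by rewrite addrK.
  have -> : s = 0 by lra.
  by rewrite add0r (_ : 2 - 1 = 1) ?path_tgt ?path_src //; lra.
apply: (@path_homotopic_reparam R X A _ _ g
  (cat_fun (fun s => s) (cat_fun (fun s => s + 1) (fun s => s + 2)))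
  (cat_fun (cat_fun (fun s => s) (fun s => s + 1)) (fun s => s + 2))) => //.
- apply: cat_continuous; rcont; last by rewrite cat_fun0 add0r.
  by apply: cat_continuous; rcont; lra.
- apply: cat_continuous; rcont; last by rewrite cat_fun1; lra.
  by apply: cat_continuous; rcont; lra.
- by rewrite !cat_fun0.
- by rewrite !cat_fun1.
- move=> s hs; rewrite /cat_fun; case: leP => h1; first by rewrite pE //; lra.
  by case: leP => h2; [rewrite qE //; lra|rewrite rE //; lra].
- move=> s hs; rewrite /cat_fun; case: leP => h1; last by rewrite rE //; lra.
  by case: leP => h2; [rewrite pE //; lra|rewrite qE //; lra].
Qed.

Lemma pmul1p x y (Ax : A x) (a : pi1 x y) : pmul (pone Ax) a = a.
Proof.
have [p ->] := pcls_surj a; rewrite pmulE; apply/pclsP => /=.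
have := @cat_reparam R X A p (fun=> 0) (fun s => s) (fun s => s).
rewrite path_src; apply; rcont => //; [exact: path_cont|exact: path_val].
Qed.

Lemma pmulp1 x y (Ay : A y) (a : pi1 x y) : pmul a (pone Ay) = a.
Proof.
have [p ->] := pcls_surj a; rewrite pmulE; apply/pclsP => /=.
have := @cat_reparam R X A p (fun s => s) (fun=> 1) (fun s => s).
rewrite path_tgt; apply; rcont => //; [exact: path_cont|exact: path_val].
Qed.

Lemma pmulpV x y (Ax : A x) (a : pi1 x y) : pmul a (pinv a) = pone Ax.
Proof.
have [p ->] := pcls_surj a; rewrite pinvE pmulE; apply/pclsP => /=.
have := @cat_reparam R X A p (fun s => s) (fun s => 1 - s) (fun=> 0).
rewrite path_src; apply; rcont => //; [exact: path_cont|exact: path_val|lra..].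
Qed.

Lemma pmulVp x y (Ay : A y) (a : pi1 x y) : pmul (pinv a) a = pone Ay.
Proof.
have [p ->] := pcls_surj a; rewrite pinvE pmulE; apply/pclsP => /=.
have := @cat_reparam R X A p (fun s => 1 - s) (fun s => s) (fun=> 1).
rewrite path_tgt; apply; rcont => //; [exact: path_cont|exact: path_val|lra..].
Qed.

Lemma pmulKp x y z (a : pi1 x y) (b : pi1 y z) : pmul (pinv a) (pmul a b) = b.
Proof.
have Ay : A y by have [p _] := pcls_surj b; rewrite -(path_src p); exact: path_val.
by rewrite pmulA (pmulVp Ay) pmul1p.
Qed.

Lemma pmulpI x y z (a : pi1 x y) (b c : pi1 y z) : pmul a b = pmul a c -> b = c.
Proof. by move=> /(congr1 (pmul (pinv a))); rewrite !pmulKp. Qed.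

Lemma pmulIp x y z (a b : pi1 x y) (c : pi1 y z) : pmul a c = pmul b c -> a = b.
Proof.
have Ay : A y by have [p _] := pcls_surj c; rewrite -(path_src p); exact: path_val.
by move=> /(congr1 (fun d => pmul d (pinv c))); rewrite -!pmulA (pmulpV Ay) !pmulp1.
Qed.

(** The piece of [g] over [a, b], run over the unit interval. Clamping confines all its values to
    that piece, and [psub_cat] gives the additivity that [interval_induction] asks for. *)
Definition psub (g : R -> X) (cg : continuous g) (Ag : forall s, A (g s)) (a b : R) :
  path_in (g a) (g b).
Proof.
exists (fun s => g (a + clamp s * (b - a))).
- by rcont.
- by [].
- by rewrite clamp0 mul0r addr0.
- by rewrite clamp1 mul1r addrC subrK.
Defined.

Lemma psub_range (a b : R) s : a <= b ->
  a <= a + clamp s * (b - a) <= b.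
Proof.
move=> ab; have /andP[h0 h1] := clamp_in s.
by apply/andP; split; nra.
Qed.

Lemma psub_cat g (cg : continuous g) (Ag : forall s, A (g s)) a b c :
  pmul (pcls (psub cg Ag a b)) (pcls (psub cg Ag b c)) = pcls (psub cg Ag a c).
Proof.
rewrite pmulE; apply/pclsP; apply: cat_reparam => //; rcont.
- by rewrite clamp0 !mul0r.
- by rewrite clamp0 clamp1 mul1r mul0r; ring.
- by rewrite clamp1 !mul1r; ring.
Qed.

Lemma psub01 (g : R -> X) (cg : continuous g) (Ag : forall s, A (g s)) :
  pcls (psub cg Ag 0 1) = pcls (@PathIn R X A (g 0) (g 1) g cg Ag erefl erefl).
Proof.
by apply: eq_pcls => s hs /=; rewrite clampK // subr0 mulr1 add0r.
Qed.

End PathOperations.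

Section PathMap.
Context {R : realType} {X Y : topologicalType} {A : set X} {B : set Y}.
Variables (f : X -> Y) (cf : {in A, continuous f}) (fAB : forall x, A x -> B (f x)).

Definition pmap_path x y (p : @path_in R X A x y) : @path_in R Y B (f x) (f y).
Proof.
exists (fun s => f (p s)).
- by apply: (cont_comp_at cf); [exact: path_val|exact: path_cont].
- by move=> s; apply: fAB; exact: path_val.
- by rewrite path_src.
- by rewrite path_tgt.
Defined.

Definition pmap x y (a : pi1 R A x y) : pi1 R B (f x) (f y) :=
  pcls (pmap_path (repr a)).

Lemma homotopic_comp (p q : R -> X) : path_homotopic A p q ->
  path_homotopic B (fun s => f (p s)) (fun s => f (q s)).
Proof.
move=> [H [cH AH H0 H1 He]]; exists (fun w => f (H w)); split.
- exact: (cont_comp_at cf).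
- by move=> w; exact: fAB.
- by move=> s /H0 ->.
- by move=> s /H1 ->.
- by move=> t /He[-> ->].
Qed.

Lemma pmapE x y (p : path_in A x y) : pmap (pcls p) = pcls (pmap_path p).
Proof. by apply/pclsP; apply: homotopic_comp; apply/pclsP; rewrite pcls_repr. Qed.

Lemma pmapM x y z (a : pi1 R A x y) (b : pi1 R A y z) :
  pmap (pmul a b) = pmul (pmap a) (pmap b).
Proof.
have [p ->] := pcls_surj a; have [q ->] := pcls_surj b.
rewrite pmulE !pmapE [RHS]pmulE; apply: eq_pcls => s _ /=.
by rewrite /cat_fun; case: ifP.
Qed.

Lemma pmap1 x (Ax : A x) : pmap (pone Ax) = pone (fAB Ax).
Proof. by rewrite pmapE; apply: eq_pcls. Qed.

End PathMap.

Section PathPair.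
Context {R : realType} {X Y : topologicalType} {A : set X} {B : set Y}.

Definition ppair_path x y x' y' (p : @path_in R X A x y) (q : @path_in R Y B x' y') :
  @path_in R (X * Y)%type (A `*` B) (x, x') (y, y').
Proof.
exists (fun s => (p s, q s)).
- by have := path_cont p => cp; have := path_cont q => cq; rcont.
- by move=> s; split; exact: path_val.
- by rewrite !path_src.
- by rewrite !path_tgt.
Defined.

Definition ppair x y x' y' (a : pi1 R A x y) (b : pi1 R B x' y') :
  pi1 R (A `*` B) (x, x') (y, y') := pcls (ppair_path (repr a) (repr b)).

Lemma ppairE x y x' y' (p : path_in A x y) (q : path_in B x' y') :
  ppair (pcls p) (pcls q) = pcls (ppair_path p q).
Proof.
apply/pclsP; have /pclsP[H [cH AH H0 H1 He]] := pcls_repr (pcls p).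
have /pclsP[K [cK AK K0 K1 Ke]] := pcls_repr (pcls q).
exists (fun w => (H w, K w)); split => /=.
- by rcont.
- by move=> w; split.
- by move=> s hs; rewrite H0 // K0.
- by move=> s hs; rewrite H1 // K1.
- by move=> t ht; have [-> ->] := He t ht; have [-> ->] := Ke t ht.
Qed.

Lemma ppairM x y z x' y' z' (a : pi1 R A x y) (b : pi1 R A y z)
    (a' : pi1 R B x' y') (b' : pi1 R B y' z') :
  pmul (ppair a a') (ppair b b') = ppair (pmul a b) (pmul a' b').
Proof.
have [p ->] := pcls_surj a; have [q ->] := pcls_surj b.
have [p' ->] := pcls_surj a'; have [q' ->] := pcls_surj b'.
rewrite [pmul (pcls p) _]pmulE [pmul (pcls p') _]pmulE !ppairE pmulE; apply: eq_pcls => s _ /=.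
by rewrite /cat_fun; case: ifP.
Qed.

End PathPair.

Section Monodromy.
Context {R : realType} {X : topologicalType}.
Variables (A : set X) (x0 : X).

(** Preservation of [M] along paths inside small neighbourhoods propagates by [interval_induction]
    over the subpaths of [p]. *)
Lemma path_transport (M : forall x, pi1 R A x0 x -> Prop) :
  (forall x, A x -> exists2 U : set X, nbhs x U &
     forall y z (p : path_in A y z) (a : pi1 R A x0 y),
       (forall s, U (p s)) -> M y a -> M z (pmul a (pcls p))) ->
  forall y z (p : path_in A y z) a, M y a -> M z (pmul a (pcls p)).
Proof.
move=> Mloc y z p.
case: p => p cp Ap py pz; case: _ / py; case: _ / pz => a.
rewrite -(psub01 cp Ap); move: a.
apply: (@interval_induction R (fun s t => forall a, M (p s) a ->
  M (p t) (pmul a (pcls (psub cp Ap s t))))).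
  move=> s t u _ _ _ _ hst htu a Ma.
  by rewrite -(psub_cat cp Ap s t u) pmulA; apply/htu/hst.
move=> s _; have [U nU hU] := Mloc _ (Ap s).
have /(cp s)/nbhs_ballP[e /= e0 he] := nU.
exists e => // t u h1 h2 h3 _ _ a Ma; apply: hU => // v /=; apply: he.
have := psub_range v h2; set w := _ + _ * _ => hw.
by rewrite /ball /= ltr_distl; lra.
Qed.

End Monodromy.

(** * Simply connected sets *)

Section SimplyConnected.
Context {R : realType}.

Definition simply_connected (X : topologicalType) (A : set X) :=
  (forall x y, A x -> A y -> exists p : @path_in R X A x y, True) /\
  forall x y (a b : pi1 R A x y), a = b.

(** [M] selects exactly one class for each point, and a selected class extended by a path is again
    selected. Hence two parallel classes extend the selected class [c] at their source to the same
    class, and [c] cancels. *)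
Lemma simply_connected_transport (X : topologicalType) (A : set X) x0
    (M : forall x, pi1 R A x0 x -> Prop) :
  (forall x, A x -> exists a, M x a) ->
  (forall x a b, M x a -> M x b -> a = b) ->
  (forall x, A x -> exists2 U : set X, nbhs x U &
     forall y z (p : path_in A y z) (a : pi1 R A x0 y),
       (forall s, U (p s)) -> M y a -> M z (pmul a (pcls p))) ->
  simply_connected A.
Proof.
move=> Mex Muniq Mloc; split=> [x y /Mex[a _] /Mex[b _]|x y a b].
  have [p _] := pcls_surj a; have [q _] := pcls_surj b.
  by exists (pcat (prev p) q).
have [p ->] := pcls_surj a; have [q ->] := pcls_surj b.
have Ax : A x by rewrite -(path_src p); exact: path_val.
have [c Mc] := Mex _ Ax; apply: (pmulpI (a := c)).
by apply: Muniq; apply: path_transport.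
Qed.

Section Squares.
Context {X : topologicalType} {A : set X}.

(** The two routes along the boundary of the square are [(f1, f2)] and [(f2, f1)]; moving one to the
    other along straight lines in the plane and applying [H] is the homotopy. *)
Lemma square_homotopy (H : R * R -> X) x y z w
    (l : path_in A x y) (t : path_in A y z) (b : path_in A x w) (r : path_in A w z) :
  continuous H -> (forall v, A (H v)) ->
  (forall s, 0 <= s <= 1 -> l s = H (0, s)) -> (forall s, 0 <= s <= 1 -> t s = H (s, 1)) ->
  (forall s, 0 <= s <= 1 -> b s = H (s, 0)) -> (forall s, 0 <= s <= 1 -> r s = H (1, s)) ->
  pmul (pcls l) (pcls t) = pmul (pcls b) (pcls r).
Proof.
move=> cH AH lE tE bE rE; rewrite !pmulE; apply/pclsP => /=.
pose f1 := cat_fun (fun s : R => 0) (fun s => s).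
pose f2 := cat_fun (fun s : R => s) (fun s => 1).
have c1 : continuous f1 by apply: cat_continuous => //; rcont.
have c2 : continuous f2 by apply: cat_continuous => //; rcont.
have e s : 0 <= s <= 1 -> cat_fun l t s = H (f1 s, f2 s).
  by move=> hs; rewrite /cat_fun /f1 /f2 /cat_fun; case: ifP => hs'; rewrite ?lE ?tE //; lra.
have e' s : 0 <= s <= 1 -> cat_fun b r s = H (f2 s, f1 s).
  by move=> hs; rewrite /cat_fun /f1 /f2 /cat_fun; case: leP => hs'; rewrite ?bE ?rE //; lra.
exists (fun v => H (f1 v.1 + v.2 * (f2 v.1 - f1 v.1), f2 v.1 + v.2 * (f1 v.1 - f2 v.1))).
split => /=.
- by rcont.
- by [].
- by move=> s hs; rewrite !mul0r !addr0 e.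
- by move=> s hs; rewrite !mul1r e'//; congr (H (_, _)); ring.
- move=> s _; rewrite e ?lexx ?ler01 // e ?lexx ?ler01 // /f1 /f2 !cat_fun0 !cat_fun1.
  by rewrite !subrr !mulr0 !addr0.
Qed.

End Squares.

Section Dominated.
Context {X Y : topologicalType}.
Variables (A : set X) (B : set Y) (f : X -> Y) (g : Y -> X) (H : X * R -> X).
Hypotheses (cf : {in A, continuous f}) (fAB : forall x, A x -> B (f x)).
Hypotheses (cg : {in B, continuous g}) (gBA : forall y, B y -> A (g y)).
Let D : set (X * R) := [set w | A w.1 /\ 0 <= w.2 <= 1].
Hypotheses (cH : {in D, continuous H}) (HA : forall w, D w -> A (H w)).
Hypotheses (H0 : forall x, A x -> H (x, 0) = x) (H1 : forall x, A x -> H (x, 1) = g (f x)).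

Let track x (Ax : A x) : @path_in R X A x (g (f x)).
Proof.
exists (fun s => H (x, clamp s)).
- by apply: (cont_comp_at cH); [move=> s; split => //=; exact: clamp_in|rcont].
- by move=> s; apply: HA; split => //=; exact: clamp_in.
- by rewrite clamp0 H0.
- by rewrite clamp1 H1.
Defined.

(** The tracks of the homotopy from the identity to [g] after [f] form a naturality square: up to
    the tracks at its ends, a path of [A] is the image under [g] of a path of [B], and parallel
    classes in [B] agree. *)
Lemma dominated_simply_connected : simply_connected B -> simply_connected A.
Proof.
case=> Bex Bun; split=> [x y Ax Ay|x y a b].
  have [p _] := Bex _ _ (fAB Ax) (fAB Ay).
  by exists (pcat (track Ax) (pcat (pmap_path cg gBA p) (prev (track Ay)))).
have [p ->] := pcls_surj a; have [q ->] := pcls_surj b.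
have Ax : A x by rewrite -(path_src p); exact: path_val.
have Ay : A y by rewrite -(path_tgt p); exact: path_val.
have h (r : path_in A x y) : pmul (pcls (track Ax)) (pmap cg gBA (pmap cf fAB (pcls r))) =
    pmul (pcls r) (pcls (track Ay)).
  rewrite !pmapE; apply: (square_homotopy (H := fun v => H (r (clamp v.1), clamp v.2))).
  - apply: (cont_comp_at cH); first by move=> w; split => //=; [exact: path_val|exact: clamp_in].
    by have := path_cont r; move=> cr; rcont.
  - by move=> v; apply: HA; split => //=; [exact: path_val|exact: clamp_in].
  - by move=> s hs /=; rewrite clamp0 path_src.
  - move=> s hs /=; rewrite clamp1 clampK // H1 //.
    exact: path_val.
  - move=> s hs /=; rewrite clamp0 clampK // H0 //.
    exact: path_val.
  - by move=> s hs /=; rewrite clamp1 path_tgt.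
by apply: (pmulIp (c := pcls (track Ay))); rewrite -!h; congr (pmul _ (pmap _ _ _)); exact: Bun.
Qed.

End Dominated.

Section Lines.
Context {V : normedModType R} {A : set V}.

Definition line (x y : V) (t : R) := x + t *: (y - x).

Lemma line_cont (T : topologicalType) (x y : T -> V) (t : T -> R) :
  continuous x -> continuous y -> continuous t ->
  continuous (fun v => line (x v) (y v) (t v)).
Proof.
move=> cx cy ct v; apply: cvgD; first exact: cx.
by apply: cvgZ; [exact: ct|apply: cvgB; [exact: cy|exact: cx]].
Qed.

Lemma line0 x y : line x y 0 = x. Proof. by rewrite /line scale0r addr0. Qed.
Lemma line1 x y : line x y 1 = y. Proof. by rewrite /line scale1r addrC subrK. Qed.

Definition line_path x y (h : forall t, 0 <= t <= 1 -> A (line x y t)) : @path_in R V A x y.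
Proof.
exists (fun s => line x y (clamp s)).
- by apply: (@line_cont _ (cst x) (cst y) clamp); [exact: cst_continuous..|exact: clamp_cont].
- by move=> s; apply: h; exact: clamp_in.
- by rewrite clamp0 line0.
- by rewrite clamp1 line1.
Defined.

Lemma line_path_range x y (h : forall t, 0 <= t <= 1 -> A (line x y t)) (C : set V) :
  (forall t, 0 <= t <= 1 -> C (line x y t)) -> forall s, C (line_path h s).
Proof. by move=> hC s; apply: hC; exact: clamp_in. Qed.

(** Pulling [p] radially towards [e] sweeps out a square whose top is [p], whose vertical sides are
    the segments from [e] to [x] and to [y], and whose bottom is the point [e]. *)
Lemma star_path (C : set V) e x y (p : @path_in R V A x y)
    (hx : forall t, 0 <= t <= 1 -> A (line e x t))
    (hy : forall t, 0 <= t <= 1 -> A (line e y t)) :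
  (forall z t, C z -> 0 <= t <= 1 -> A (line e z t)) ->
  (forall s, C (p s)) ->
  pmul (pcls (line_path hx)) (pcls p) = pcls (line_path hy).
Proof.
move=> hC Cp; have Ae : A e by rewrite -(line0 e x); apply: hx; rewrite lexx ler01.
rewrite -[RHS](pmul1p Ae).
apply: (square_homotopy (H := fun v => line e (p (clamp v.1)) (clamp v.2))).
- have := path_cont p => cp.
  by apply: (@line_cont _ (cst e) (fun v => p (clamp v.1)) (fun v => clamp v.2));
    [exact: cst_continuous|rcont..].
- by move=> v; apply: hC => //; exact: clamp_in.
- by move=> s hs /=; rewrite clamp0 path_src.
- by move=> s hs /=; rewrite clamp1 clampK // line1.
- by move=> s hs /=; rewrite clamp0 line0.
- by move=> s hs /=; rewrite clamp1 path_tgt.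
Qed.

Lemma convex_path (C : set V) x y (p q : @path_in R V A x y) :
  (forall y z t, C y -> C z -> 0 <= t <= 1 -> A (line y z t)) ->
  (forall s, C (p s)) -> (forall s, C (q s)) -> pcls p = pcls q.
Proof.
move=> hC Cp Cq.
have Cx : C x by rewrite -(path_src p).
have Cy : C y by rewrite -(path_tgt p).
have hx t : 0 <= t <= 1 -> A (line x x t) by exact: hC.
have hy t : 0 <= t <= 1 -> A (line x y t) by exact: hC.
apply: (pmulpI (a := pcls (line_path hx))).
by rewrite !(@star_path C _ _ _ _ hx hy) // => z t Cz; exact: hC.
Qed.

End Lines.
End SimplyConnected.

Section PuncturedSpace.
Context {R : realType} {n : nat}.
Variables i0 i1 i2 : 'I_n.
Hypotheses (i10 : i1 != i0) (i20 : i2 != i0) (i21 : i2 != i1).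
Local Notation V := 'cV[R]_n.
Implicit Types (x y : V) (c t : R).

Definition punctured : set V := [set x | x != 0].

(* Star-shaped about [e c]; [U 1] and [U (-1)] cover the punctured space. *)
Let U c : set V := [set x | (exists2 i, i != i0 & x i 0 != 0) \/ 0 < c * x i0 0].
Let e c : V := c *: delta_mx i0 0.
Let b : V := delta_mx i1 0.

Let lineE x y t i : line x y t i 0 = x i 0 + t * (y i 0 - x i 0).
Proof. by rewrite /line !mxE. Qed.

Let eE c i : e c i 0 = if i == i0 then c else 0.
Proof. by rewrite !mxE eqxx andbT; case: eqP => _; rewrite ?mulr1 ?mulr0. Qed.

Let bE i : b i 0 = if i == i1 then 1 else 0.
Proof. by rewrite !mxE eqxx andbT; case: eqP. Qed.

Let Usub c x : U c x -> punctured x.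
Proof.
move=> h; apply/eqP => x0; move: h; rewrite x0 => -[[i _]|]; rewrite !mxE ?eqxx //.
by rewrite mulr0 ltxx.
Qed.

Let Ustar c x t : c * c = 1 -> U c x -> 0 <= t <= 1 -> U c (line (e c) x t).
Proof.
move=> cc; have [->|t0] := eqVneq t 0.
  by move=> _ _; right; rewrite line0 eE eqxx cc ltr01.
move=> [[i ii0 xi]|xc] /andP[ht0 ht1].
  by left; exists i => //; rewrite lineE eE (negbTE ii0) add0r subr0 mulf_neq0.
right; rewrite lineE eE eqxx; have tp : 0 < t by lra.
rewrite (_ : _ * _ = (1 - t) * (c * c) + t * (c * x i0 0)); last by ring.
by rewrite cc; have := mulr_gt0 tp xc; lra.
Qed.

Let Uopen c x : U c x -> nbhs x (U c).
Proof.
have cc i : continuous (fun x : V => x i 0) by exact: coord_continuous.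
case=> [[i ii0 xi]|xc].
  have : nbhs x ((fun x : V => x i 0) @^-1` [set r | r != 0]).
    by apply: cc; exact: (@open_neq R 0 _ _).
  by apply: filterS => y /= yi; left; exists i.
have : nbhs x ((fun x : V => c * x i0 0) @^-1` [set r | 0 < r]).
  have : continuous (fun x : V => c * x i0 0) by apply: rcontM; [exact: cst_continuous|exact: cc].
  by apply; exact: lt_nbhsr.
by apply: filterS => y /= yi; right.
Qed.

Let bline c t : c * c = 1 -> 0 <= t <= 1 -> punctured (line b (e c) t).
Proof.
move=> cc /andP[t0 t1]; apply/eqP => /matrixP h.
have /eqP := h i1 0; rewrite lineE bE eE eqxx (negbTE i10) mxE => h1.
have /eqP := h i0 0; rewrite lineE bE eE eqxx [i0 == i1]eq_sym (negbTE i10) mxE => h2.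
have tE : t = 1 by move/eqP: h1; lra.
by move/eqP: h2; rewrite tE mul1r add0r subr0 => c0; move: cc; rewrite c0 mul0r; lra.
Qed.

(** The reference class of [x]: from [b], which lies off the axis and hence in both sets of the
    cover, straight to the centre [e c], then straight to [x]. *)
Let M x (a : pi1 R punctured b x) := exists c (cc : c * c = 1) (Ux : U c x),
  a = pmul (pcls (line_path (fun t => @bline c t cc)))
           (pcls (line_path (fun t ht => Usub (Ustar cc Ux ht)))).

Let Mtransport c (cc : c * c = 1) y z (p : path_in punctured y z) (Uy : U c y) (Uz : U c z) :
  (forall s, U c (p s)) ->
  pmul (pcls (line_path (fun t ht => Usub (Ustar cc Uy ht)))) (pcls p) =
  pcls (line_path (fun t ht => Usub (Ustar cc Uz ht))).
Proof. by apply: star_path => w t Uw ht; apply: Usub; exact: Ustar Uw ht. Qed.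

(** The intersection of the two sets of the cover is the complement of the axis, and this is where a
    third coordinate enters. The segment from [b] avoids the axis unless [x] may lie opposite to [b]
    modulo the axis; then the path turns through the direction [i2]. *)
Let off_axis_path x : (exists2 i, i != i0 & x i 0 != 0) ->
  exists p : @path_in R V punctured b x, forall s, exists2 i, i != i0 & p s i 0 != 0.
Proof.
move=> [i ii0 xi].
have mk y z : (forall t, 0 <= t <= 1 -> exists2 i, i != i0 & line y z t i 0 != 0) ->
    exists p : @path_in R V punctured y z, forall s, exists2 i, i != i0 & p s i 0 != 0.
  move=> h; have hp t : 0 <= t <= 1 -> punctured (line y z t).
    by move=> /h ?; apply: (@Usub 1); left.
  by exists (line_path hp); exact: (@line_path_range _ _ _ _ _ hp [set y | exists2 i, i != i0 & y i 0 != 0]).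
have line_bx : i != i1 -> exists p : @path_in R V punctured b x,
    forall s, exists2 i, i != i0 & p s i 0 != 0.
  move=> ii1; apply: mk => t _; have [->|t0] := eqVneq t 0.
    by exists i1 => //; rewrite line0 bE eqxx oner_eq0.
  by exists i => //; rewrite lineE bE (negbTE ii1) add0r subr0 mulf_neq0.
have [ii1|/line_bx //] := eqVneq i i1.
have [xi2|/eqP xi2] := eqVneq (x i2 0) 0; last first.
  apply: mk => t _; have [->|t0] := eqVneq t 0.
    by exists i1 => //; rewrite line0 bE eqxx oner_eq0.
  by exists i2 => //; rewrite lineE bE (negbTE i21) add0r subr0 mulf_neq0 //; apply/eqP.
pose d : V := delta_mx i2 0.
have dE k : d k 0 = if k == i2 then 1 else 0 by rewrite !mxE eqxx andbT; case: eqP.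
have [p hp] : exists p : @path_in R V punctured b d, forall s, exists2 i, i != i0 & p s i 0 != 0.
  apply: mk => t _; have [->|t0] := eqVneq t 0.
    by exists i1 => //; rewrite line0 bE eqxx oner_eq0.
  by exists i2 => //; rewrite lineE bE dE eqxx (negbTE i21) add0r subr0 mulr1.
have [q hq] : exists p : @path_in R V punctured d x, forall s, exists2 i, i != i0 & p s i 0 != 0.
  apply: mk => t _; have [->|t0] := eqVneq t 0.
    by exists i2 => //; rewrite line0 dE eqxx oner_eq0.
  exists i => //; rewrite lineE dE; rewrite ii1 [i1 == i2]eq_sym (negbTE i21) add0r subr0 mulf_neq0 //.
  by rewrite -ii1.
by exists (pcat p q) => s /=; rewrite /cat_fun; case: ifP.
Qed.

(** If the centres differ, they are opposite and [x] lies off the axis. Carrying both classes along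
    an off-axis path from [b] to [x] reduces the claim to [x = b], where each class is a segment run
    there and back. *)
Let agree c d (cc : c * c = 1) (dd : d * d = 1) x (Uc : U c x) (Ud : U d x) :
  pmul (pcls (line_path (fun t => @bline c t cc)))
           (pcls (line_path (fun t ht => Usub (Ustar cc Uc ht)))) =
  pmul (pcls (line_path (fun t => @bline d t dd)))
           (pcls (line_path (fun t ht => Usub (Ustar dd Ud ht)))).
Proof.
have [cd|cd] := eqVneq c d.
  subst d; rewrite (Prop_irrelevance dd cc).
  by rewrite (Prop_irrelevance Uc Ud).
have oc : d = - c.
  have /eqP : (c - d) * (c + d) = 0 by rewrite (_ : _ * _ = c * c - d * d); [rewrite cc dd subrr|ring].
  by rewrite mulf_eq0 subr_eq0 (negbTE cd) /= => /eqP; lra.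
have off : exists2 i, i != i0 & x i 0 != 0.
  case: Uc => [//|h1]; case: Ud => [//|]; rewrite oc mulNr; lra.
have Ub c' : U c' b by left; exists i1 => //; rewrite bE eqxx oner_eq0.
(* The loop stays on the segment from [b] to the centre, which contracts to [b] inside the punctured
   space. *)
have base c' (cc' : c' * c' = 1) : pmul (pcls (line_path (fun t => @bline c' t cc')))
    (pcls (line_path (fun t ht => Usub (Ustar cc' (Ub c') ht)))) = pone (@Usub c b (Ub c)).
  have hb t : 0 <= t <= 1 -> punctured (line b b t).
    by move=> _; rewrite /line subrr scaler0 addr0; exact: Usub (Ub c).
  rewrite (star_path (C := [set y | exists s, 0 <= s <= 1 /\ y = line (e c') b s]) _ hb).
  - apply: eq_pcls => s _ /=; by rewrite /line subrr scaler0 addr0.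
  - move=> _ t [s [hs ->]] ht.
    suff -> : line b (line (e c') b s) t = line b (e c') (t * (1 - s)).
      by apply: bline => //; nra.
    by apply/matrixP => i j; rewrite ord1 !lineE; ring.
  - by apply: line_path_range => t ht; exists t.
have [p hp] := off_axis_path off.
rewrite -(Mtransport cc (p := p) (Ub c)); last by move=> s; left.
rewrite -(Mtransport dd (p := p) (Ub d)); last by move=> s; left.
by rewrite !pmulA !base.
Qed.

Lemma punctured_simply_connected : @simply_connected R V punctured.
Proof.
have Ucover x : punctured x -> exists c, c * c = 1 /\ U c x.
  move=> /eqP x0; have [h|nh] := pselect (exists2 i, i != i0 & x i 0 != 0).
    by exists 1; rewrite mulr1; split => //; left.
  have x00 : x i0 0 != 0.
    apply/eqP => h; apply: x0; apply/matrixP => i j; rewrite ord1 [RHS]mxE.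
    have [->//|ii0] := eqVneq i i0.
    by apply: contrapT => /eqP xi; apply: nh; exists i.
  have [h|h] := ltP 0 (x i0 0).
    by exists 1; rewrite mulr1; split => //; right; rewrite mul1r.
  exists (-1); rewrite mulrNN mulr1; split => //; right.
  by rewrite mulN1r oppr_gt0 lt_neqAle x00.
apply: (@simply_connected_transport R V punctured b M).
- by move=> x /Ucover[c [cc Ux]]; eexists; exists c, cc, Ux.
- by move=> x _ _ [c [cc [Ux ->]]] [d [dd [Ux' ->]]]; exact: agree.
- move=> x /Ucover[c [cc Ux]]; exists (U c); first exact: Uopen.
  move=> y z p a hp [d [dd [Uy ->]]].
  have Uy' : U c y by rewrite -(path_src p).
  have Uz : U c z by rewrite -(path_tgt p).
  rewrite (agree dd cc Uy Uy') -pmulA (Mtransport cc Uy' Uz hp).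
  by exists c, cc, Uz.
Qed.

End PuncturedSpace.

(** * Local systems and holonomy *)

Section LocalSystem.
Context {R : realType} {G : groupType} {B : topologicalType} {C : Type}.
Variables (E : set B) (U : C -> set B) (g : C -> C -> B -> G).

(** A locally constant Cech cocycle: a principal bundle with discrete group [G], given by transition
    functions with no total space. Coordinates change by right multiplication, from chart [c] to
    chart [d] by [g c d]. *)
Record local_system : Prop := LocalSystem {
  ls_open : forall c x, U c x -> nbhs x (U c);
  ls_cover : forall x, E x -> exists c, U c x;
  ls_cocycle : forall c d e x, U c x -> U d x -> U e x -> (g c d x * g d e x = g c e x)%g;
  ls_locconst : forall c d x, U c x -> U d x -> \forall y \near x, g c d y = g c d x }.

Hypothesis LS : local_system.

Lemma ls_id c x : U c x -> g c c x = 1%g.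
Proof.
by move=> Ux; apply: (@mulgI G (g c c x)); rewrite (ls_cocycle LS) // mulg1.
Qed.

(** A lift of [H] to the bundle over [D]: [l y c] is its coordinate in the chart [c], meaningful
    only when [H y] lies in [U c]. Continuity into a discrete fibre is local constancy relative to
    [D]. *)
Definition is_section (Y : topologicalType) (D : set Y) (H : Y -> B) (l : Y -> C -> G) :=
  (forall y c d, D y -> U c (H y) -> U d (H y) -> l y d = (l y c * g c d (H y))%g) /\
  (forall y c, D y -> U c (H y) -> \forall z \near y, D z -> l z c = l y c).

(** Left translations commute with the changes of chart, which act on the right; they serve to
    normalise a lift at one point. *)
Lemma section_mul (Y : topologicalType) (D : set Y) H l (a : G) :
  is_section D H l -> is_section D H (fun y c => a * l y c)%g.
Proof.
move=> [l1 l2]; split=> [y c d Dy Uc Ud|y c Dy Uc]; first by rewrite (l1 y c d) // mulgA.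
by apply: filterS (l2 y c Dy Uc) => z lz /lz ->.
Qed.

Lemma section_comp (Y Z : topologicalType) (D : set Y) (D' : set Z) H l (k : Z -> Y) H' :
  continuous k -> (forall z, D' z -> D (k z)) -> (forall z, D' z -> H' z = H (k z)) ->
  is_section D H l -> is_section D' H' (fun z => l (k z)).
Proof.
move=> ck kD HE [l1 l2]; split=> [z c d Dz|z c Dz]; rewrite HE //.
  by apply: l1; exact: kD.
move=> Uc; have h : nbhs z (k @^-1` _) := ck z _ (l2 (k z) c (kD _ Dz) Uc).
by apply: filterS h => w /= lw /kD.
Qed.

Lemma section_cst (Y : topologicalType) (D : set Y) (x : B) (a : C -> G) :
  (forall c d, U c x -> U d x -> a d = (a c * g c d x)%g) ->
  is_section D (fun=> x) (fun=> a).
Proof. by move=> ha; split=> [y c d _|y c _ _]; [exact: ha|near=> z]. Unshelve. all: by end_near. Qed.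

Lemma section_local (Y : topologicalType) (D : set Y) (H : Y -> B) c :
  continuous H -> (forall y, D y -> U c (H y)) ->
  is_section D H (fun y d => g c d (H y)).
Proof.
move=> cH DU; split=> [y d e Dy Ud Ue|y d Dy Ud].
  by rewrite (ls_cocycle LS) //; exact: DU.
by have h : nbhs y (H @^-1` _) := cH y _ (ls_locconst LS (DU y Dy) Ud); apply: filterS h => z /= ->.
Qed.

Lemma section_glue (Y : topologicalType) (D : set Y) (H : Y -> B) (a : Y -> R) (m : R) l1 l2 :
  continuous a ->
  is_section (D `&` [set y | a y <= m]) H l1 -> is_section (D `&` [set y | m <= a y]) H l2 ->
  (forall y c, D y -> a y = m -> U c (H y) -> l1 y c = l2 y c) ->
  is_section D H (fun y => if a y <= m then l1 y else l2 y).
Proof.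
move=> ca [l11 l12] [l21 l22] l12E; split=> [y c d Dy Uc Ud|y c Dy Uc].
  by case: ifPn => h; [apply: l11|rewrite -ltNge in h; apply: l21 => //; split => //=; exact: ltW].
case: (ltgtP (a y) m) => h.
- have n1 : nbhs y (a @^-1` [set r | r < m]) by apply: ca; exact: lt_nbhsl.
  have n2 := l12 y c (conj Dy (ltW h)) Uc.
  by apply: filterS2 n1 n2 => z /= zm lz Dz; rewrite (ltW zm) lz //; split => //=; exact: ltW.
- have n1 : nbhs y (a @^-1` [set r | m < r]) by apply: ca; exact: lt_nbhsr.
  have n2 := l22 y c (conj Dy (ltW h)) Uc.
  by apply: filterS2 n1 n2 => z /= zm lz Dz; rewrite leNgt zm /= lz //; split => //=; exact: ltW.
- have n1 := l12 y c (conj Dy (eq_ind_r (fun r => r <= m) (lexx m) h)) Uc.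
  have n2 := l22 y c (conj Dy (eq_ind_r (fun r => m <= r) (lexx m) h)) Uc.
  apply: filterS2 n1 n2 => z lz1 lz2 Dz; case: leP => zm; first exact: lz1.
  by rewrite lz2 ?l12E //; split => //=; exact: ltW.
Qed.

Local Notation I := [set s : R | 0 <= s <= 1].

Lemma section_unique (p : R -> B) l l' c : continuous p -> (forall s, I s -> E (p s)) ->
  is_section I p l -> is_section I p l' ->
  U c (p 0) -> l 0 c = l' 0 c -> forall d, U d (p 1) -> l 1 d = l' 1 d.
Proof.
move=> cp Ep [l1 l2] [l1' l2'] Uc e0.
have I0 : I (0 : R) by rewrite /= lexx ler01.
suff : (forall d, U d (p 0) -> l 0 d = l' 0 d) -> forall d, U d (p 1) -> l 1 d = l' 1 d.
  by apply=> d Ud; rewrite (l1 0 c) // (l1' 0 c) // e0.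
apply: (@interval_induction R (fun s t => (forall d, U d (p s) -> l s d = l' s d) ->
  forall d, U d (p t) -> l t d = l' t d)).
  by move=> s t u _ _ _ _ h1 h2 /h1/h2.
move=> x Ix; have [c' Uc'] := ls_cover LS (Ep x Ix).
have n1 := l2 x c' Ix Uc'; have n2 := l2' x c' Ix Uc'.
have n3 : nbhs x (p @^-1` U c') by apply: cp; exact: ls_open LS _ _ Uc'.
have [e /= e_gt0 he] : exists2 e : R, 0 < e & ball (x : R) e `<=` p @^-1` U c' `&`
    ([set z | I z -> l z c' = l x c'] `&` [set z | I z -> l' z c' = l' x c']).
  by apply/nbhs_ballP; apply: filterI => //; apply: filterI.
have {}he y : x - e < y -> y < x + e -> I y -> [/\ U c' (p y), l y c' = l x c' & l' y c' = l' x c'].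
  move=> h1 h2 Iy; have [/=|h3 [h4 h5]] := he y; first by rewrite /ball /= ltr_distl; lra.
  by split; [|exact: h4|exact: h5].
exists e => // s t xs st tx s0 t1 hs d Ud.
have Is : I s by apply/andP; split; lra.
have It : I t by apply/andP; split; lra.
have [||us ls ls'] := he s _ _ Is => //; first by lra.
have [||ut lt lt'] := he t _ _ It => //; first by lra.
by rewrite (l1 t c') // (l1' t c') // lt lt' -ls -ls' hs.
Qed.

Let rect (a b c d : R) : set (R * R) := [set v | a <= v.1 <= b /\ c <= v.2 <= d].

(** The interface [a v = m] is path-connected to [v0]. It is therefore enough to translate [l2] so
    that it matches [l1] at [v0]: uniqueness along paths in the interface does the rest. *)
Lemma section_glue_ex (D : set (R * R)) (H : R * R -> B) (a : R * R -> R) (m : R) v0 :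
  continuous H -> (forall v, D v -> E (H v)) -> continuous a -> D v0 -> a v0 = m ->
  (forall v, D v -> a v = m -> exists k : R -> R * R,
     [/\ continuous k, k 0 = v0, k 1 = v & forall s, I s -> D (k s) /\ a (k s) = m]) ->
  (exists l, is_section (D `&` [set y | a y <= m]) H l) ->
  (exists l, is_section (D `&` [set y | m <= a y]) H l) ->
  exists l, is_section D H l.
Proof.
move=> cH EH ca D0 a0 hk [l1 s1] [l2 s2].
have [c Uc] := ls_cover LS (EH _ D0).
pose l2' v d := ((l1 v0 c * (l2 v0 c)^-1) * l2 v d)%g.
have s2' : is_section (D `&` [set y | m <= a y]) H l2' by exact: section_mul.
exists (fun y => if a y <= m then l1 y else l2' y); apply: section_glue => //.
move=> v d Dv av Ud; have [k [ck k0 k1 kI]] := hk v Dv av.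
have := @section_unique (fun s => H (k s)) (fun s => l1 (k s)) (fun s => l2' (k s)) c.
rewrite k0 k1; apply => //.
- by rcont.
- by move=> s /kI[/EH].
- by apply: (section_comp ck) s1 => // s /kI[? e]; split => //=; rewrite e.
- by apply: (section_comp ck) s2' => // s /kI[? e]; split => //=; rewrite e.
- by rewrite /l2' mulgVK.
Qed.

(** Subdivision of the square by two nested uses of [interval_induction]: small rectangles are
    joined into thin horizontal strips, and the strips are stacked. Consecutive pieces meet in a
    segment, as gluing requires. *)
Lemma section_exists (H : R * R -> B) : continuous H -> (forall v, E (H v)) ->
  exists l, is_section (rect 0 1 0 1) H l.
Proof.
move=> cH EH.
have between (s c y d : R) : 0 <= s <= 1 -> c <= y <= d -> c <= c + s * (y - c) <= d.
  by move=> /andP[s0 s1] /andP[cy yd]; apply/andP; split; nra.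
pose good a b c d := exists l, is_section (rect a b c d) H l.
have c1 : continuous (@fst R R) by exact: cont_fst.
have c2 : continuous (@snd R R) by exact: cont_snd.
have sub D D' : D' `<=` D -> (exists l, is_section D H l) -> exists l, is_section D' H l.
  by move=> DD [l sl]; exists l; exact: (section_comp (@cont_id _) DD) sl.
have addh a m b c d : a <= m -> m <= b -> c <= d ->
    good a m c d -> good m b c d -> good a b c d.
  move=> am mb cd h1 h2; apply: (@section_glue_ex _ _ fst m (m, c)) => //=.
  - by rewrite /rect /= lexx am mb cd.
  - case=> x y [/= hx hy] xm; subst x; exists (fun s => (m, c + s * (y - c))); split => /=.
    + by rcont.
    + by rewrite mul0r addr0.
    + by rewrite mul1r addrC subrK.
    + by move=> s hs; split => //; split => //=; apply: between.
  - by apply: sub h1 => -[x y] [[/= /andP[k1 _] k2] k3]; split => //=; rewrite k1.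
  - by apply: sub h2 => -[x y] [[/= k1 k2] k3]; split => //=; lra.
have addv a b c m d : a <= b -> c <= m -> m <= d ->
    good a b c m -> good a b m d -> good a b c d.
  move=> ab cm md h1 h2; apply: (@section_glue_ex _ _ snd m (a, m)) => //=.
  - by rewrite /rect /= lexx ab cm md.
  - case=> x y [/= hx hy] xm; subst y; exists (fun s => (a + s * (x - a), m)); split => /=.
    + by rcont.
    + by rewrite mul0r addr0.
    + by rewrite mul1r addrC subrK.
    + by move=> s hs; split => //; split => //=; apply: between.
  - by apply: sub h1 => -[x y] [[/= k1 /andP[k2 _]] k3]; split => //=; rewrite k2.
  - by apply: sub h2 => -[x y] [[/= k1 k2] k3]; split => //=; lra.
have loc v : exists2 e : R, 0 < e & forall a b c d, v.1 - e < a -> b < v.1 + e ->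
    v.2 - e < c -> d < v.2 + e -> good a b c d.
  have [k Uk] := ls_cover LS (EH v).
  have nv : nbhs v (H @^-1` U k) by apply: cH; exact: ls_open LS _ _ Uk.
  have [e /= e0 he] := (nbhs_ballP v _).1 nv.
  exists e => // a b c d h1 h2 h3 h4; eexists; apply: (section_local (c := k)) => //.
  move=> w [/= hw1 hw2]; apply: he; split; rewrite /ball /= ltr_distl; lra.
(* One height [e] must serve for the whole length of the strip; when two strips are joined the
   smaller height is kept. *)
pose strip a b t := exists2 e : R, 0 < e &
  forall c d, t - e < c -> c <= d -> d < t + e -> good a b c d.
have hstrip t : strip 0 1 t.
  apply: (@interval_induction R (fun a b => strip a b t)).
    move=> a b c _ ab bc _ [e e0 he] [f f0 hf]; exists (Num.min e f); first by rewrite lt_min e0.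
    move=> c' d h1 h2 h3; have := ge_min e e f; have := ge_min f e f; rewrite !lexx orbT /= => m1 m2.
    by apply: (addh _ b) => //; [apply: he|apply: hf] => //; lra.
  move=> x _; have [e e0 he] := loc (x, t); exists e => // a b h1 h2 h3 _ _.
  by exists e => // c d h4 h5 h6; apply: he.
apply: (@interval_induction R (fun c d => good 0 1 c d)).
  by move=> a b c _ ab bc _ h1 h2; apply: (addv _ _ _ b).
move=> t _; have [e e0 he] := hstrip t; exists e => // c d h1 h2 h3 _ _.
exact: he.
Qed.

(* [hol c d p a]: continuing along [p] turns the element 1 over [p 0] in the
   chart [c] into [a] over [p 1] in the chart [d]. *)
Definition hol c d (p : R -> B) (a : G) := exists l, [/\ is_section I p l, l 0 c = 1%g & l 1 d = a].

Lemma hol_exists c d (p : R -> B) : continuous p -> (forall s, E (p s)) -> U c (p 0) ->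
  exists a, hol c d p a.
Proof.
move=> cp Ep Uc; have [||l sl] := @section_exists (fun v => p v.1).
- by rcont.
- by [].
exists ((l (0, 0)%R c)^-1 * l (1, 0)%R d)%g, (fun s d => (l (0, 0)%R c)^-1 * l (s, 0)%R d)%g.
rewrite mulVg; split => //; apply: section_mul.
by apply: (@section_comp _ _ _ _ _ _ (fun s => (s, 0))) sl => //; [rcont|move=> s hs; split => //=; rewrite lexx ler01].
Qed.

(** A lift of the whole homotopy restricts to lifts of [p] and [q] on the bottom and the top, and it
    does not change along the vertical sides, where [H] is constant. *)
Lemma hol_homotopic c d (p q : R -> B) a b :
  path_homotopic E p q -> U c (p 0) -> U d (p 1) ->
  hol c d p a -> hol c d q b -> a = b.
Proof.
move=> [H [cH EH H0 H1 He]] Uc Ud [l [sl l0 <-]] [k [sk k0 <-]].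
have I0 : I (0 : R) by rewrite /= lexx ler01.
have I1 : I (1 : R) by rewrite /= lexx ler01.
have [m sm] := @section_exists H cH EH.
pose m' v e := ((m (0, 0)%R c)^-1 * m v e)%g.
have sm' : is_section (rect 0 1 0 1) H m' by exact: section_mul.
have m0 : m' (0, 0) c = 1%g by rewrite /m' mulVg.
have p0 : p 0 = H (0, 0) by rewrite H0.
have p1 : p 1 = H (1, 0) by rewrite H0.
have q0 : q 0 = p 0 by rewrite -H1 //; case: (He 1 I1).
have q1 : q 1 = p 1 by rewrite -H1 //; case: (He 1 I1).
(* Over a constant path the lift is compared with the constant one. *)
have side x e : I x -> U e (H (x, 0)) -> (forall t, I t -> H (x, t) = H (x, 0)) -> m' (x, 1) e = m' (x, 0) e.
  move=> Ix Ue hx; pose s t := m' (x, t).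
  apply: (@section_unique (fun=> H (x, 0)) (fun t => m' (x, t)) (fun=> m' (x, 0)) e) => //.
  - exact: cst_continuous.
  - apply: (@section_comp _ _ _ _ _ _ (fun t => (x, t))) sm' => //; first by rcont.
    by move=> t It; rewrite [RHS]hx.
  - by apply: section_cst => e1 e2 U1 U2; apply: (proj1 sm').
have lm : l 1 d = m' (1, 0) d.
  apply: (@section_unique (fun s => H (s, 0)) l (fun s => m' (s, 0)) c) => //.
  - by rcont.
  - by apply: (@section_comp _ _ _ _ _ _ (fun s => s)) sl => //; exact: cont_id.
  - by apply: (@section_comp _ _ _ _ _ _ (fun s : R => (s, 0 : R))) sm' => //; first [by rcont | by move=> s hs; split => //=; rewrite lexx ler01].
  - by rewrite -p0.
  - by rewrite l0 m0.
  - by rewrite -p1.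
have km : k 1 d = m' (1, 1) d.
  apply: (@section_unique (fun s => H (s, 1)) k (fun s => m' (s, 1)) c) => //.
  - by rcont.
  - by apply: (@section_comp _ _ _ _ _ _ (fun s => s)) sk => //; exact: cont_id.
  - by apply: (@section_comp _ _ _ _ _ _ (fun s : R => (s, 1 : R))) sm' => //; first [by rcont | by move=> s hs; split => //=; rewrite lexx ler01].
  - by rewrite H1 // q0.
  - by rewrite k0 side // -?p0 // => t It; case: (He t It) => ->.
  - by rewrite H1 // q1.
rewrite lm km side // -?p1 // => t It; by case: (He t It) => _ ->.
Qed.

(** The lift of [q] starts at 1 and that of [p] ends at [a] in the chart [d]; translating the former
    by [a] on the left makes them fit, which fixes the order of the product. *)
Lemma hol_cat c d e (p q : R -> B) a b : p 1 = q 0 -> U d (p 1) ->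
  hol c d p a -> hol d e q b -> hol c e (cat_fun p q) (a * b)%g.
Proof.
move=> pq Ud [l [sl l0 l1]] [k [sk k0 k1]].
exists (fun s => if s <= 2^-1 then l (2 * s) else fun c' => (a * k (2 * s - 1)%R c')%g); split.
- apply: (@section_glue R I (cat_fun p q) (fun s => s) 2^-1 (fun s => l (2 * s))
    (fun s c' => a * k (2 * s - 1)%R c')%g); first exact: cont_id.
  + apply: (@section_comp _ _ _ _ _ _ (fun s : R => 2 * s)) sl; first by rcont.
      by move=> s [/= hs ?]; lra.
    by move=> s [/= hs hs2]; rewrite /cat_fun hs2.
  + apply: (@section_comp _ _ _ _ _ _ (fun s : R => 2 * s - 1)) (section_mul a sk); first by rcont.
      by move=> s [/= hs ?]; lra.
    move=> s [/= hs hs2]; rewrite /cat_fun; case: leP => // hs3.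
    have -> : s = 2^-1 by lra.
    by rewrite mulfV ?subrr // pnatr_eq0.
  + move=> s c' /= hs -> ; rewrite /cat_fun lexx mulfV ?subrr ?pnatr_eq0 // => Uc'.
    have I0 : I (0 : R) by rewrite /= lexx ler01.
    have I1 : I (1 : R) by rewrite /= lexx ler01.
    rewrite (proj1 sl 1 d c' I1 Ud Uc') l1 (proj1 sk 0 d c' I0) -?pq //.
    by rewrite k0 mul1g.
- by rewrite invr_ge0 ler0n mulr0.
- rewrite ifF; last by apply/negbTE; rewrite -ltNge; lra.
  by rewrite (_ : 2 * 1 - 1 = 1) ?k1 //; lra.
Qed.

Lemma hol_cst c x : E x -> U c x -> hol c c (fun=> x) 1%g.
Proof.
move=> Ex Uc; exists (fun _ d => g c d x); split; rewrite ?ls_id //.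
by apply: section_cst => d e Ud Ue; rewrite (ls_cocycle LS).
Qed.

End LocalSystem.

(** * The presented group and its evaluation on loop classes *)

Section QuadricGroup.
Local Open Scope group_scope.

Definition qword (w : word generator) : quadric_group := word_class _ w.
Definition alpha := qword [:: letter Alpha].
Definition beta := qword [:: letter Beta].
Definition kappa := qword [:: letter Kappa].

Lemma qwordM u v : qword u * qword v = qword (u ++ v).
Proof. exact: presented_mulE. Qed.

Lemma qword_surj x : exists w, x = qword w.
Proof. by elim/presented_group_ind: x => w; exists w. Qed.

Lemma kappa2 : kappa * kappa = 1.
Proof.
by rewrite qwordM; apply/word_classP; apply: WordRel; rewrite !inE eqxx orbT.
Qed.

Lemma kappa_alpha : kappa * alpha = beta * kappa.
Proof.
by rewrite !qwordM; apply/word_classP; apply: WordRel; rewrite !inE eqxx.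
Qed.

Lemma betaE : beta = kappa * alpha * kappa.
Proof. by rewrite kappa_alpha -mulgA kappa2 mulg1. Qed.

(** By [betaE] the letter [beta] is a conjugate of [alpha], so closure from [alpha] and [kappa]
    reaches every letter. *)
Lemma quadric_group_gen (P : quadric_group -> Prop) :
  P alpha -> P kappa -> P 1 -> (forall x y, P x -> P y -> P (x * y)) ->
  (forall x, P x -> P x^-1) -> forall x, P x.
Proof.
move=> Pa Pk P1 PM PV x; have [w ->] := qword_surj x; elim: w => [//|[s b] w Pw].
rewrite -cat1s -qwordM; apply: (PM) => //.
have Ps : P (qword [:: letter s]).
  case: s; [exact: Pa| |exact: Pk].
  by rewrite -[qword _]/beta betaE; apply: (PM _ _ (PM _ _ Pk Pa) Pk).
case: b => //; have := PV _ Ps; congr P; apply: (mulgI (qword [:: letter s])).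
by rewrite mulgV qwordM; apply/esym/word_classP; exact: (WordCancel _ (letter s)).
Qed.

End QuadricGroup.

Section Evaluation.
Context {R : realType} {X : topologicalType} {A : set X} {x0 : X}.
Variables (Ax0 : A x0) (a k : pi1 R A x0 x0).
Hypothesis kk : pmul k k = pone Ax0.

(** The value at [Beta] is forced by the first relation, so a homomorphism out of the group is given
    by a class [a] and a class [k] of square one. *)
Let gen (s : generator) := match s with
  | Alpha => a | Beta => pmul (pmul k a) k | Kappa => k end.

Let ev (x : generator * bool) := if x.2 then pinv (gen x.1) else gen x.1.

Let eval (w : word generator) := foldr (fun x => pmul (ev x)) (pone Ax0) w.

Let eval_cat u v : eval (u ++ v) = pmul (eval u) (eval v).
Proof. by elim: u => [|x u IH] /=; rewrite ?pmul1p // IH pmulA. Qed.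

Definition pi1_eval (x : quadric_group) := eval (repr (x : {eq_quot (word_eqv _)})).

Let eval_cong rels u v :
  (forall u v, (u, v) \in rels -> eval u = eval v) ->
  word_cong rels u v -> eval u = eval v.
Proof.
move=> hr; elim=> {u v} //=.
- by move=> v u w _ -> _ ->.
- by move=> u u' v v' _ e1 _ e2; rewrite !eval_cat e1 e2.
- by case=> s [] /=; rewrite /ev /= !pmulp1 ?(pmulpV Ax0) ?(pmulVp Ax0).
Qed.

Let eval_class w : pi1_eval (qword w) = eval w.
Proof.
apply: eval_cong (repr_word_class _ w) => u v; rewrite !inE => /orP[]/eqP[-> ->] /=.
  by rewrite /ev /= !pmulp1 -!pmulA kk pmulp1.
by rewrite /ev /= !pmulp1.
Qed.

Lemma pi1_eval1 : pi1_eval 1%g = pone Ax0. Proof. exact: (eval_class [::]). Qed.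

Lemma pi1_evalM x y : pi1_eval (x * y)%g = pmul (pi1_eval x) (pi1_eval y).
Proof.
have [u ->] := qword_surj x; have [v ->] := qword_surj y.
by rewrite qwordM !eval_class eval_cat.
Qed.

Lemma pi1_eval_alpha : pi1_eval alpha = a.
Proof. by rewrite eval_class /= pmulp1. Qed.

Lemma pi1_eval_kappa : pi1_eval kappa = k.
Proof. by rewrite eval_class /= pmulp1. Qed.

End Evaluation.

(** * The twice-punctured plane *)

Section Regions.
Context {R : realType}.

(* Convex cells covering the plane minus the points (1, 0) and (-1, 0), with
   connected pairwise intersections and no triple intersection. *)
Inductive region := Upper | Lower | Right | Left | Middle.

Definition in_region (k : region) : set (R * R) := [set t | match k with
  | Upper => 0 < t.2 | Lower => t.2 < 0
  | Right => 1 < t.1 | Left => t.1 < -1 | Middle => -1 < t.1 < 1 end].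

Definition opp_region k := match k with
  | Upper => Lower | Lower => Upper | Right => Left | Left => Right | Middle => Middle end.

Definition twice_punctured : set (R * R) := [set t | t <> (1, 0) /\ t <> (-1, 0)].

(* Around (1, 0) the four cells Middle, Upper, Right, Lower form a cycle with
   monodromy alpha; around (-1, 0) the monodromy is beta. *)
Definition transition (k l : region) : quadric_group := match k, l with
  | Lower, Right => alpha | Right, Lower => alpha^-1
  | Upper, Left => beta | Left, Upper => beta^-1
  | _, _ => 1 end%g.

Lemma opp_regionK : involutive opp_region. Proof. by case. Qed.

Lemma in_opp_region k t : in_region (opp_region k) (- t) <-> in_region k t.
Proof.
have e1 : (- t).1 = - t.1 by []. have e2 : (- t).2 = - t.2 by [].
by case: k => /=; rewrite ?e1 ?e2; split=> ?; lra.
Qed.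

Lemma region_cover t : twice_punctured t -> exists k, in_region k t.
Proof.
case: t => x y [h1 h2].
have [y0|y0|y0] := ltgtP y 0; [by exists Lower|by exists Upper|].
have [x1|x1|x1] := ltgtP x 1; [|by exists Right|by case: h1; rewrite x1 y0].
have [x2|x2|x2] := ltgtP x (-1); [by exists Left| |by case: h2; rewrite x2 y0].
by exists Middle; rewrite /= x1 x2.
Qed.

Lemma region_sub k t : in_region k t -> twice_punctured t.
Proof.
by case: t => x y; case: k => /= h; split=> -[e1 e2]; move: h; rewrite ?e1 ?e2; lra.
Qed.

Lemma region_convex k t u s : in_region k t -> in_region k u -> 0 <= s <= 1 ->
  in_region k (line t u s).
Proof.
have e1 : (line t u s).1 = t.1 + s * (u.1 - t.1) by [].
have e2 : (line t u s).2 = t.2 + s * (u.2 - t.2) by [].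
have gt (c x y : R) : 0 <= s <= 1 -> c < x -> c < y -> c < x + s * (y - x).
  by move=> /andP[s0 s1] cx cy; have [xy|xy] := leP x y; nra.
have lt (c x y : R) : 0 <= s <= 1 -> x < c -> y < c -> x + s * (y - x) < c.
  by move=> /andP[s0 s1] cx cy; have [xy|xy] := leP x y; nra.
case: k => /=; rewrite ?e1 ?e2 => h1 h2 hs.
- exact: gt.
- exact: lt.
- exact: gt.
- exact: lt.
- by move: h1 h2 => /andP[? ?] /andP[? ?]; rewrite gt // lt.
Qed.

Lemma region_open k t : in_region k t -> nbhs t (in_region k).
Proof.
have c1 : continuous (fun t : R * R => t.1) by rcont.
have c2 : continuous (fun t : R * R => t.2) by rcont.
case: k => /= h.
- exact: (c2 t _ (lt_nbhsr h)).
- exact: (c2 t _ (lt_nbhsl h)).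
- exact: (c1 t _ (lt_nbhsr h)).
- exact: (c1 t _ (lt_nbhsl h)).
- case/andP: h => h1 h2.
  have n1 : nbhs t _ := c1 t _ (lt_nbhsr h1); have n2 : nbhs t _ := c1 t _ (lt_nbhsl h2).
  by apply: filterS2 n1 n2 => u /= -> ->.
Qed.

Lemma transition_id k : transition k k = 1%g. Proof. by case: k. Qed.

(** No three distinct cells have a common point: either two of the three indices coincide or the
    hypotheses are contradictory. *)
Lemma transition_cocycle k l m t : in_region k t -> in_region l t -> in_region m t ->
  (transition k l * transition l m = transition k m)%g.
Proof.
case: k; case: l; case: m => /= h1 h2 h3; rewrite ?mulg1 ?mul1g ?mulgV ?mulVg //;
  exfalso; lra.
Qed.

(** The half-turn exchanges the two punctures as conjugation by [kappa] exchanges [alpha] and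
    [beta]. This equivariance is what lets the cocycle descend to the quotient. *)
Lemma transition_opp k l :
  transition (opp_region k) (opp_region l) = (kappa * transition k l * kappa)%g.
Proof.
have kV : (kappa^-1 = kappa)%g by apply: (mulgI kappa); rewrite mulgV kappa2.
have aE : (alpha = kappa * beta * kappa)%g.
  by rewrite betaE !mulgA kappa2 mul1g -mulgA kappa2 mulg1.
have bV : (beta^-1 = kappa * alpha^-1 * kappa)%g by rewrite betaE !invgM kV mulgA.
have aV : (alpha^-1 = kappa * beta^-1 * kappa)%g by rewrite [in LHS]aE !invgM kV mulgA.
by case: k; case: l => /=; rewrite ?mulg1 ?kappa2 -?betaE -?aE -?bV -?aV.
Qed.

End Regions.

Section TwicePunctured.
Context {R : realType}.
Local Notation T := (@twice_punctured R).
Local Notation O := ((0, 0) : R * R).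

Definition in_seg k x y (a : pi1 R T x y) :=
  exists2 p : path_in T x y, (forall s, in_region k (p s)) & a = pcls p.

Lemma in_seg_exists k x y : in_region k x -> in_region k y -> exists a : pi1 R T x y, in_seg k a.
Proof.
move=> kx ky; have h t : 0 <= t <= 1 -> T (line x y t).
  by move=> ht; apply: region_sub (region_convex kx ky ht).
exists (pcls (line_path h)); exists (line_path h) => //.
by apply: line_path_range => t; exact: region_convex.
Qed.

Lemma in_seg_unique k x y (a b : pi1 R T x y) : in_seg k a -> in_seg k b -> a = b.
Proof.
move=> [p hp ->] [q hq ->]; apply: (convex_path (C := in_region k)) => //.
by move=> u v t ku kv ht; exact: region_sub (region_convex ku kv ht).
Qed.

Lemma in_segM k x y z (a : pi1 R T x y) (b : pi1 R T y z) :
  in_seg k a -> in_seg k b -> in_seg k (pmul a b).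
Proof.
move=> [p hp ->] [q hq ->]; exists (pcat p q); last by rewrite pmulE.
by move=> s /=; rewrite /cat_fun; case: ifP.
Qed.

Lemma in_seg_ends k x y (a : pi1 R T x y) : in_seg k a -> in_region k x /\ in_region k y.
Proof.
move=> [p hp _]; split; first by rewrite -(path_src p).
by rewrite -(path_tgt p).
Qed.

(** By convexity the class is that of the straight segment, which lies in both cells as soon as its
    ends do. *)
Lemma in_seg_change k l x y (a : pi1 R T x y) :
  in_region l x -> in_region l y -> in_seg k a -> in_seg l a.
Proof.
move=> lx ly ka; have [kx ky] := in_seg_ends ka.
have h t : 0 <= t <= 1 -> T (line x y t).
  by move=> ht; apply: region_sub (region_convex kx ky ht).
have lseg : in_seg l (pcls (line_path h)).
  by exists (line_path h) => //; apply: line_path_range => t; exact: region_convex.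
suff -> : a = pcls (line_path h) by [].
apply: in_seg_unique ka _; exists (line_path h) => //.
by apply: line_path_range => t; exact: region_convex.
Qed.

(* The standard paths from the origin to a point of the cell [k] run through
   the points [entry k] and [corner k]; Right is reached through Upper and Left
   through Lower, which is symmetric under t |-> - t. *)
Let via k := match k with Right => Upper | Left => Lower | k => k end.
Let entry k : R * R := match k with
  | Upper | Right => (0, 1) | Lower | Left => (0, -1) | Middle => O end.
Let corner k : R * R := match k with
  | Right => (2, 1) | Left => (-2, -1) | k => entry k end.

Let corner_in k : [/\ in_region Middle (entry k), in_region (via k) (entry k),
  in_region (via k) (corner k) & in_region k (corner k)].
Proof. by case: k; split => /=; lra. Qed.

Definition standard k t (a : pi1 R T O t) :=
  exists (b1 : pi1 R T O (entry k)) (b2 : pi1 R T (entry k) (corner k)) (b3 : pi1 R T (corner k) t),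
  [/\ in_seg Middle b1, in_seg (via k) b2, in_seg k b3 & a = pmul b1 (pmul b2 b3)].

Lemma standard_exists k t : in_region k t -> exists a : pi1 R T O t, standard k a.
Proof.
move=> kt; have [h1 h2 h3 h4] := corner_in k.
have [|b1 s1] := @in_seg_exists Middle O (entry k) _ h1; first by rewrite /=; lra.
have [b2 s2] := in_seg_exists h2 h3; have [b3 s3] := in_seg_exists h4 kt.
by eexists; exists b1, b2, b3.
Qed.

Lemma standard_unique k t (a b : pi1 R T O t) : standard k a -> standard k b -> a = b.
Proof.
move=> [a1 [a2 [a3 [s1 s2 s3 ->]]]] [b1 [b2 [b3 [r1 r2 r3 ->]]]].
by rewrite (in_seg_unique s1 r1) (in_seg_unique s2 r2) (in_seg_unique s3 r3).
Qed.

Lemma standard_end k t (a : pi1 R T O t) : standard k a -> in_region k t.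
Proof. by move=> [a1 [a2 [a3 [_ _ s3 _]]]]; case: (in_seg_ends s3). Qed.

Lemma standard_trans k t t' (a : pi1 R T O t) (b : pi1 R T t t') :
  standard k a -> in_seg k b -> standard k (pmul a b).
Proof.
move=> [a1 [a2 [a3 [s1 s2 s3 ->]]]] sb; exists a1, a2, (pmul a3 b).
by split => //; [exact: in_segM|rewrite !pmulA].
Qed.

(** The pairs left open are exactly those whose [transition] is not 1. For the other pairs of
    distinct meeting cells, the parts in which the two standard paths differ can be moved into a
    single convex cell. *)
Lemma standard_agree k l t (a b : pi1 R T O t) : standard k a -> standard l b ->
  match k, l with
  | Lower, Right | Right, Lower | Upper, Left | Left, Upper => True
  | _, _ => a = b end.
Proof.
have toMiddle l' (c d : pi1 R T O t) : l' = Upper \/ l' = Lower ->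
    standard Middle c -> standard l' d -> c = d.
  move=> hl sc sd; have lt := standard_end sd; have Mt := standard_end sc.
  have [M1 M2 M3 M4] := corner_in l'.
  case: hl => el; subst l';
  case: sc sd => [a1 [a2 [a3 [s1 s2 s3 ->]]]] [b1 [b2 [b3 [r1 r2 r3 ->]]]];
  (apply: (@in_seg_unique Middle); first by do 2?apply: in_segM);
  apply: in_segM => //.
    by apply: (@in_seg_change Upper) => //; exact: in_segM.
  by apply: (@in_seg_change Lower) => //; exact: in_segM.
have toRight k' l' (c d : pi1 R T O t) : k' = Upper /\ l' = Right \/ k' = Lower /\ l' = Left ->
    standard k' c -> standard l' d -> c = d.
  move=> hl sc sd; have lt := standard_end sd; have kt := standard_end sc.
  have [M1 M2 M3 M4] := corner_in l'.
  case: hl => -[ek el]; subst k' l';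
  case: sc sd => [a1 [a2 [a3 [s1 s2 s3 ->]]]] [b1 [b2 [b3 [r1 r2 r3 ->]]]];
  rewrite (in_seg_unique s1 r1); congr pmul.
    apply: (@in_seg_unique Upper); apply: in_segM => //.
    exact: (@in_seg_change Right).
  apply: (@in_seg_unique Lower); apply: in_segM => //.
  exact: (@in_seg_change Left).
move=> sa sb; have kt := standard_end sa; have lt := standard_end sb.
case: k sa kt; case: l sb lt => sb lt sa kt //; try exact: (standard_unique sa sb);
  first [by exfalso; move: kt lt => /=; lra
        |by apply: (toMiddle _ _ _ _ sa sb); [left|..]
        |by apply: (toMiddle _ _ _ _ sa sb); right
        |by apply/esym; apply: (toMiddle _ _ _ _ sb sa); left
        |by apply/esym; apply: (toMiddle _ _ _ _ sb sa); right
        |by apply: (toRight _ _ _ _ _ sa sb); left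
        |by apply: (toRight _ _ _ _ _ sa sb); right
        |by apply/esym; apply: (toRight _ _ _ _ _ sb sa); left
        |by apply/esym; apply: (toRight _ _ _ _ _ sb sa); right].
Qed.

(** The intersection of Lower and Right is convex, so the discrepancy of the two standard classes is
    the same at all its points. The loop [a0] is by definition the discrepancy at (2, -1). *)
Lemma standard_monodromy : exists a0 : pi1 R T O O, forall t (a b : pi1 R T O t),
  standard Lower a -> standard Right b -> a = pmul a0 b.
Proof.
pose t1 : R * R := (2, -1).
have L1 : in_region Lower t1 by rewrite /=; lra.
have R1 : in_region Right t1 by rewrite /=; lra.
have [a1 sa1] := standard_exists L1; have [b1 sb1] := standard_exists R1.
exists (pmul a1 (pinv b1)) => t a b sa sb.
have [c sc] := in_seg_exists L1 (standard_end sa).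
have sc' := in_seg_change R1 (standard_end sb) sc.
rewrite (standard_unique sa (standard_trans sa1 sc)).
by rewrite (standard_unique sb (standard_trans sb1 sc')) -pmulA pmulKp.
Qed.

(** A relation instead of a map on classes, because the negatives of the endpoints are equal but not
    convertible to the desired ones: [- O] is not literally [O]. *)
Definition negated x y x' y' (a : pi1 R T x y) (a' : pi1 R T x' y') :=
  exists p p', [/\ a = pcls p, a' = pcls p' & forall s, p' s = - p s].

Lemma negatedM x y z x' y' z' (a : pi1 R T x y) (b : pi1 R T y z)
    (a' : pi1 R T x' y') (b' : pi1 R T y' z') :
  negated a a' -> negated b b' -> negated (pmul a b) (pmul a' b').
Proof.
move=> [p [p' [-> -> hp]]] [q [q' [-> -> hq]]].
exists (pcat p q), (pcat p' q'); rewrite !pmulE; split => // s /=.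
by rewrite /cat_fun; case: ifP.
Qed.

Lemma in_seg_opp k x y x' y' (a : pi1 R T x y) : x' = - x -> y' = - y -> in_seg k a ->
  exists2 a' : pi1 R T x' y', in_seg (opp_region k) a' & negated a a'.
Proof.
move=> -> -> [p hp ->]; have ko s : in_region (opp_region k) (- p s).
  by apply/in_opp_region.
have cp : continuous (fun s => - p s).
  by move=> s; apply: continuousN; exact: path_cont p s.
have e0 : - p 0 = - x by rewrite path_src.
have e1 : - p 1 = - y by rewrite path_tgt.
pose q := PathIn cp (fun s => region_sub (ko s)) e0 e1.
by exists (pcls q); [exists q|exists p, q].
Qed.

Lemma standard_opp k t (a : pi1 R T O t) : standard k a ->
  exists2 a' : pi1 R T O (- t), standard (opp_region k) a' & negated a a'.
Proof.
have oE (x y : R) : - ((x, y) : R * R) = (- x, - y) by [].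
have e0 : O = - O by rewrite oE oppr0.
have e1 l : entry (opp_region l) = - entry l.
  by case: l; rewrite /= oE ?oppr0 ?opprK.
have e2 l : corner (opp_region l) = - corner l.
  by case: l; rewrite /= oE ?oppr0 ?opprK.
have e3 l : via (opp_region l) = opp_region (via l) by case: l.
move=> [b1 [b2 [b3 [s1 s2 s3 ->]]]].
have [c1 r1 n1] := in_seg_opp e0 (e1 k) s1; have [c2 r2 n2] := in_seg_opp (e1 k) (e2 k) s2.
have [c3 r3 n3] := in_seg_opp (e2 k) (erefl (- t)) s3.
exists (pmul c1 (pmul c2 c3)); last by do 2?apply: negatedM.
by exists c1, c2, c3; rewrite e3.
Qed.

End TwicePunctured.

Section Cast.
Context {R : realType} {X : topologicalType} {A : set X}.
Implicit Types x y z : X.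

(** The identifications made by the quotient map, such as [j (- t, neg u) = j (t, u)], are
    propositional, so classes must be moved between the corresponding types. *)
Definition pcast x y x' y' (ex : x = x') (ey : y = y') (a : pi1 R A x y) : pi1 R A x' y' :=
  match ex in _ = x', ey in _ = y' return pi1 R A x' y' with erefl, erefl => a end.

Lemma pcast_pcls x y x' y' (ex : x = x') (ey : y = y') (p : path_in A x y) (q : path_in A x' y') :
  (forall s, 0 <= s <= 1 -> p s = q s) -> pcast ex ey (pcls p) = pcls q.
Proof. by case: _ / ex q; case: _ / ey => q; exact: eq_pcls. Qed.

Lemma pcastMr x y z z' (ez : z = z') (a : pi1 R A x y) (b : pi1 R A y z) :
  pcast erefl ez (pmul a b) = pmul a (pcast erefl ez b).
Proof. by case: _ / ez. Qed.

Lemma pcastMm x y y' z z' (ey : y = y') (ey' : y' = y) (ez : z = z')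
    (a : pi1 R A x y) (b : pi1 R A y' z) :
  pmul (pcast erefl ey a) (pcast erefl ez b) = pmul a (pcast ey' ez b).
Proof. by case: _ / ey ey' b => ey' b; case: _ / ez; rewrite (Prop_irrelevance ey' erefl). Qed.

Lemma pcastM x y y' z z' (ey : y = y') (ez : z = z') (a : pi1 R A x y) (b : pi1 R A y z) :
  pmul (pcast erefl ey a) (pcast ey ez b) = pcast erefl ez (pmul a b).
Proof. by case: _ / ey; case: _ / ez. Qed.

Lemma pcast_comp x y z w (e : y = z) (f : z = w) (g : y = w) (a : pi1 R A x y) :
  pcast erefl f (pcast erefl e a) = pcast erefl g a.
Proof. by case: _ / f g; case: _ / e => g; rewrite (Prop_irrelevance g erefl). Qed.

End Cast.

(** * The quotient of (C minus two points) x S by a free involution *)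

Section Cylinder.
Context {R : realType} {V B : topologicalType} {I : Type}.
Variables (S : set V) (neg : V -> V) (sgn : I -> V -> R) (j : (R * R) * V -> B) (u0 : V).
Local Notation T := (@twice_punctured R).
Local Notation X := (T `*` S).
Hypotheses (S_sc : @simply_connected R V S) (Su0 : S u0).
Hypotheses (S_neg : forall u, S u -> S (neg u)) (neg_cont : continuous neg) (negK : involutive neg).
(** Odd functions without a common zero on [S]: the sign of each one singles out a representative of
    every pair of opposite points where it does not vanish, which trivialises the double cover
    locally. *)
Hypotheses (sgn_cont : forall i, continuous (sgn i))
  (sgn_neg : forall i u, sgn i (neg u) = - sgn i u)
  (sgn_cover : forall u, S u -> exists i, sgn i u != 0).
Hypotheses (j_cont : {in X, continuous j})
  (j_open : forall w O, X w -> nbhs w O -> nbhs (j w) (j @` (O `&` X)))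
  (j_neg : forall t u, j (- t, neg u) = j (t, u))
  (j_fibre : forall t u t' u', X (t, u) -> X (t', u') -> j (t, u) = j (t', u') ->
     (t' = t /\ u' = u) \/ (t' = - t /\ u' = neg u)).

Definition cylinder_image : set B := j @` X.
Local Notation E := cylinder_image.

Let jXE w : X w -> E (j w). Proof. by move=> Xw; exists w. Qed.

(* Of the two representatives (t, u) and (- t, neg u) of a point, exactly one has
   [sgn i u > 0], as soon as [sgn i u <> 0]. *)
Let rep (k : region) (i : I) (x : B) t u :=
  [/\ in_region k t, S u, 0 < sgn i u & j (t, u) = x].

Let rep_unique k l i x t u t' u' : rep k i x t u -> rep l i x t' u' -> t' = t /\ u' = u.
Proof.
move=> [kt Su su jx] [kt' Su' su' jx'].
have Xw : X (t, u) by split=> //=; exact: region_sub kt.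
have Xw' : X (t', u') by split=> //=; exact: region_sub kt'.
case: (j_fibre Xw Xw'); [by rewrite jx jx'|by []|].
by case=> _ e; exfalso; move: su'; rewrite e sgn_neg; lra.
Qed.

Definition chart (c : region * I) : set B := [set x | exists t u, rep c.1 c.2 x t u].

(* Passing from (t, u) to (- t, neg u) contributes a factor kappa. *)
Let fibre_value (k : region) (c : region * I) u : quadric_group :=
  if 0 < sgn c.2 u then transition k c.1 else (transition k (opp_region c.1) * kappa)%g.

(** Over the chart [c] the representative [u] of [x] exists and is unique by [rep_unique]; [u0] is
    only the default value of [xget]. *)
Definition chart_transition (c d : region * I) x : quadric_group :=
  fibre_value c.1 d (xget u0 [set u | exists t, rep c.1 c.2 x t u]).

Let chart_transitionE c d x t u : rep c.1 c.2 x t u ->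
  chart_transition c d x = fibre_value c.1 d u.
Proof.
move=> h; rewrite /chart_transition; congr fibre_value.
have [t' h'] := @xgetPex _ u0 [set u | exists t, rep c.1 c.2 x t u] (ex_intro _ u (ex_intro _ t h)).
by have [] := rep_unique h h'.
Qed.

Let chart_pos c t u : T t -> S u -> chart c (j (t, u)) -> 0 < sgn c.2 u -> in_region c.1 t.
Proof.
move=> Tt Su [t' [u' [kt' Su' su' e]]] su.
have Xw' : X (t', u') by split=> //=; exact: region_sub kt'.
have [[-> //]|[_ eu]] := j_fibre Xw' (conj Tt Su : X (t, u)) e.
by exfalso; move: su; rewrite eu sgn_neg; lra.
Qed.

Let chart_neg c t u : T t -> S u -> chart c (j (t, u)) -> sgn c.2 u < 0 ->
  in_region c.1 (- t).
Proof.
move=> Tt Su [t' [u' [kt' Su' su' e]]] su.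
have Xw' : X (t', u') by split=> //=; exact: region_sub kt'.
have [[_ eu]|[-> _]] := j_fibre Xw' (conj Tt Su : X (t, u)) e; last by rewrite opprK.
by exfalso; move: su; rewrite eu; lra.
Qed.

Let chart_nz c t u : T t -> S u -> chart c (j (t, u)) -> sgn c.2 u != 0.
Proof.
move=> Tt Su [t' [u' [kt' Su' su' e]]].
have Xw' : X (t', u') by split=> //=; exact: region_sub kt'.
have [[_ ->]|[_ ->]] := j_fibre Xw' (conj Tt Su : X (t, u)) e.
  by rewrite gt_eqF.
by rewrite sgn_neg oppr_eq0 gt_eqF.
Qed.

(** For a point of the cell [k], the values [fibre_value k c u] are the coordinates of a single
    fibre element in all charts [c]. Taking [k] to be the cell of a chart gives the cocycle law;
    letting the point move gives lifts of paths, in [hol_lift]. *)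
Let fibre_valueM k c d t u : in_region k t -> S u ->
  chart c (j (t, u)) -> chart d (j (t, u)) ->
  (fibre_value k c u * chart_transition c d (j (t, u)) = fibre_value k d u)%g.
Proof.
move=> kt Su Uc Ud; have Tt := region_sub kt.
have dT : sgn d.2 u < 0 -> in_region (opp_region d.1) t.
  by move=> h; rewrite -[t]opprK; apply/in_opp_region; exact: chart_neg Ud h.
have := chart_nz Tt Su Uc; rewrite /fibre_value; case: ltrgt0P => // su _.
  have ct := chart_pos Tt Su Uc su.
  rewrite (@chart_transitionE c d _ t u) // /fibre_value.
  have := chart_nz Tt Su Ud; case: ltrgt0P => // su' _.
    by rewrite (transition_cocycle kt ct (chart_pos Tt Su Ud su')).
  by rewrite mulgA (transition_cocycle kt ct (dT su')).
have ct := chart_neg Tt Su Uc su.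
have oct : in_region (opp_region c.1) t by rewrite -[t]opprK; apply/in_opp_region.
rewrite (@chart_transitionE c d _ (- t) (neg u)); last first.
  by split => //; [exact: S_neg|rewrite sgn_neg oppr_gt0].
(* Moving [kappa] to the right past a transition replaces both cells by their opposites; two factors
   [kappa] that meet then cancel. *)
have trE a b : (kappa * transition a b = transition (opp_region a) (opp_region b) * kappa)%g.
  by rewrite transition_opp -!mulgA kappa2 mulg1.
rewrite /fibre_value sgn_neg oppr_gt0.
have := chart_nz Tt Su Ud; case: ltrgt0P => // su' _.
  rewrite -mulgA [(kappa * _)%g]mulgA trE opp_regionK -mulgA kappa2 mulg1.
  by rewrite (transition_cocycle kt oct (chart_pos Tt Su Ud su')).
by rewrite -mulgA trE mulgA (transition_cocycle kt oct (dT su')).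
Qed.

Let chart_open c x : chart c x -> nbhs x (chart c).
Proof.
move=> [t [u [kt Su su <-]]].
have n1 : nbhs (t, u) [set w : (R * R) * V | in_region c.1 w.1 /\ 0 < sgn c.2 w.2].
  have c1 : continuous (fun w : (R * R) * V => sgn c.2 w.2) by have hc := @sgn_cont c.2; rcont.
  have c2 : continuous (fun w : (R * R) * V => w.1) by rcont.
  have m1 : nbhs (t, u) _ := c1 (t, u) _ (lt_nbhsr su).
  have m2 : nbhs (t, u) _ := c2 (t, u) _ (region_open kt).
  by apply: filterS2 m1 m2 => w.
have Xw : X (t, u) by split => //=; exact: region_sub kt.
apply: filterS (j_open Xw n1) => y [[t' u'] [[/= h1 h2] [_ /= Su']] <-].
by exists t', u'.
Qed.

Lemma cylinder_local_system : local_system E chart chart_transition.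
Proof.
split.
- exact: chart_open.
- move=> x [[t u] [/= Tt Su] <-]; have [k kt] := region_cover Tt.
  have [i /lt_total/orP[h|h]] := sgn_cover Su.
    exists (opp_region k, i), (- t), (neg u); split => //.
    + by apply/in_opp_region.
    + exact: S_neg.
    + by rewrite sgn_neg oppr_gt0.
  by exists (k, i), t, u.
- move=> c d e x Uc Ud Ue; have [t [u [kt Su su jx]]] := Uc.
  rewrite (@chart_transitionE c d x t u) // (@chart_transitionE c e x t u) // -jx.
  by apply: fibre_valueM => //; rewrite jx.
- move=> c d x [t [u [kt Su su jx]]] Ud.
  have Tt := region_sub kt; have Xw : X (t, u) by [].
  (* On [O] the chosen representative does not switch sheets and the sign relevant to the chart [d]
     is constant, hence so is [fibre_value]. *)
  pose O := [set w : (R * R) * V | [/\ in_region c.1 w.1, 0 < sgn c.2 w.2 & (0 < sgn d.2 w.2) = (0 < sgn d.2 u)]].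
  have n1 : nbhs (t, u) O.
    have c0 i : continuous (fun w : (R * R) * V => sgn i w.2) by have hc := @sgn_cont i; rcont.
    have c2 : continuous (fun w : (R * R) * V => w.1) by rcont.
    have m1 : nbhs (t, u) _ := c0 c.2 (t, u) _ (lt_nbhsr su).
    have m2 : nbhs (t, u) _ := c2 (t, u) _ (region_open kt).
    have m3 : nbhs (t, u) [set w : (R * R) * V | (0 < sgn d.2 w.2) = (0 < sgn d.2 u)].
      rewrite -jx in Ud; have := chart_nz Tt Su Ud; case: ltrgt0P => // su' _.
        have m : nbhs (t, u) _ := c0 d.2 (t, u) _ (lt_nbhsr su').
        by apply: filterS m => w /= ->.
      have m : nbhs (t, u) _ := c0 d.2 (t, u) _ (lt_nbhsl su').
      by apply: filterS m => w /= h; apply/negbTE; rewrite -leNgt ltW.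
    by apply: filterS3 m1 m2 m3 => w /= ? ? ?.
  rewrite -jx; apply: filterS (j_open Xw n1) => y [[t' u'] [[/= h1 h2 h3] [_ /= Su']] <-].
  rewrite (@chart_transitionE c d _ t' u') // (@chart_transitionE c d _ t u) //.
  by rewrite /fibre_value h3.
Qed.

(** Inside one chart the representative with positive sign is unique, so it can be chosen pointwise;
    continuity of the choice then follows from the openness of [j]. *)
Let lift_path k i y z (p : @path_in R B E y z) : (forall s, chart (k, i) (p s)) ->
  exists tau ups, [/\ continuous tau, continuous ups & forall s, rep k i (p s) (tau s) (ups s)].
Proof.
move=> hp.
have [w hw] := choice (fun s => (let: ex_intro t (ex_intro u h) := hp s in
  ex_intro _ (t, u) h : exists w, rep k i (p s) w.1 w.2)).
have Xw s : X (w s).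
  by have [h1 h2 _ _] := hw s; split => //=; exact: region_sub h1.
have cw : continuous w.
  move=> s O nO.
  (* Keeping the sign positive ensures that a preimage found in [O'] is the chosen representative
     and not its opposite. *)
  pose O' := O `&` [set v | 0 < sgn i v.2].
  have nO' : nbhs (w s) O'.
    have hc := @sgn_cont i; have c1 : continuous (fun v : (R * R) * V => sgn i v.2) by rcont.
    have [_ _ su _] := hw s.
    by apply: filterI => //; exact: (c1 (w s) _ (lt_nbhsr su)).
  have n1 := j_open (Xw s) nO'.
  have [_ _ _ js] := hw s.
  rewrite -surjective_pairing in js.
  have n2 : nbhs s (p @^-1` (j @` (O' `&` X))) by rewrite js in n1; exact: (path_cont p s _ n1).
  apply: filterS n2 => s' [v [[Ov sv] [Tv Sv]] jv].
  suff e : w s' = v by rewrite /= e.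
  have [kt' Su' su' js'] := hw s'.
  have jj : j (v.1, v.2) = j ((w s').1, (w s').2) by rewrite -surjective_pairing jv js'.
  have [[e1 e2]|[_ e2]] := j_fibre (conj Tv Sv) (Xw s') jj.
    by rewrite [LHS]surjective_pairing [RHS]surjective_pairing e1 e2.
  by exfalso; move: su'; rewrite e2 sgn_neg; move: sv => /=; lra.
exists (fun s => (w s).1), (fun s => (w s).2); split => //; rcont.
Qed.

Local Notation O := ((0, 0) : R * R).

Let jm x y (a : pi1 R X x y) : pi1 R E (j x) (j y) := pmap j_cont jXE a.

(** Opposite paths have the same image in the quotient. In the second factor [om'] may be any class
    with the right ends, because [S] is simply connected. *)
Let jm_neg x y v w x' y' v' w' (th : pi1 R T x y) (th' : pi1 R T x' y')
    (om : pi1 R S v w) (om' : pi1 R S v' w')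
    (e : j (x', v') = j (x, v)) (e' : j (y', w') = j (y, w)) :
  negated th th' -> v' = neg v -> w' = neg w ->
  pcast e e' (jm (ppair th' om')) = jm (ppair th om).
Proof.
move=> [p [p' [-> -> hp]]] ev ew; have [q ->] := pcls_surj om.
have cq : continuous (fun s => neg (q s)) by have := path_cont q => cq; rcont.
have e0 : neg (q 0) = v' by rewrite path_src.
have e1 : neg (q 1) = w' by rewrite path_tgt.
rewrite (S_sc.2 _ _ om' (pcls (PathIn cq (fun s => S_neg (path_val q s)) e0 e1))).
rewrite !ppairE /jm !pmapE; apply: pcast_pcls => s _ /=.
by rewrite hp j_neg.
Qed.

Section Monodromy.
Variables (t0 : R * R) (k0 : region) (i0 : I).
Hypothesis sgn0 : 0 < sgn i0 u0.
Local Notation x0 := (j (t0, u0)).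
Variable th0 : pi1 R T O t0.
Hypothesis th0_std : standard k0 th0.
Variable a0 : pi1 R T O O.
Hypothesis a0P : forall t (a b : pi1 R T O t),
  standard Lower a -> standard Right b -> a = pmul a0 b.
Variable om0 : pi1 R S u0 (neg u0).

Let TO : T O. Proof. by apply: (@region_sub _ Middle); rewrite /=; lra. Qed.
Let Tt0 : T t0. Proof. exact: region_sub (standard_end th0_std). Qed.
Let Ex0 : E x0. Proof. by apply: jXE. Qed.
Let delta : pi1 R E x0 (j (O, u0)) := pinv (jm (ppair th0 (pone Su0))).

Let eN : j (O, neg u0) = j (O, u0).
Proof. by rewrite -[RHS]j_neg (_ : - O = O) // -[LHS]/(- 0, - 0) oppr0. Qed.

Let conj_delta (a : pi1 R E (j (O, u0)) (j (O, u0))) := pmul (pmul delta a) (pinv delta).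

Let conj_deltaM a b : conj_delta (pmul a b) = pmul (conj_delta a) (conj_delta b).
Proof. by rewrite /conj_delta -!pmulA pmulKp. Qed.

Let alphaE := conj_delta (jm (ppair a0 (pone Su0))).
(** The image of a path from [u0] to [neg u0] over the fixed point [O] of the half-turn; it closes
    up in the quotient. *)
Let kappaO : pi1 R E (j (O, u0)) (j (O, u0)) := pcast erefl eN (jm (ppair (pone TO) om0)).
Let kappaE := conj_delta kappaO.

Let negated1 : negated (pone TO) (pone TO).
Proof.
exists (pcst TO), (pcst TO); split => // s /=.
by rewrite -[RHS]/(- 0, - 0) oppr0.
Qed.

Let jmM x y z (a : pi1 R X x y) (b : pi1 R X y z) : jm (pmul a b) = pmul (jm a) (jm b).
Proof. exact: pmapM. Qed.

(** By [jm_neg] the second copy of the loop is also the image of a path from [neg u0] back to [u0].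
    The composite lifts to a loop in [S], which is trivial. *)
Let kappaE2 : pmul kappaE kappaE = pone Ex0.
Proof.
rewrite -conj_deltaM /kappaO (pcastMm _ (esym eN)).
have [om1 _] := S_sc.1 _ _ (S_neg Su0) Su0.
rewrite (@jm_neg _ _ _ _ _ _ _ _ (pone TO) _ (pcls om1)) ?negK //.
rewrite -jmM ppairM pmul1p (S_sc.2 _ _ (pmul _ _) (pone Su0)) /jm.
have -> : (ppair (pone TO) (pone Su0) : pi1 R _ _ _) = pone (conj TO Su0 : X (O, u0)).
  by rewrite /pone ppairE; apply: eq_pcls.
by rewrite pmap1 /conj_delta (pmulp1 _ delta) (pmulpV Ex0).
Qed.

Let phi := pi1_eval Ex0 alphaE kappaE.

Let phiM x y : phi (x * y)%g = pmul (phi x) (phi y).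
Proof. exact: (@pi1_evalM R B E x0 Ex0 alphaE kappaE kappaE2). Qed.
Let phi1 : phi 1%g = pone Ex0.
Proof. exact: (@pi1_eval1 R B E x0 Ex0 alphaE kappaE kappaE2). Qed.
Let phi_alpha : phi alpha = alphaE.
Proof. exact: (@pi1_eval_alpha R B E x0 Ex0 alphaE kappaE kappaE2). Qed.
Let phi_kappa : phi kappa = kappaE.
Proof. exact: (@pi1_eval_kappa R B E x0 Ex0 alphaE kappaE kappaE2). Qed.

(** Only the first factor of the path is prescribed: all choices of [om] are equal in [S]. *)
Let std k t u (a : pi1 R E x0 (j (t, u))) :=
  exists th om, standard k th /\ a = pmul delta (jm (ppair th om)).

Let std_exists k t u : in_region k t -> S u -> exists a : pi1 R E x0 (j (t, u)), std k a.
Proof.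
move=> kt Su; have [th sth] := standard_exists kt.
by have [om _] := S_sc.1 _ _ Su0 Su; eexists; exists th, (pcls om).
Qed.

Let std_unique k t u (a b : pi1 R E x0 (j (t, u))) : std k a -> std k b -> a = b.
Proof.
move=> [th [om [s ->]]] [th' [om' [s' ->]]].
by rewrite (standard_unique s s') (S_sc.2 _ _ om om').
Qed.

(** Negating a standard path to [(- t, neg u)] gives one from [(O, neg u0)] to [(t, u)] with the
    same image; preceded by the path that defines [kappaO], it becomes standard for the cell [k]. *)
Let std_opp k t u (a : pi1 R E x0 (j (t, u))) (a' : pi1 R E x0 (j (- t, neg u))) :
  std k a -> std (opp_region k) a' -> a = pmul kappaE (pcast erefl (j_neg t u) a').
Proof.
move=> [th [om [s ->]]] [th' [om' [s' ->]]].
have [th2 s2 n2] := standard_opp s; rewrite (standard_unique s' s2).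
have Su : S u by have [q _] := pcls_surj om; rewrite -(path_tgt q); exact: path_val.
have [om1 _] := S_sc.1 _ _ (S_neg Su0) Su.
rewrite pcastMr /kappaE /conj_delta -!pmulA pmulKp; congr pmul.
rewrite /kappaO (pcastMm _ (esym eN)).
rewrite (@jm_neg _ _ _ _ _ _ _ _ th _ (pcls om1)) ?negK //.
by rewrite -jmM ppairM pmul1p (S_sc.2 _ _ (pmul _ _) om).
Qed.

Let std_alpha t u (a b : pi1 R E x0 (j (t, u))) :
  std Lower a -> std Right b -> a = pmul alphaE b.
Proof.
move=> [th [om [s ->]]] [th' [om' [s' ->]]].
rewrite (a0P s s') /alphaE /conj_delta -!pmulA pmulKp; congr pmul.
by rewrite -jmM ppairM (S_sc.2 _ _ (pmul _ om') om).
Qed.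

(** The half-turn carries Upper and Left to Lower and Right, so [std_alpha] applies between two uses
    of [std_opp]; the outcome is [kappa * alpha * kappa]. *)
Let std_beta t u (a b : pi1 R E x0 (j (t, u))) :
  std Upper a -> std Left b -> a = pmul (phi beta) b.
Proof.
move=> sa sb.
have [ta [oma [s1 _]]] := sa; have [tb [omb [s2 _]]] := sb.
have Su : S (neg u).
  by apply: S_neg; have [q _] := pcls_surj oma; rewrite -(path_tgt q); exact: path_val.
have [a' sa'] : exists a' : pi1 R E x0 (j (- t, neg u)), std Lower a'.
  by apply: std_exists => //; apply/(in_opp_region Upper); exact: standard_end s1.
have [b' sb'] : exists b' : pi1 R E x0 (j (- t, neg u)), std Right b'.
  by apply: std_exists => //; apply/(in_opp_region Left); exact: standard_end s2.
rewrite (std_opp (k := Upper) sa sa') (std_opp (k := Left) sb sb') (std_alpha sa' sb').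
rewrite pcastMr betaE !phiM phi_kappa phi_alpha.
by rewrite -(pmulA (pmul kappaE alphaE) kappaE) (pmulA kappaE kappaE) kappaE2 pmul1p pmulA.
Qed.

Let std_agree k l t u (a b : pi1 R E x0 (j (t, u))) :
  std k a -> std l b -> a = pmul (phi (transition k l)) b.
Proof.
have phiV g (x y : pi1 R E x0 (j (t, u))) : y = pmul (phi g) x -> x = pmul (phi g^-1%g) y.
  by move=> ->; rewrite pmulA -phiM mulVg phi1 pmul1p.
move=> sa sb; have [th [om [s ea]]] := sa; have [th' [om' [s' eb]]] := sb.
have := standard_agree s s'; case: k sa s => sa s; case: l sb s' => sb s' /=;
  rewrite ?phi1 ?pmul1p ?ea ?eb; try (by move=> ->; rewrite (S_sc.2 _ _ om om'));
  move=> _; rewrite -?ea -?eb.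
- exact: std_beta.
- by rewrite phi_alpha; exact: std_alpha.
- by apply: phiV; rewrite phi_alpha; exact: std_alpha.
- by apply: phiV; exact: std_beta.
Qed.

Let std_trans k t u t' u' (a : pi1 R E x0 (j (t, u))) (th : pi1 R T t t') (om : pi1 R S u u') :
  std k a -> in_seg k th -> std k (pmul a (jm (ppair th om))).
Proof.
move=> [th1 [om1 [s1 ->]]] sth; exists (pmul th1 th), (pmul om1 om).
by split; [exact: standard_trans|rewrite -pmulA -jmM ppairM].
Qed.

(* [over c a]: the class [a] is the standard one over the chart [c]. *)
Let over c x (a : pi1 R E x0 x) := exists t u (e : j (t, u) = x) b,
  [/\ in_region c.1 t, S u, 0 < sgn c.2 u, std c.1 b & a = pcast erefl e b].

Let over_exists c x : chart c x -> exists a : pi1 R E x0 x, over c a.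
Proof.
move=> [t [u [ct Su su e]]]; have [b sb] := std_exists ct Su.
by exists (pcast erefl e b), t, u, e, b.
Qed.

Let over_unique c x (a b : pi1 R E x0 x) : over c a -> over c b -> a = b.
Proof.
move=> [t [u [e [a' [ct Su su sa ->]]]]] [t' [u' [e' [b' [ct' Su' su' sb ->]]]]].
have [et eu] : t' = t /\ u' = u by apply: (@rep_unique c.1 c.1 c.2 x).
by subst t' u'; rewrite (Prop_irrelevance e' e) (std_unique sa sb).
Qed.

Let over_chart c x (a : pi1 R E x0 x) : over c a -> chart c x.
Proof. by move=> [t [u [e [b [ct Su su _ _]]]]]; exists t, u. Qed.

(** The link between algebra and topology: reference classes change from chart to chart by the
    images of the abstract transitions. A change of sheet contributes the factor [kappa] through
    [std_opp]. *)
Let over_agree c d x (a b : pi1 R E x0 x) : over c a -> over d b ->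
  a = pmul (phi (chart_transition c d x)) b.
Proof.
move=> oa ob; have Ud := over_chart ob; have Uc := over_chart oa.
case: oa => [t [u [e [a' [ct Su su sa ->]]]]].
have Tt := region_sub ct.
rewrite (@chart_transitionE c d x t u) // /fibre_value.
have Ud' : chart d (j (t, u)) by rewrite e.
have := chart_nz Tt Su Ud'; case: ltrgt0P => // su' _.
  have dt := chart_pos Tt Su Ud' su'; have [b' sb'] := std_exists dt Su.
  have ob' : over d (pcast erefl e b') by exists t, u, e, b'.
  by rewrite (over_unique ob ob') (std_agree sa sb') pcastMr.
have dt := chart_neg Tt Su Ud' su'; have dt' : in_region (opp_region d.1) t.
  by rewrite -[t]opprK; apply/in_opp_region.
have [b1 sb1] := std_exists dt' Su.
have [b2 sb2] := std_exists dt (S_neg Su).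
have e2 : j (- t, neg u) = x by rewrite j_neg.
have ob' : over d (pcast erefl e2 b2).
  by exists (- t), (neg u), e2, b2; rewrite sgn_neg oppr_gt0; split => //; exact: S_neg.
rewrite (over_unique ob ob') (std_agree sa sb1) pcastMr phiM -pmulA; congr pmul.
rewrite (@std_opp _ _ _ b1 b2 sb1) ?opp_regionK // pcastMr phi_kappa; congr pmul.
exact: pcast_comp.
Qed.

(** Within a chart the path lifts to one whose plane coordinate stays in a single cell, and
    extending a standard path inside its cell keeps it standard. *)
Let over_trans c y z (p : @path_in R B E y z) (a : pi1 R E x0 y) :
  (forall s, chart c (p s)) -> over c a -> over c (pmul a (pcls p)).
Proof.
case: c => k i hp [t [u [e [b [ct Su su sb ->]]]]].
have [tau [ups [ctau cups hrep]]] := lift_path hp.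
have [/= e0 e1] : tau 0 = t /\ ups 0 = u.
  by apply: (@rep_unique k k i y) => //; rewrite -(path_src p).
have Ttau s : T (tau s) by have [h _ _ _] := hrep s; exact: region_sub h.
have Sups s : S (ups s) by have [_ h _ _] := hrep s.
have [kt1 Su1 su1 j1] := hrep 1.
have e2 : j (tau 1, ups 1) = z by rewrite j1 path_tgt.
pose th := PathIn ctau Ttau e0 (erefl (tau 1)).
pose om := PathIn cups Sups e1 (erefl (ups 1)).
have -> : pcls p = pcast e e2 (jm (ppair (pcls th) (pcls om))).
  rewrite ppairE /jm pmapE; apply/esym; apply: pcast_pcls => s _ /=.
  by have [_ _ _ ->] := hrep s.
rewrite pcastM; exists (tau 1), (ups 1), e2; eexists; split; last reflexivity => //.
- by [].
- by [].
- by [].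
- apply: std_trans => //; exists th => // s.
  by have [h _ _ _] := hrep s.
Qed.

Let LS := cylinder_local_system.
Local Notation Hol := (hol chart chart_transition).

(** On short pieces of [p] both the section and the reference class are constant in one chart;
    [over_agree] accounts for the changes of chart at the ends, and the pieces are added up. *)
Let over_hol c d y z (p : @path_in R B E y z) g a b :
  over c a -> over d b -> Hol c d p g -> pmul a (pcls p) = pmul (phi g) b.
Proof.
case: p => p cp Ap py pz; case: _ / py a => a; case: _ / pz b => b.
rewrite -(psub01 cp Ap) /= => oa ob [l [[l1 l2] l0 lg]].
have I0 : 0 <= (0 : R) <= 1 by rewrite lexx ler01.
(* With [l 0 c] kept as a factor in place of its value 1, the claim becomes additive over
   subintervals. *)
suff : forall c d a b, over c a -> over d b ->
    pmul (phi (l 0 c)) (pmul a (pcls (psub cp Ap 0 1))) = pmul (phi (l 1 d)) b.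
  by move=> /(_ c d a b oa ob); rewrite l0 lg phi1 pmul1p.
clear c d a b g oa ob l0 lg.
apply: (@interval_induction R (fun s t => forall c d a b, over c a -> over d b ->
    pmul (phi (l s c)) (pmul a (pcls (psub cp Ap s t))) = pmul (phi (l t d)) b)).
  move=> s t v _ _ _ _ h1 h2 c d a b oa ob.
  have [e Ue] := ls_cover LS (Ap t); have [m om] := over_exists Ue.
  by rewrite -(psub_cat cp Ap s t v) !pmulA -(pmulA _ a) (h1 c e a m) // -pmulA; exact: h2.
move=> x Ix; have [e Ue] := ls_cover LS (Ap x).
have n1 := l2 x e Ix Ue.
have n3 : nbhs x (p @^-1` chart e) by apply: cp; exact: chart_open.
have [r /= r_gt0 hr] : exists2 r : R, 0 < r & ball (x : R) r `<=` p @^-1` chart e `&`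
    [set z | 0 <= z <= 1 -> l z e = l x e].
  by apply/nbhs_ballP; apply: filterI.
have {}hr v : x - r < v -> v < x + r -> chart e (p v) /\ (0 <= v <= 1 -> l v e = l x e).
  by move=> h1 h2; apply: hr; rewrite /ball /= ltr_distl; lra.
exists r => // s t xs st tx s0 t1 c d a b oa ob.
have Is : 0 <= s <= 1 by apply/andP; split; lra.
have It : 0 <= t <= 1 by apply/andP; split; lra.
have [||Us ls] := hr s => //; first by lra.
have [||Ut lt] := hr t => //; first by lra.
have [a' oa'] := over_exists Us; have [b' ob'] := over_exists Ut.
have ob2 : over e (pmul a' (pcls (psub cp Ap s t))).
  apply: over_trans => // v /=; have := psub_range v st.
  by set w := _ + _ * _ => hw; apply: (proj1 (hr w _ _)); lra.
rewrite (over_agree oa oa') (over_agree ob ob') -(over_unique ob2 ob') !pmulA -!phiM.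
by rewrite -(l1 s c e Is (over_chart oa) Us) -(l1 t d e It (over_chart ob) Ut) ls // lt.
Qed.

Let over_base : over (k0, i0) (pone Ex0).
Proof.
exists t0, u0, erefl, (pone Ex0); split => //; first exact: standard_end th0_std.
exists th0, (pone Su0); split => //; rewrite /delta pmulVp //.
Qed.

(** The holonomy of a path that stays in the cell [k] upstairs is read off its endpoint, even if the
    sign of [sgn i] changes on the way: the section is [fibre_value] along the lift. *)
Let hol_lift k i d t u t' u' (tau : path_in T t t') (ups : @path_in R V S u u') :
  (forall s, in_region k (tau s)) -> 0 < sgn i u ->
  Hol (k, i) d (fun s => j (tau s, ups s)) (fibre_value k d u').
Proof.
move=> htau su; exists (fun s c => fibre_value k c (ups s)); split.
- split=> [s c e _ Uc Ue|s c _ Uc].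
    by rewrite fibre_valueM //; exact: path_val.
  have := chart_nz (path_val tau s) (path_val ups s) Uc.
  have hc := @sgn_cont c.2; have cu := path_cont ups.
  have c1 : continuous (fun s => sgn c.2 (ups s)) by rcont.
  rewrite /fibre_value; case: ltrgt0P => // su' _.
    have n : nbhs s _ := c1 s _ (lt_nbhsr su').
    by apply: filterS n => s' /= ->.
  have n : nbhs s _ := c1 s _ (lt_nbhsl su').
  by apply: filterS n => s' /= h _; rewrite ltNge (ltW h).
- by rewrite path_src /fibre_value /= su transition_id.
- by rewrite path_tgt.
Qed.

Let attained x y c d g := exists p : @path_in R B E x y, Hol c d p g.

Let attainedM x y z c d e g h : chart d y ->
  attained x y c d g -> attained y z d e h -> attained x z c e (g * h)%g.
Proof.
move=> Ud [p hp] [q hq]; exists (pcat p q); apply: (hol_cat _ _ hp hq).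
  by rewrite path_tgt path_src.
by rewrite path_tgt.
Qed.

Let attainedV x y c d g : chart c x -> chart d y -> attained x y c d g -> attained y x d c g^-1%g.
Proof.
move=> Uc Ud [p hp]; have [|h hh] := hol_exists LS (c := d) c (path_cont (prev p)) (path_val (prev p)).
  by rewrite path_src.
exists (prev p); suff <- : h = g^-1%g by [].
have Ex : E x by rewrite -(path_src p); exact: path_val.
have hc := hol_cat (e := c) _ _ hp hh.
apply: (mulgI g); rewrite mulgV.
apply: (hol_homotopic LS (c := c) (d := c) (p := pcat p (prev p)) (q := fun=> x)).
- by apply/(pclsP _ (pcst Ex)); rewrite -pmulE -pinvE (pmulpV Ex).
- by rewrite path_src.
- by rewrite path_tgt.
- by apply: hc; rewrite ?path_tgt ?path_src.
- exact: (hol_cst LS Ex Uc).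
Qed.

Let chart_at k x : in_region k x -> chart (k, i0) (j (x, u0)).
Proof. by move=> kx; exists x, u0. Qed.

Let attained_seg k l x y : in_region k x -> in_region k y ->
  attained (j (x, u0)) (j (y, u0)) (k, i0) (l, i0) (transition k l).
Proof.
move=> kx ky; have [_ [p hp _]] := in_seg_exists kx ky.
exists (pmap_path j_cont jXE (ppair_path p (pcst Su0))).
have := @hol_lift k i0 (l, i0) _ _ _ _ p (pcst Su0) hp sgn0.
by rewrite /fibre_value /= sgn0.
Qed.

Let attained_all g : attained (j (O, u0)) (j (O, u0)) (Middle, i0) (Middle, i0) g.
Proof.
have MO : in_region Middle O by rewrite /=; lra.
have UO : chart (Middle, i0) (j (O, u0)) by exact: chart_at.
elim/quadric_group_gen: g.
(* One factor for each side of the loop O, (0,-1), (2,-1), (2,1), (0,1), O around the puncture (1,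
   0). Only the passage from Lower to Right is not 1. *)
- rewrite -[alpha]mul1g -[(1 * alpha)%g]mulg1 -[(1 * alpha * 1)%g]mulg1 -[(1 * alpha * 1 * 1)%g]mulg1.
  apply: (@attainedM _ (j ((0, 1), u0)) _ _ (Middle, i0)).
  + by apply: chart_at; rewrite /=; lra.
  + apply: (@attainedM _ (j ((2, 1), u0)) _ _ (Upper, i0)).
    * by apply: chart_at; rewrite /=; lra.
    * apply: (@attainedM _ (j ((2, -1), u0)) _ _ (Right, i0)).
      - by apply: chart_at; rewrite /=; lra.
      - apply: (@attainedM _ (j ((0, -1), u0)) _ _ (Lower, i0)).
        + by apply: chart_at; rewrite /=; lra.
        + by apply: (@attained_seg Middle Lower); rewrite /=; lra.
        + by apply: (@attained_seg Lower Right); rewrite /=; lra.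
      - by apply: (@attained_seg Right Upper); rewrite /=; lra.
    * by apply: (@attained_seg Upper Middle); rewrite /=; lra.
  + by apply: (@attained_seg Middle Middle); rewrite /=; lra.
(* The plane coordinate rests at [O], and the sign of [sgn i0] is reversed from [u0] to [neg u0], so
   [fibre_value] gives [kappa]. *)
- have [q _] := pcls_surj om0.
  pose p := pmap_path j_cont jXE (ppair_path (pcst TO) q).
  have e1 : p 1 = j (O, u0) by rewrite path_tgt eN.
  exists (PathIn (path_cont p) (path_val p) (path_src p) e1).
  have := @hol_lift Middle i0 (Middle, i0) _ _ _ _ (pcst TO) q (fun=> MO) sgn0.
  rewrite /fibre_value /= sgn_neg oppr_gt0 ltNge (ltW sgn0) /= mul1g; exact.
- by apply: (@attained_seg Middle Middle).
- by move=> x y hx hy; apply: attainedM hx hy.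
- by move=> x; exact: attainedV.
Qed.

Lemma cylinder_pi1_based : exists psi : pi1 R E x0 x0 -> quadric_group,
  bijective psi /\ forall a b, psi (pmul a b) = (psi a * psi b)%g.
Proof.
pose c0 := (k0, i0).
have U0 : chart c0 x0 by apply: chart_at; exact: standard_end th0_std.
have UO : chart (Middle, i0) (j (O, u0)) by apply: chart_at; rewrite /=; lra.
have hex (p : @path_in R B E x0 x0) : exists g, Hol c0 c0 p g.
  by apply: (hol_exists LS) (path_cont p) (path_val p) _; rewrite path_src.
have huniq (p q : @path_in R B E x0 x0) g h : Hol c0 c0 p g -> Hol c0 c0 q h -> pcls p = pcls q -> g = h.
  move=> hp hq /pclsP pq; apply: (hol_homotopic LS pq) hp hq; first by rewrite path_src.
  by rewrite path_tgt.
have [psi hpsi] := choice (fun a : pi1 R E x0 x0 =>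
  let: ex_intro p pa := pcls_surj a in let: ex_intro g hg := hex p in
  ex_intro _ g (ex_intro2 _ _ p pa hg) : exists g, exists2 p, a = pcls p & Hol c0 c0 p g).
have psiE (p : @path_in R B E x0 x0) g : Hol c0 c0 p g -> psi (pcls p) = g.
  by move=> hg; have [q pq hq] := hpsi (pcls p); apply: (huniq q p).
exists psi; split; last first.
  move=> a b; have [p pa hp] := hpsi a; have [q qb hq] := hpsi b.
  rewrite {1}pa {1}qb pmulE; apply: psiE; apply: (hol_cat _ _ hp hq).
    by rewrite path_tgt path_src.
  by rewrite path_tgt.
(* The trivial class is the reference class at both ends, so [over_hol] reads as a left inverse of
   [psi]. *)
have psiK a : a = phi (psi a).
  have [p pa hp] := hpsi a; have := over_hol over_base over_base hp.
  by rewrite pmul1p pmulp1 -pa.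
have inj : injective psi by move=> a b ab; rewrite (psiK a) (psiK b) ab.
have surj g : exists a, psi a = g.
  have [d _] := pcls_surj delta.
  have [|h hh] := hol_exists LS (c := c0) (Middle, i0) (path_cont d) (path_val d).
    by rewrite path_src.
  have ad : attained x0 (j (O, u0)) c0 (Middle, i0) h by exists d.
  (* The loops of [attained_all] are based at [j (O, u0)]; conjugation by the holonomy [h] of a path
     from [x0] is compensated in advance. *)
  have [p hp] : attained x0 x0 c0 c0 (h * (h^-1 * g * h) * h^-1)%g.
    exact: (attainedM UO (attainedM UO ad (attained_all _)) (attainedV U0 UO ad)).
  exists (pcls p); rewrite (psiE _ _ hp) !mulgA mulgV mul1g -mulgA mulgV mulg1 //.
have [phi' hphi'] := choice surj.
by exists phi' => [a|g]; [apply: inj; rewrite hphi'|exact: hphi'].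
Qed.

End Monodromy.

End Cylinder.

Section CylinderImage.
Context {R : realType} {V B : topologicalType} {I : Type}.
Variables (S : set V) (neg : V -> V) (sgn : I -> V -> R) (j : (R * R) * V -> B).
Local Notation X := (@twice_punctured R `*` S).

Theorem cylinder_pi1 :
  @simply_connected R V S ->
  (forall u, S u -> S (neg u)) -> continuous neg -> involutive neg ->
  (forall i, continuous (sgn i)) -> (forall i u, sgn i (neg u) = - sgn i u) ->
  (forall u, S u -> exists i, sgn i u != 0) ->
  {in X, continuous j} ->
  (forall w O, X w -> nbhs w O -> nbhs (j w) (j @` (O `&` X))) ->
  (forall t u, j (- t, neg u) = j (t, u)) ->
  (forall t u t' u', X (t, u) -> X (t', u') -> j (t, u) = j (t', u') ->
     (t' = t /\ u' = u) \/ (t' = - t /\ u' = neg u)) ->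
  forall x, (j @` X) x -> exists psi : pi1 R (j @` X) x x -> quadric_group,
    bijective psi /\ forall a b, psi (pmul a b) = (psi a * psi b)%g.
Proof.
move=> S_sc S_neg neg_cont negK sgn_cont sgn_neg sgn_cover j_cont j_open j_neg j_fibre x.
move=> [[t u] [/= Tt Su] <-].
(* If the sign found is negative, the opposite representative of the same base point is taken. *)
have [t1 [u1 [i [Tt1 Su1 su1 ->]]]] : exists t1 u1 i, [/\ twice_punctured t1, S u1, 0 < sgn i u1 &
    j (t, u) = j (t1, u1)].
  have [i /lt_total/orP[h|h]] := sgn_cover _ Su; last by exists t, u, i.
  exists (- t), (neg u), i; split => //; [|exact: S_neg|by rewrite sgn_neg oppr_gt0].
  have [k kt] := region_cover Tt; apply: (@region_sub _ (opp_region k)).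
  by apply/in_opp_region.
have [k kt] := region_cover Tt1; have [th sth] := standard_exists kt.
have [a0 a0P] := @standard_monodromy R.
have [om _] := S_sc.1 _ _ Su1 (S_neg _ Su1).
exact: (cylinder_pi1_based S_sc Su1 S_neg neg_cont negK sgn_cont sgn_neg sgn_cover
  j_cont j_open j_neg j_fibre su1 sth a0P (pcls om)).
Qed.

End CylinderImage.

(** * Continuity of matrix entries, finite sums and complex coordinates *)

Lemma cvg_mx (T U : topologicalType) m n (F : T -> 'M[U]_(m, n)) (x : T) :
  (forall i j, continuous_at x (fun t => F t i j)) -> continuous_at x F.
Proof.
move=> cF A [P hP sPA]; rewrite /nbhs /=.
suff : \forall t \near x, forall i j, P i j (F t i j).
  by apply: filterS => t ht; exact: sPA.
apply: (@filter_forall T _ (fun i t => forall j, P i j (F t i j)) (nbhs x)) => i.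
apply: (@filter_forall T _ (fun j t => P i j (F t i j)) (nbhs x)) => j.
exact: cF (hP i j).
Qed.

Lemma coord_cont (U : topologicalType) m n i j : continuous (fun M : 'M[U]_(m, n) => M i j).
Proof.
move=> M A nA; exists (fun i' j' => if (i' == i) && (j' == j) then A else setT).
  by move=> i' j'; case: eqP => [->|_]; [case: eqP => [->|_]|] => //=; exact: filterT.
by move=> N /(_ i j); rewrite !eqxx.
Qed.

Section SumContinuity.
Context {K : numFieldType} {T : topologicalType}.

Lemma sum_cvg n (F : 'I_n -> T -> K) (x : T) : (forall i, continuous_at x (F i)) ->
  continuous_at x (fun t => \sum_(i < n) F i t).
Proof.
elim: n F => [|n IH] F cF.
  rewrite (_ : (fun t => _) = cst 0); first exact: cst_continuous.
  by apply/funext => t; rewrite big_ord0.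
rewrite (_ : (fun t => _) = (fun t => F ord0 t + \sum_(i < n) F (lift ord0 i) t)).
  by apply: cvgD; [exact: cF|apply: IH => i; exact: cF].
by apply/funext => t; rewrite big_ord_recl.
Qed.

End SumContinuity.

Section Complexes.
Variable R : realType.

Definition complexes : numClosedFieldType := R[i].
Local Notation C := complexes.
Definition re (z : C) : R := complex.Re z.
Definition im (z : C) : R := complex.Im z.
Definition cplx (x y : R) : C := (x +i* y)%C.

Lemma cplxK (z : C) : cplx (re z) (im z) = z. Proof. by case: z. Qed.
Lemma re_cplx x y : re (cplx x y) = x. Proof. by []. Qed.
Lemma im_cplx x y : im (cplx x y) = y. Proof. by []. Qed.

Lemma complexes_eq (z w : C) : re z = re w -> im z = im w -> z = w.
Proof. by move=> h1 h2; rewrite -(cplxK z) -(cplxK w) h1 h2. Qed.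

Lemma reD (z w : C) : re (z + w) = re z + re w. Proof. by case: z w => ? ? []. Qed.
Lemma imD (z w : C) : im (z + w) = im z + im w. Proof. by case: z w => ? ? []. Qed.
Lemma reN (z : C) : re (- z) = - re z. Proof. by case: z. Qed.
Lemma imN (z : C) : im (- z) = - im z. Proof. by case: z. Qed.
Lemma reM (z w : C) : re (z * w) = re z * re w - im z * im w.
Proof. by case: z w => ? ? []. Qed.
Lemma imM (z w : C) : im (z * w) = re z * im w + im z * re w.
Proof. by case: z w => ? ? []. Qed.

Lemma re_sum n (F : 'I_n -> C) : re (\sum_(i < n) F i) = \sum_(i < n) re (F i).
Proof. by elim/big_rec2: _ => // i x y _ <-; rewrite reD. Qed.
Lemma im_sum n (F : 'I_n -> C) : im (\sum_(i < n) F i) = \sum_(i < n) im (F i).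
Proof. by elim/big_rec2: _ => // i x y _ <-; rewrite imD. Qed.

(** Norms and radii of balls take values in the complex field itself, so real bounds are written as
    complex numbers with imaginary part 0. *)
Lemma cplx_norm_re (z : C) : cplx `|re z| 0 <= `|z|.
Proof. exact: normc_ge_Re. Qed.

Lemma cplx_norm_im (z : C) : cplx `|im z| 0 <= `|z|.
Proof.
(* Multiplication by [- i] turns the imaginary part into the real part and preserves the norm. *)
have := cplx_norm_re (- (cplx 0 1) * z).
rewrite normrM normrN (_ : `|cplx 0 1| = 1) ?mul1r; last first.
  by rewrite /cplx normc_def /= expr0n /= expr1n add0r sqrtr1.
by rewrite reM reN imN !re_cplx !im_cplx oppr0 mul0r sub0r mulN1r opprK.
Qed.

Lemma cplx_gt0 (x : R) : (0 < cplx x 0) = (0 < x).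
Proof. by rewrite ltcE /= eqxx. Qed.

Lemma cplx_lt (x y : R) : (cplx x 0 < cplx y 0) = (x < y).
Proof. by rewrite ltcE /= eqxx. Qed.

Lemma re_cont : continuous re.
Proof.
move=> z U /nbhs_ballP[e /= e0 he]; apply/nbhs_ballP; exists (cplx e 0); first by rewrite /= cplx_gt0.
move=> w; rewrite /ball /= => hw; apply: he; rewrite /ball /=.
by have := le_lt_trans (cplx_norm_re (z - w)) hw; rewrite cplx_lt reD reN.
Qed.

Lemma im_cont : continuous im.
Proof.
move=> z U /nbhs_ballP[e /= e0 he]; apply/nbhs_ballP; exists (cplx e 0); first by rewrite /= cplx_gt0.
move=> w; rewrite /ball /= => hw; apply: he; rewrite /ball /=.
by have := le_lt_trans (cplx_norm_im (z - w)) hw; rewrite cplx_lt imD imN.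
Qed.

Lemma cplx_norm_le (z : C) : `|z| <= cplx (`|re z| + `|im z|) 0.
Proof.
have -> : z = cplx (re z) 0 + cplx 0 (im z).
  by apply: complexes_eq; rewrite ?reD ?imD ?addr0 ?add0r.
rewrite reD imD !re_cplx !im_cplx addr0 add0r.
apply: le_trans (ler_normD _ _) _.
have -> : cplx (`|re z| + `|im z|) 0 = cplx `|re z| 0 + cplx `|im z| 0.
  by apply: complexes_eq; rewrite ?reD ?imD ?addr0.
apply: lerD.
  by rewrite {1}/cplx normc_def /= expr0n /= addr0 sqrtr_sqr.
by rewrite {1}/cplx normc_def /= expr0n /= add0r sqrtr_sqr.
Qed.

Lemma cplx_cont : continuous (fun t : R * R => cplx t.1 t.2).
Proof.
move=> t U /nbhs_ballP[e /= e0 he].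
have [re0 eE] : 0 < re e /\ e = cplx (re e) 0.
  move: e0; rewrite ltcE /= => /andP[/eqP ie ee]; split => //.
  by apply: complexes_eq.
apply/nbhs_ballP; exists (re e / 2); first by rewrite /= divr_gt0.
move=> s [/= h1 h2]; apply: he; rewrite /ball /=.
apply: le_lt_trans (cplx_norm_le _) _; rewrite [X in _ < X]eE cplx_lt reD imD reN imN !re_cplx !im_cplx.
by move: h1 h2; rewrite /ball /=; lra.
Qed.

Lemma cplx_cvg (T : topologicalType) (a b : T -> R) x :
  continuous_at x a -> continuous_at x b -> continuous_at x (fun t => cplx (a t) (b t)).
Proof.
move=> ca cb; have h : continuous_at x (fun t => (a t, b t)) by exact: (cvg_pair ca cb).
exact: (continuous_comp h (@cplx_cont _)).
Qed.

End Complexes.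

(** * The complex sphere *)

Section ComplexSphere.
Context {R : realType} {n : nat}.
Local Notation C := (complexes R).

Definition complex_sphere : set 'cV[C]_n := [set u | \sum_i u i 0 ^+ 2 = 1].

Lemma complex_sphereP (u : 'cV[C]_n) : complex_sphere u <->
  \sum_i (re (u i 0) ^+ 2 - im (u i 0) ^+ 2) = 1 /\ \sum_i (re (u i 0) * im (u i 0)) = 0.
Proof.
have e1 : re (\sum_i u i 0 ^+ 2) = \sum_i (re (u i 0) ^+ 2 - im (u i 0) ^+ 2).
  by rewrite re_sum; apply: eq_bigr => i _; rewrite expr2 reM -!expr2.
have e2 : im (\sum_i u i 0 ^+ 2) = 2 * \sum_i (re (u i 0) * im (u i 0)).
  rewrite im_sum mulr_sumr; apply: eq_bigr => i _; rewrite expr2 imM; ring.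
split=> [h|[h1 h2]].
  by split; [rewrite -e1 h|have := e2; rewrite h /im /=; lra].
by apply: complexes_eq; [rewrite e1 h1|rewrite e2 h2 mulr0].
Qed.

(** The sum of the squares of the coordinates after the imaginary parts have been scaled by [1 - s].
    It remains real because real and imaginary parts are orthogonal, and on the sphere it is at
    least 1 for [s] in the unit interval. *)
Let N (u : 'cV[C]_n) (s : R) := \sum_i (re (u i 0) ^+ 2 - (1 - s) ^+ 2 * im (u i 0) ^+ 2).
(* Shrinks the imaginary part to 0 while rescaling to stay on the sphere. *)
Let Hs (w : 'cV[C]_n * R) : 'cV[C]_n := \col_i
  cplx (re (w.1 i 0) / Num.sqrt (N w.1 w.2)) ((1 - w.2) * im (w.1 i 0) / Num.sqrt (N w.1 w.2)).
Let D : set ('cV[C]_n * R) := [set w | complex_sphere w.1 /\ 0 <= w.2 <= 1].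

Let N_ge1 u s : complex_sphere u -> 0 <= s <= 1 -> 1 <= N u s.
Proof.
move=> /complex_sphereP[e _] /andP[s0 s1]; rewrite -[X in X <= _]e; apply: ler_sum => i _.
rewrite lerD2l lerN2 ler_piMl ?sqr_ge0 // exprn_ile1 //; lra.
Qed.

Let Hs_sphere w : D w -> complex_sphere (Hs w).
Proof.
case: w => u s [/= Su hs]; have N1 := N_ge1 Su hs.
have /complex_sphereP[h1 h2] := Su.
have m2 : Num.sqrt (N u s) ^+ 2 = N u s by rewrite sqr_sqrtr //; lra.
have m0 : Num.sqrt (N u s) != 0 by rewrite sqrtr_eq0 -ltNge; lra.
apply/complex_sphereP; split.
  transitivity (N u s / Num.sqrt (N u s) ^+ 2); last by rewrite m2 divff //; lra.
  rewrite {1}/N mulr_suml; apply: eq_bigr => i _; rewrite mxE re_cplx im_cplx /=.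
  by field.
transitivity ((1 - s) / Num.sqrt (N u s) ^+ 2 * \sum_i (re (u i 0) * im (u i 0))).
  rewrite mulr_sumr; apply: eq_bigr => i _; rewrite mxE re_cplx im_cplx /=.
  by field.
by rewrite h2 mulr0.
Qed.

Let Hs_cont : {in D, continuous Hs}.
Proof.
move=> [u s] /set_mem[/= Su hs]; have N1 := N_ge1 Su hs.
have m0 : Num.sqrt (N u s) != 0 by rewrite sqrtr_eq0 -ltNge; lra.
have cx i : continuous_at (u, s) (fun w : 'cV[C]_n * R => re (w.1 i 0)).
  have h1 : continuous (fun w : 'cV[C]_n * R => w.1) by rcont.
  have h2 := @coord_cont C n 1 i 0; have h3 := @re_cont R.
  by have : continuous (fun w : 'cV[C]_n * R => re (w.1 i 0)) by
    apply: (cont_comp h3); apply: (cont_comp h2 h1).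
have cy i : continuous_at (u, s) (fun w : 'cV[C]_n * R => im (w.1 i 0)).
  have h1 : continuous (fun w : 'cV[C]_n * R => w.1) by rcont.
  have h2 := @coord_cont C n 1 i 0; have h3 := @im_cont R.
  by have : continuous (fun w : 'cV[C]_n * R => im (w.1 i 0)) by
    apply: (cont_comp h3); apply: (cont_comp h2 h1).
have cs : continuous_at (u, s) (fun w : 'cV[C]_n * R => 1 - w.2).
  by have : continuous (fun w : 'cV[C]_n * R => 1 - w.2) by rcont.
have cN : continuous_at (u, s) (fun w : 'cV[C]_n * R => N w.1 w.2).
  apply: sum_cvg => i; apply: cvgB; first by apply: cvgM; exact: cx.
  by apply: cvgM; apply: cvgM; first [exact: cs|exact: cy].
have cm : continuous_at (u, s) (fun w : 'cV[C]_n * R => (Num.sqrt (N w.1 w.2))^-1).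
  apply: cvgV => //.
  exact: (continuous_comp cN (@sqrt_continuous R _)).
apply: cvg_mx => i k; rewrite (_ : (fun w => _) = fun w : 'cV[C]_n * R => cplx (re (w.1 i 0) / Num.sqrt (N w.1 w.2))
  ((1 - w.2) * im (w.1 i 0) / Num.sqrt (N w.1 w.2))); last by apply/funext => w; rewrite mxE.
apply: cplx_cvg; first by apply: cvgM; [exact: cx|exact: cm].
by apply: cvgM; [apply: cvgM; [exact: cs|exact: cy]|exact: cm].
Qed.

Let re_mx (u : 'cV[C]_n) : 'cV[R]_n := \col_i re (u i 0).
Let of_real (x : 'cV[R]_n) : 'cV[C]_n :=
  \col_i cplx (x i 0 / Num.sqrt (\sum_k x k 0 ^+ 2)) 0.

(** The real part of a point of the sphere is nonzero, as its square norm exceeds that of the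
    imaginary part by 1. At time 1 the deformation [Hs] yields the normalised real part, so the
    punctured real space dominates the sphere. *)
Lemma complex_sphere_simply_connected : (2 < n)%N -> @simply_connected R 'cV[C]_n complex_sphere.
Proof.
move=> n2.
pose i0 : 'I_n := Ordinal (ltn_trans (isT : 0 < 2)%N n2).
pose i1 : 'I_n := Ordinal (ltn_trans (isT : 1 < 2)%N n2).
pose i2 : 'I_n := Ordinal n2.
have sq_gt0 (x : 'cV[R]_n) : x != 0 -> 0 < \sum_k x k 0 ^+ 2.
  move=> x0; rewrite lt_neqAle sumr_ge0 ?andbT; last by move=> i _; exact: sqr_ge0.
  apply: contra x0 => /eqP/esym/eqP; rewrite psumr_eq0; last by move=> i _; exact: sqr_ge0.
  move=> /allP h; apply/eqP/matrixP => i j; rewrite ord1 [RHS]mxE.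
  by have := h i (mem_index_enum _); rewrite sqrf_eq0 => /eqP.
apply: (@dominated_simply_connected R _ _ complex_sphere (@punctured R n) re_mx of_real Hs).
- move=> u _; apply: cvg_mx => i k.
  rewrite (_ : (fun u => _) = fun u : 'cV[C]_n => re (u i 0)); last by apply/funext => v; rewrite mxE.
  by have h2 := @coord_cont C n 1 i 0; have h3 := @re_cont R; apply: (cont_comp h3 h2).
- move=> u /complex_sphereP[h1 _]; apply/eqP => x0.
  have : \sum_i (re (u i 0) ^+ 2 - im (u i 0) ^+ 2) <= 0.
    apply: sumr_le0 => i _.
    have -> : re (u i 0) = 0 by have := congr1 (fun x : 'cV[R]_n => x i 0) x0; rewrite /re_mx !mxE.
    by rewrite expr0n sub0r oppr_le0 sqr_ge0.
  by rewrite h1; lra.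
- move=> x /set_mem x0; have q0 := sq_gt0 _ x0.
  have m0 : Num.sqrt (\sum_k x k 0 ^+ 2) != 0 by rewrite sqrtr_eq0 -ltNge.
  have cc i : continuous_at x (fun y : 'cV[R]_n => y i 0) by exact: coord_cont.
  have cm : continuous_at x (fun y : 'cV[R]_n => (Num.sqrt (\sum_k y k 0 ^+ 2))^-1).
    have cN : continuous_at x (fun y : 'cV[R]_n => \sum_k y k 0 ^+ 2).
      by apply: sum_cvg => i; exact: (cvgM (cc i) (cc i)).
    have cS := continuous_comp cN (@sqrt_continuous R (\sum_k x k 0 ^+ 2)).
    exact: (cvgV m0 cS).
  apply: cvg_mx => i k; rewrite (_ : (fun y => _) =
    fun y : 'cV[R]_n => cplx (y i 0 / Num.sqrt (\sum_k y k 0 ^+ 2)) 0); last by apply/funext => y; rewrite mxE.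
  by apply: cplx_cvg; [exact: (cvgM (cc i) cm)|exact: cst_continuous].
- move=> x x0; have q0 := sq_gt0 _ x0.
  have m0 : Num.sqrt (\sum_k x k 0 ^+ 2) != 0 by rewrite sqrtr_eq0 -ltNge.
  apply/complex_sphereP; split; last by apply: big1 => i _; rewrite mxE im_cplx mulr0.
  transitivity ((\sum_k x k 0 ^+ 2) / Num.sqrt (\sum_k x k 0 ^+ 2) ^+ 2).
    rewrite mulr_suml; apply: eq_bigr => i _; rewrite mxE re_cplx im_cplx expr0n subr0.
    by rewrite expr_div_n.
  by rewrite sqr_sqrtr ?divff ?ltW // gt_eqF.
- exact: Hs_cont.
- exact: Hs_sphere.
- move=> u Su; apply/matrixP => i k; rewrite ord1 mxE /=.
  have -> : N u 0 = 1.
    have /complex_sphereP[<- _] := Su; apply: eq_bigr => l _.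
    by rewrite subr0 expr1n mul1r.
  by rewrite sqrtr1 subr0 !divr1 mul1r cplxK.
- move=> u Su; apply/matrixP => i k; rewrite ord1 !mxE /= subrr !mul0r.
  have -> // : N u 1 = \sum_k re_mx u k 0 ^+ 2.
  by apply: eq_bigr => l _; rewrite mxE subrr expr0n mul0r subr0.
- exact: (@punctured_simply_connected R n i0 i1 i2).
Qed.

End ComplexSphere.

Lemma nbhs_neq0 (K : numFieldType) (x : K) : x != 0 -> nbhs x [set c : K | c != 0].
Proof.
move=> x0; apply/nbhs_ballP; exists `|x|; first by rewrite /= normr_gt0.
move=> y; rewrite /ball /= => h; apply: contraTneq h => ->.
by rewrite subr0 ltxx.
Qed.

(** * Hyperplanes in projective space *)

Section ProjectivizationTopology.
Context {C : numClosedFieldType} {p q : nat}.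
Local Notation M := 'M[C]_(p, q).
Local Notation P := (projectivization C p q).
Local Notation proj := (\pi_({eq_quot @proportional C p q}) : nonzero_mx C p q -> P).

Let projE (x : nonzero_mx C p q) : proj x = proj_class (nonzero_mxP x).
Proof. by rewrite /proj_class; congr (\pi_({eq_quot _}) _); exact/val_inj. Qed.

Let proj_cont : continuous proj.
Proof. exact: (@pi_continuous _ {eq_quot @proportional C p q}). Qed.

Lemma proj_class_inj (v w : M) (v0 : v != 0) (w0 : w != 0) : proj_class v0 = proj_class w0 ->
  exists2 c : C, c != 0 & w = c *: v.
Proof.
move=> e; have [d d0 hd] := proj_class_hcoord v0; have [d' d0' hd'] := proj_class_hcoord w0.
exists (d'^-1 * d); first by rewrite mulf_neq0 // invr_eq0.
by rewrite -scalerA -hd e hd' scalerA mulVf // scale1r.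
Qed.

Lemma hcoord_neq0 (x : P) : hcoord x != 0. Proof. exact: nonzero_mxP. Qed.

Lemma near_neq0 (v : M) : v != 0 -> \forall w \near v, w != 0.
Proof.
move=> v0; have [i [j vij]] : exists i j, v i j != 0.
  apply: contrapT => h; have /eqP := v0; apply; apply/matrixP => i j; rewrite [RHS]mxE.
  by apply: contrapT => /eqP vij; apply: h; exists i, j.
have : nbhs v ((fun w : M => w i j) @^-1` [set c | c != 0]).
  exact: (@coord_cont C _ _ i j v _ (nbhs_neq0 vij)).
by apply: filterS => w /= wij; apply: contra wij => /eqP ->; rewrite mxE.
Qed.

Lemma near_proj_class (v : M) (v0 : v != 0) (W : set P) : nbhs (proj_class v0) W ->
  \forall w \near v, forall w0 : w != 0, W (proj_class w0).
Proof.
pose x : nonzero_mx C p q := SigSub (mem_set (v0 : [set v | v != 0] v)).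
have -> : proj_class v0 = proj x by [].
move=> nW0; have : nbhs x (proj @^-1` W) := proj_cont nW0.
rewrite nbhsE => -[V [[O oO OV] Vx] VW].
have nO : nbhs v O by apply: open_nbhs_nbhs; split => //; move: Vx; rewrite -OV.
apply: filterS nO => w Ow w0.
have := VW (SigSub (mem_set (w0 : [set v | v != 0] w))); rewrite -OV; exact.
Qed.

Lemma open_projP (D : set P) :
  (forall (a : M) (a0 : a != 0), D (proj_class a0) ->
     \forall b \near a, forall b0 : b != 0, D (proj_class b0)) ->
  open D.
Proof.
move=> hD.
have e : proj @^-1` D = [set x | D (proj_class (nonzero_mxP x))].
  by apply/funext => x /=; rewrite projE.
suff : open [set x : nonzero_mx C p q | D (proj_class (nonzero_mxP x))] by rewrite -e.
rewrite openE => x /= /hD h.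
have : nbhs x (@mx_of_nonzero C p q @^-1` [set b | forall b0 : b != 0, D (proj_class b0)]).
  exact: (@initial_continuous _ _ (set_val : nonzero_mx C p q -> M)).
by apply: filterS => y /= Dy; exact: Dy.
Qed.

End ProjectivizationTopology.

Section DualProjectiveSpace.
Context {C : numClosedFieldType} {n : nat}.
Local Notation M := 'M[C]_(1 + n, 1).
Implicit Types (a b v w : M) (L : dualCP C n).

(* The hyperplane with coordinate column [v]; junk value for [v = 0]. *)
Definition hyperplane v : dualCP C n :=
  if pselect (v != 0) is left v0 then proj_class v0 else Hinf C n.

Lemma hyperplaneE v (v0 : v != 0) : hyperplane v = proj_class v0.
Proof. by rewrite /hyperplane; case: pselect => // h; rewrite (Prop_irrelevance h v0). Qed.

Lemma hcoord_hyperplane v : v != 0 -> exists2 c : C, c != 0 & hcoord (hyperplane v) = c *: v.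
Proof. by move=> v0; rewrite (hyperplaneE v0); exact: proj_class_hcoord. Qed.

Lemma hyperplane_hcoord L : hyperplane (hcoord L) = L.
Proof.
have [c c0 e] := hcoord_hyperplane (hcoord_neq0 L).
by apply: (@hcoord_eq C _ _ _ _ c^-1); rewrite e scalerA mulVf // scale1r.
Qed.

Lemma hyperplane_eq v w (c : C) : v != 0 -> w != 0 -> w = c *: v -> hyperplane v = hyperplane w.
Proof.
move=> v0 w0 e; have [d d0 hd] := hcoord_hyperplane v0; have [d' d0' hd'] := hcoord_hyperplane w0.
apply: (@hcoord_eq C _ _ _ _ (d' * c / d)).
by rewrite hd hd' e !scalerA divfK.
Qed.

Lemma hyperplaneZ (c : C) v : c != 0 -> hyperplane (c *: v) = hyperplane v.
Proof.
move=> c0; have [->|v0] := eqVneq v 0; first by rewrite scaler0.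
by apply/esym; apply: (@hyperplane_eq _ _ c) => //; rewrite scaler_eq0 negb_or c0.
Qed.

Lemma hyperplane_inj v w : v != 0 -> w != 0 -> hyperplane v = hyperplane w ->
  exists2 c : C, c != 0 & w = c *: v.
Proof. by move=> v0 w0; rewrite (hyperplaneE v0) (hyperplaneE w0); exact: proj_class_inj. Qed.

Lemma hyperplane_cont v : v != 0 -> continuous_at v hyperplane.
Proof.
move=> v0 W; rewrite (hyperplaneE v0) => /near_proj_class nW.
by apply: filterS2 nW (near_neq0 v0) => w hw w0; rewrite /= (hyperplaneE w0).
Qed.

Lemma open_hyperplanes (D : set (dualCP C n)) :
  (forall a, a != 0 -> D (hyperplane a) -> \forall b \near a, b != 0 -> D (hyperplane b)) ->
  open D.
Proof.
move=> hD; apply: open_projP => a a0; rewrite -hyperplaneE => /(hD a a0).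
by apply: filterS => b hb b0; rewrite -hyperplaneE; exact: hb.
Qed.

End DualProjectiveSpace.

(** If [r ^+ 2] is within [e ^+ 2] of [c ^+ 2], the product of the distances from [c] to [r] and to
    [- r] is less than [e ^+ 2], so one of the two roots is within [e] of [c]. This includes
    [c = 0]. *)
Lemma square_open (C : numClosedFieldType) (c : C) (N : set C) : nbhs c N ->
  nbhs (c ^+ 2) [set z | exists2 r, N r & r ^+ 2 = z].
Proof.
move=> /nbhs_ballP[e /= e0 he]; apply/nbhs_ballP; exists (e ^+ 2); first by rewrite /= exprn_gt0.
move=> z; rewrite /ball /= => hz; pose r := sqrtC z.
have r2 : r ^+ 2 = z by rewrite /r sqrtCK.
have : `|c - r| * `|c + r| < e * e.
  by rewrite -normrM -expr2 (_ : _ * _ = c ^+ 2 - z) // -r2; ring.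
have [h _|h] := boolP (`|c - r| < e).
  by exists r => //; apply: he; rewrite /ball /=.
move=> hm; exists (- r); last by rewrite sqrrN.
apply: he; rewrite /ball /= opprK; apply: contraTT hm => hn.
have h1 : e <= `|c - r| by rewrite real_leNgt ?normr_real ?gtr0_real.
have h2 : e <= `|c + r| by rewrite real_leNgt ?normr_real ?gtr0_real.
by rewrite le_gtF // ler_pM // ltW.
Qed.

Lemma mulmx_cont (K : numFieldType) m n (A : 'M[K]_(m, n)) :
  continuous (fun u : 'cV[K]_n => A *m u).
Proof.
move=> u; apply: cvg_mx => i k.
rewrite (_ : (fun v => _) = fun v : 'cV[K]_n => \sum_l A i l * v l k); last first.
  by apply/funext => v; rewrite mxE.
apply: sum_cvg => l; have cu : continuous_at u (fun v : 'cV[K]_n => v l k) by exact: coord_cont.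
exact: (cvgM (@cst_continuous _ _ (A i l) u) cu).
Qed.

Section Frame.
Context {R : realType} {n : nat}.
Local Notation C := (complexes R).
Variables (d : C) (w : 'rV[C]_n) (W : 'M[C]_n).
Hypotheses (d0 : d != 0) (Wu : W \in unitmx).

(** The coordinate column of the hyperplane of the points [x] with
    [(x - w) *m (W *m u) + d * z = 0]. In the application [w] is the centre of the quadric, and [d]
    and [W] normalise its equation. *)
Definition frame (z : C) (u : 'cV[C]_n) : 'cV[C]_(1 + n) :=
  col_mx ((d * z - (w *m (W *m u)) 0 0)%:M) (W *m u).

Definition frame_dir (b : 'cV[C]_(1 + n)) : 'cV[C]_n := invmx W *m dsubmx b.

Definition frame_offset (b : 'cV[C]_(1 + n)) : C :=
  ((usubmx b) 0 0 + (w *m dsubmx b) 0 0) / d.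

Lemma frame_dirK z u : frame_dir (frame z u) = u.
Proof. by rewrite /frame_dir col_mxKd mulKmx. Qed.

Lemma frame_offsetK z u : frame_offset (frame z u) = z.
Proof. by rewrite /frame_offset col_mxKu col_mxKd mxE eqxx mulr1n subrK mulrC mulKf. Qed.

Lemma frameK b : frame (frame_offset b) (frame_dir b) = b.
Proof.
rewrite /frame /frame_dir mulKVmx // /frame_offset mulrCA mulfV // mulr1 addrK.
by rewrite -mx11_scalar vsubmxK.
Qed.

Lemma frameZ c z u : frame (c * z) (c *: u) = c *: frame z u.
Proof.
rewrite /frame scale_col_mx -!scalemxAr; congr col_mx.
by rewrite scale_scalar_mx mxE mulrBr mulrCA.
Qed.

Lemma frame_neq0 z u : u != 0 -> frame z u != 0.
Proof.
by apply: contra_neq => h; rewrite -(frame_dirK z u) h /frame_dir linear0 mulmx0.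
Qed.

Lemma frame_cvg (T : topologicalType) (z : T -> C) (u : T -> 'cV[C]_n) x :
  continuous_at x z -> continuous_at x u -> continuous_at x (fun t => frame (z t) (u t)).
Proof.
move=> cz cu; have cWu : continuous_at x (fun t => W *m u t).
  exact: (continuous_comp cu (@mulmx_cont _ _ _ W _)).
have cwWu : continuous_at x (fun t => w *m (W *m u t)).
  exact: (continuous_comp cWu (@mulmx_cont _ _ _ w _)).
apply: cvg_mx => i k; case: (splitP i) => l il.
  rewrite (_ : (fun t => _) = fun t => d * z t - (w *m (W *m u t)) 0 0).
    have c1 : continuous_at x (fun t => d * z t) by exact: (cvgM (@cst_continuous _ _ d x) cz).
    have c2 : continuous_at x (fun t => (w *m (W *m u t)) 0 0) := continuous_comp cwWu (@coord_cont C _ _ 0 0 _).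
    exact: (cvgB c1 c2).
  apply/funext => t; rewrite (_ : i = lshift n 0) ?col_mxEu ?mxE ?ord1 ?mulr1n //.
  by apply: val_inj; rewrite /= il ord1.
rewrite (_ : (fun t => _) = fun t => (W *m u t) l k).
  exact: (continuous_comp cWu (@coord_cont C _ _ l k _)).
apply/funext => t; rewrite (_ : i = rshift 1 l) ?col_mxEd //.
by apply: val_inj; rewrite /= il.
Qed.

Let dsub_cont : continuous (fun b : 'cV[C]_(1 + n) => dsubmx b).
Proof.
move=> b; apply: cvg_mx => i k.
rewrite (_ : (fun b => _) = fun b : 'cV[C]_(1 + n) => b (rshift 1 i) k).
  exact: coord_cont.
by apply/funext => v; rewrite mxE.
Qed.

Lemma frame_dir_cont : continuous frame_dir.
Proof. by move=> b; exact: (continuous_comp (@dsub_cont b) (@mulmx_cont _ _ _ (invmx W) _)). Qed.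

Lemma frame_offset_cont : continuous frame_offset.
Proof.
move=> b; have c1 : continuous_at b (fun b : 'cV[C]_(1 + n) => usubmx b 0 0).
  rewrite (_ : (fun b => _) = fun b : 'cV[C]_(1 + n) => b (lshift n 0) 0).
    exact: coord_cont.
  by apply/funext => v; rewrite mxE.
have c2 : continuous_at b (fun b => w *m dsubmx b).
  exact: (continuous_comp (@dsub_cont b) (@mulmx_cont _ _ _ w _)).
have c3 := continuous_comp c2 (@coord_cont C _ _ 0 0 _).
exact: (cvgM (cvgD c1 c3) (@cst_continuous _ _ d^-1 b)).
Qed.

Local Notation S := (@complex_sphere R n).
Local Notation X := (@twice_punctured R `*` S).

Definition pencil (x : (R * R) * 'cV[C]_n) : dualCP C n :=
  hyperplane (frame (cplx x.1.1 x.1.2) x.2).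

Let sphere_neq0 u : S u -> u != 0.
Proof.
apply: contraPneq => -> /=; rewrite /complex_sphere /= big1 => [/eqP|i _].
  by rewrite eq_sym oner_eq0.
by rewrite mxE expr0n.
Qed.

Lemma pencil_cont : {in X, continuous pencil}.
Proof.
move=> [t u] /set_mem[/= _ Su].
have c0 : continuous_at (t, u) (fun x : (R * R) * 'cV[C]_n => frame (cplx x.1.1 x.1.2) x.2).
  apply: frame_cvg; last exact: cont_snd.
  apply: cplx_cvg.
    by have : continuous (fun x : (R * R) * 'cV[C]_n => x.1.1) by rcont.
  by have : continuous (fun x : (R * R) * 'cV[C]_n => x.1.2) by rcont.
by apply: (continuous_comp c0); apply: hyperplane_cont; exact: frame_neq0 (sphere_neq0 Su).
Qed.

Lemma pencil_neg t u : pencil (- t, - u) = pencil (t, u).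
Proof.
have e1 : cplx (- t).1 (- t).2 = - 1 * cplx t.1 t.2.
  by rewrite mulN1r; apply: complexes_eq; rewrite ?reN ?imN.
rewrite /pencil; move: e1; set z := cplx _ _; set z' := cplx _ _ => ->.
by rewrite -[(- t, - u).2]scaleN1r frameZ hyperplaneZ // oppr_eq0 oner_eq0.
Qed.

Lemma pencil_fibre t u t' u' : X (t, u) -> X (t', u') -> pencil (t, u) = pencil (t', u') ->
  (t' = t /\ u' = u) \/ (t' = - t /\ u' = - u).
Proof.
move=> [/= _ Su] [/= _ Su'].
case/(hyperplane_inj (frame_neq0 _ (sphere_neq0 Su)) (frame_neq0 _ (sphere_neq0 Su'))) => c c0.
rewrite -frameZ => e.
have eu : u' = c *: u by rewrite -(frame_dirK (cplx t'.1 t'.2) u') e frame_dirK.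
have et : cplx t'.1 t'.2 = c * cplx t.1 t.2.
  by rewrite -(frame_offsetK (cplx t'.1 t'.2) u') e frame_offsetK.
have c2 : c ^+ 2 = 1.
  move: Su'; rewrite eu /complex_sphere /= => <-; rewrite -[LHS]mulr1 -Su mulr_sumr.
  by apply: eq_bigr => i _; rewrite mxE exprMn.
have := c2 => /eqP; rewrite sqrf_eq1 => /orP[]/eqP cE; rewrite cE in et eu.
  left; rewrite eu scale1r; split => //; move: et; rewrite mul1r.
  by case: t t' {Su Su' e} => x y [x' y'] /= [-> ->].
right; rewrite eu scaleN1r; split => //; move: et; rewrite mulN1r.
by case: t t' {Su Su' e} => x y [x' y'] /= [-> ->].
Qed.

(** A hyperplane near the given one is normalised by dividing its frame coordinates by a square root
    of the sum of squares of its direction. [square_open] supplies a root close to the old one, so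
    that the result stays in the given neighbourhood. *)
Lemma pencil_open x O : X x -> nbhs x O -> nbhs (pencil x) (pencil @` (O `&` X)).
Proof.
move=> Xx; rewrite nbhsE => -[V [oV Vx] VO].
suff oD : open (pencil @` (V `&` X)).
  have : nbhs (pencil x) (pencil @` (V `&` X)).
    by apply: open_nbhs_nbhs; split => //; exists x.
  by apply: filterS => _ [y [/VO Oy Xy] <-]; exists y.
apply: open_hyperplanes => a a0 [[t u] [Vtu [/= Tt Su]]].
case/(hyperplane_inj (frame_neq0 _ (sphere_neq0 Su)) a0) => c c0 aE.
have adir : frame_dir a = c *: u by rewrite aE -frameZ frame_dirK.
have aoff : frame_offset a = c * cplx t.1 t.2 by rewrite aE -frameZ frame_offsetK.
(* Division by the scalar [y.2] of the frame coordinates of the column [y.1]; continuity at [(a, c)]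
   is joint in the column and the scalar. *)
pose F (y : 'cV[C]_(1 + n) * C) : (R * R) * 'cV[C]_n :=
  ((re (frame_offset y.1 / y.2), im (frame_offset y.1 / y.2)), y.2^-1 *: frame_dir y.1).
have Fac : F (a, c) = (t, u).
  rewrite /F /= adir aoff scalerA mulVf // scale1r mulrAC divff // mul1r re_cplx im_cplx.
  by case: t {Vtu Tt aE aoff}.
have cF : continuous_at (a, c) F.
  have c1 : continuous_at (a, c) (fun y : 'cV[C]_(1 + n) * C => y.2^-1).
    have c2 : continuous_at (a, c) (fun y : 'cV[C]_(1 + n) * C => y.2) by exact: cont_snd.
    exact: (cvgV c0 c2).
  have c3 : continuous_at (a, c) (fun y : 'cV[C]_(1 + n) * C => frame_offset y.1 / y.2).
    have c4 := continuous_comp (@cont_fst _ _ (a, c)) (@frame_offset_cont a).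
    exact: (cvgM c4 c1).
  have c5 := continuous_comp (@cont_fst _ _ (a, c)) (@frame_dir_cont a).
  have c6 := continuous_comp c3 (@re_cont R _); have c7 := continuous_comp c3 (@im_cont R _).
  exact: (cvg_pair (cvg_pair c6 c7) (cvgZ c1 c5)).
have nT : nbhs (t, u) (V `&` [set y : (R * R) * 'cV[C]_n | twice_punctured y.1]).
  apply: filterI; first exact: open_nbhs_nbhs.
  have [k kt] := region_cover Tt.
  have := @cont_fst (R * R)%type 'cV[C]_n (t, u) _ (region_open kt).
  by apply: filterS => y; exact: region_sub.
have : nbhs (a, c) (F @^-1` (V `&` [set y : (R * R) * 'cV[C]_n | twice_punctured y.1])).
  by apply: cF; rewrite Fac.
move=> [[N1 N2] /= [nN1 nN2] hN].
have nN2' : nbhs c (N2 `&` [set r | r != 0]) by apply: filterI => //; exact: nbhs_neq0.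
have cq : continuous_at a (fun b => \sum_i (frame_dir b) i 0 ^+ 2).
  apply: sum_cvg => i.
  have h := continuous_comp (@frame_dir_cont a) (@coord_cont C _ _ i 0 _).
  exact: (cvgM h h).
have qa : \sum_i (frame_dir a) i 0 ^+ 2 = c ^+ 2.
  rewrite adir -[RHS]mulr1 -Su mulr_sumr; apply: eq_bigr => i _.
  by rewrite mxE exprMn.
have nZ := square_open nN2'; rewrite -qa in nZ.
apply: filterS2 nN1 (cq _ nZ) => b N1b [r [N2r r0] rE] b0.
have [VF TF] := hN (b, r) (conj N1b N2r).
exists (F (b, r)); first split => //.
  split => //=; rewrite /complex_sphere /=.
  transitivity (r^-1 ^+ 2 * r ^+ 2); last by rewrite -exprMn mulVf // expr1n.
  by rewrite rE mulr_sumr; apply: eq_bigr => i _; rewrite mxE exprMn.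
rewrite /pencil /F /= cplxK -[RHS](@hyperplaneZ _ _ r^-1) ?invr_eq0 //.
by rewrite mulrC frameZ frameK.
Qed.

End Frame.

(** * Quadrics *)

Section QuadraticPolynomials.
Context {C : numClosedFieldType} {n : nat}.
Implicit Types (f : mpoly n C).

(** With the family [Z] as a parameter, the homogeneous equation (all variables) and the affine one
    (the variable of index 0 replaced by 1) share one matrix and one computation of derivatives. *)
Definition qform k (Z : 'I_(1 + n) -> mpoly k C) (Q : 'M[C]_(1 + n)) : mpoly k C :=
  \sum_i \sum_j Q i j *: (Z i * Z j).

Let qformD k (Z : 'I_(1 + n) -> mpoly k C) (P Q : 'M[C]_(1 + n)) :
  qform Z (P + Q) = qform Z P + qform Z Q.
Proof.
rewrite /qform -big_split; apply: eq_bigr => i _.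
by rewrite -big_split; apply: eq_bigr => j _; rewrite mxE scalerDl.
Qed.

Let qformZ k (Z : 'I_(1 + n) -> mpoly k C) c (Q : 'M[C]_(1 + n)) :
  qform Z (c *: Q) = c *: qform Z Q.
Proof.
rewrite /qform scaler_sumr; apply: eq_bigr => i _.
by rewrite scaler_sumr; apply: eq_bigr => j _; rewrite mxE scalerA.
Qed.

Let qform_delta k (Z : 'I_(1 + n) -> mpoly k C) a b : qform Z (delta_mx a b) = Z a * Z b.
Proof.
rewrite /qform (bigD1 a) //= (bigD1 b) //= mxE !eqxx scale1r !big1 ?addr0 // => i ia.
  by apply: big1 => j _; rewrite mxE (negbTE ia) scale0r.
by rewrite mxE (negbTE ia) andbF scale0r.
Qed.

Definition hom_var (i : 'I_(1 + n)) : mpoly (1 + n) C := mpolyX C (mnm1 i).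
Definition aff_var (i : 'I_(1 + n)) : mpoly n C :=
  match fintype.split i with inl _ => 1 | inr k => mpolyX C (mnm1 k) end.

Let aff_var0 : aff_var (lshift n 0) = 1.
Proof. by rewrite /aff_var; case: splitP => // k /= h; have := ltn_ord k; lia. Qed.

Let aff_varS k : aff_var (rshift 1 k) = mpolyX C (mnm1 k).
Proof.
rewrite /aff_var; case: splitP => [l /= h|l /= h]; first by have := ltn_ord l; lia.
by congr (mpolyX C (mnm1 _)); apply: val_inj => /=; lia.
Qed.

Let hom_mono (m : multinom n) := hom_var (lshift n 0) ^+ (2 - mdeg m) *
  mmap1 (fun i => hom_var (rshift 1 i)) m.

Let mdeg_split (m : multinom n) k : mdeg m = k.+1 ->
  exists i m', m = mnm_add (mnm1 i) m' /\ mdeg m' = k.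
Proof.
move=> hm; have [i mi] : exists i, (0 < m i)%N.
  apply: contrapT => h; move: hm; rewrite mdegE big1 // => i _.
  by apply/eqP; rewrite -leqn0 leqNgt; apply/negP => mi; apply: h; exists i.
pose m' := mnm_sub m (mnm1 i).
have e : m = mnm_add (mnm1 i) m'.
  apply/mnmP => j; rewrite mnmDE mnmBE mnm1E subnKC //.
  by case: eqP => // <-.
by exists i, m'; split => //; have := congr1 (@mdeg n) e; rewrite mdegD mdeg1 hm; lia.
Qed.

Let monomial_pair (m : multinom n) : (mdeg m <= 2)%N -> exists a b,
  hom_mono m = hom_var a * hom_var b /\ mpolyX C m = aff_var a * aff_var b.
Proof.
move=> hm; pose h := fun i => hom_var (rshift 1 i).
have hD m1 m2 : mmap1 h (mnm_add m1 m2) = mmap1 h m1 * mmap1 h m2.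
  by rewrite /mmap1 -big_split; apply: eq_bigr => i _; rewrite mnmDE exprD.
case e : (mdeg m) hm => [|[|[|//]]] _; rewrite /hom_mono e.
- have -> : m = mnm0 by apply/eqP; rewrite -mdeg_eq0 e.
  exists (lshift n 0), (lshift n 0).
  by rewrite mmap11 mulr1 expr2 aff_var0 mpolyX0 mulr1.
- have [i [m' [-> h0]]] := mdeg_split e.
  have -> : m' = mnm0 by apply/eqP; rewrite -mdeg_eq0 h0.
  exists (lshift n 0), (rshift 1 i).
  by rewrite hD mmap11 mmap1U mulr1 expr1 aff_var0 mul1r mpolyXD mpolyX0 mulr1 aff_varS.
- have [i [m' [-> h1]]] := mdeg_split e; have [j [m'' [-> h0]]] := mdeg_split h1.
  have -> : m'' = mnm0 by apply/eqP; rewrite -mdeg_eq0 h0.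
  exists (rshift 1 i), (rshift 1 j).
  by rewrite !hD mmap11 !mmap1U mulr1 expr0 mul1r !mpolyXD mpolyX0 mulr1 !aff_varS.
Qed.

Lemma quadratic_matrix f : msize f = 3%N -> exists Q : 'M[C]_(1 + n),
  [/\ Q^T = Q, homogenization f = qform hom_var Q & f = qform aff_var Q].
Proof.
move=> f3; rewrite {2}[f]mpolyE /homogenization f3 /=.
(* The induction runs over a sublist of the support; the inclusion is kept for the degree bound on
   each monomial. *)
have : {subset msupp f <= msupp f} by [].
elim: {1 3 4}(msupp f) => [_|m s IH hs].
  exists 0; rewrite trmx0 !big_nil; split => //; apply/esym/big1 => i _; apply: big1 => j _;
    by rewrite mxE scale0r.
have [|Q [Qs e1 e2]] := IH; first by move=> x xs; apply: hs; rewrite inE xs orbT.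
have [|a [b [h1 h2]]] := @monomial_pair m.
  by have := msize_mdeg_lt (hs m (mem_head _ _)); rewrite f3.
(* Half of the coefficient at each of the two transposed places makes the matrix symmetric. *)
exists ((mcoeff m f / 2) *: (delta_mx a b + delta_mx b a) + Q).
have half k (P : mpoly k C) c : (c / 2) *: (P + P) = c *: P.
  by rewrite scalerDr -scalerDl (_ : c / 2 + c / 2 = c) //; field.
rewrite linearD /= linearZ /= linearD /= !trmx_delta Qs [delta_mx b a + _]addrC.
rewrite !big_cons e1 e2 !qformD !qformZ !qformD !qform_delta.
by rewrite [hom_var b * _]mulrC [aff_var b * _]mulrC -h1 -h2 !half.
Qed.

Let meval_qform k (Z : 'I_(1 + n) -> mpoly k C) v (Q : 'M[C]_(1 + n)) (x : 'rV[C]_(1 + n)) :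
  (forall i, meval v (Z i) = x 0 i) -> meval v (qform Z Q) = (x *m Q *m x^T) 0 0.
Proof.
move=> hx; have -> : meval v (qform Z Q) = \sum_i \sum_j Q i j * (x 0 i * x 0 j).
  rewrite /qform [LHS]raddf_sum; apply: eq_bigr => i _.
  by rewrite [LHS]raddf_sum; apply: eq_bigr => j _; rewrite /= mevalZ mevalM !hx.
rewrite exchange_big mxE; apply: eq_bigr => j _ /=.
by rewrite !mxE mulr_suml; apply: eq_bigr => i _; ring.
Qed.

Let mderiv_qform k (Z : 'I_(1 + n) -> mpoly k C) v l (Q : 'M[C]_(1 + n)) (x : 'rV[C]_(1 + n)) a :
  Q^T = Q -> (forall i, meval v (Z i) = x 0 i) ->
  (forall i, meval v (mderiv l (Z i)) = (i == a)%:R) ->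
  meval v (mderiv l (qform Z Q)) = 2 * (x *m Q) 0 a.
Proof.
move=> Qs hx hd.
have Qij i j : Q i j = Q j i by rewrite -{1}Qs mxE.
have -> : meval v (mderiv l (qform Z Q)) =
    \sum_i \sum_j Q i j * ((i == a)%:R * x 0 j + x 0 i * (j == a)%:R).
  rewrite /qform [mderiv l _]raddf_sum [LHS]raddf_sum /=; apply: eq_bigr => i _.
  rewrite [mderiv l _]raddf_sum [LHS]raddf_sum /=; apply: eq_bigr => j _.
  by rewrite mderivZ mderivM mevalZ mevalD !mevalM !hx !hd.
under eq_bigr do under eq_bigr do rewrite mulrDr.
under eq_bigr do rewrite big_split.
rewrite big_split /= mxE mulr_sumr.
have -> : \sum_i \sum_j Q i j * ((i == a)%:R * x 0 j) = \sum_j x 0 j * Q j a.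
  rewrite (bigD1 a) //= [X in _ + X]big1 ?addr0; last first.
    by move=> i /negbTE ->; apply: big1 => j _; rewrite mul0r mulr0.
  by apply: eq_bigr => j _; rewrite eqxx mul1r mulrC Qij.
have -> : \sum_i \sum_j Q i j * (x 0 i * (j == a)%:R) = \sum_j x 0 j * Q j a.
  apply: eq_bigr => i _; rewrite (bigD1 a) //= big1 ?addr0; last first.
    by move=> j /negbTE ->; rewrite !mulr0.
  by rewrite eqxx mulr1 mulrC.
by rewrite -big_split; apply: eq_bigr => j _ /=; ring.
Qed.

Lemma homogenization_mderiv (Q : 'M[C]_(1 + n)) (x : 'rV[C]_(1 + n)) k : Q^T = Q ->
  meval (x 0) (mderiv k (qform hom_var Q)) = 2 * (x *m Q) 0 k.
Proof.
move=> Qs; apply: mderiv_qform => // i; first by rewrite mevalXU.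
rewrite mderivX mevalZ mnm1E; have [->|ik] := eqVneq i k; last by rewrite mul0r.
rewrite (_ : mnm_sub _ _ = mnm0) ?mpolyX0 ?meval1 ?mulr1 //.
by apply/mnmP => j; rewrite mnmBE subnn mnm0E.
Qed.

Let aff_varE (z : 'rV[C]_n) i : meval (z 0) (aff_var i) = row_mx 1%:M z 0 i.
Proof.
case: (splitP i) => k ik.
  have -> : i = lshift n 0 by apply: val_inj; rewrite /= ik ord1.
  by rewrite aff_var0 meval1 row_mxEl mxE.
have -> : i = rshift 1 k by apply: val_inj; rewrite /= ik.
by rewrite aff_varS mevalXU row_mxEr.
Qed.

Lemma affine_meval (Q : 'M[C]_(1 + n)) (z : 'rV[C]_n) :
  meval (z 0) (qform aff_var Q) = (row_mx 1%:M z *m Q *m (row_mx 1%:M z)^T) 0 0.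
Proof. by apply: meval_qform => i; exact: aff_varE. Qed.

Lemma affine_mderiv (Q : 'M[C]_(1 + n)) (z : 'rV[C]_n) k : Q^T = Q ->
  meval (z 0) (mderiv k (qform aff_var Q)) = 2 * (row_mx 1%:M z *m Q) 0 (rshift 1 k).
Proof.
move=> Qs; apply: (@mderiv_qform _ _ _ _ _ (row_mx 1%:M z)) => // i.
case: (splitP i) => l il.
  have -> : i = lshift n 0 by apply: val_inj; rewrite /= il ord1.
  by rewrite aff_var0 -mpolyC1 mderivC meval0 eq_lrshift.
have -> : i = rshift 1 l by apply: val_inj; rewrite /= il.
rewrite aff_varS mderivX mevalZ mnm1E eq_rshift.
have [->|lk] := eqVneq l k; last by rewrite mul0r.
rewrite (_ : mnm_sub _ _ = mnm0) ?mpolyX0 ?meval1 ?mulr1 //.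
by apply/mnmP => j; rewrite mnmBE subnn mnm0E.
Qed.

Lemma msize_affine (Q : 'M[C]_(1 + n)) : drsubmx Q = 0 -> (msize (qform aff_var Q) <= 2)%N.
Proof.
move=> Q0; rewrite /qform.
have le_sum (I : finType) (F : I -> mpoly n C) : (forall i, (msize (F i) <= 2)%N) ->
    (msize (\sum_i F i) <= 2)%N.
  move=> hF; elim/big_ind: _ => //; first by rewrite msize0.
  by move=> p q hp hq; apply: leq_trans (msizeD_le _ _) _; rewrite geq_max hp.
have varle k : (msize (mpolyX C (mnm1 k) : mpoly n C) <= 2)%N by rewrite msizeX mdeg1.
apply: (le_sum) => i; apply: (le_sum) => j.
case: (splitP i) => k ik; [have {ik} -> : i = lshift n 0 by apply: val_inj; rewrite /= ik ord1
  |have {ik} -> : i = rshift 1 k by apply: val_inj; rewrite /= ik];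
case: (splitP j) => l jl; [have {jl} -> : j = lshift n 0 by apply: val_inj; rewrite /= jl ord1
  |have {jl} -> : j = rshift 1 l by apply: val_inj; rewrite /= jl
  |have {jl} -> : j = lshift n 0 by apply: val_inj; rewrite /= jl ord1
  |have {jl} -> : j = rshift 1 l by apply: val_inj; rewrite /= jl].
- by apply: leq_trans (msizeZ_le _ _) _; rewrite aff_var0 mulr1 msize1.
- by apply: leq_trans (msizeZ_le _ _) _; rewrite aff_var0 mul1r aff_varS.
- by apply: leq_trans (msizeZ_le _ _) _; rewrite aff_var0 mulr1 aff_varS.
have -> : Q (rshift 1 k) (rshift 1 l) = 0.
  by have := congr1 (fun M : 'M[C]_n => M k l) Q0; rewrite !mxE.
by rewrite scale0r msize0.
Qed.

End QuadraticPolynomials.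

(** * Symmetric forms over an algebraically closed field *)

Section LinearAlgebra.
Context {C : numClosedFieldType} {n : nat}.
Implicit Types (A : 'M[C]_n) (x y : 'rV[C]_n).

Lemma mx11_eq0 (M : 'M[C]_1) : M 0 0 = 0 -> M = 0.
Proof. by move=> h; apply/matrixP => i j; rewrite !ord1 h mxE. Qed.

Lemma kernel_proportional (a b : 'cV[C]_n) : b != 0 ->
  (forall x, x *m b = 0 -> x *m a = 0) -> exists c, a = c *: b.
Proof.
move=> b0 h; have [i bi] : exists i, b i 0 != 0.
  apply: contrapT => hn; have /eqP := b0; apply; apply/matrixP => i j; rewrite ord1 [RHS]mxE.
  by apply: contrapT => /eqP bi; apply: hn; exists i.
exists (a i 0 / b i 0); apply/matrixP => k j; rewrite ord1 mxE.
(* A vector annihilated by [b]; evaluating [a] on it gives the proportionality of the entries [i]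
   and [k]. *)
pose w : 'rV[C]_n := b i 0 *: delta_mx 0 k - b k 0 *: delta_mx 0 i.
have e (v : 'cV[C]_n) : w *m v = (b i 0 * v k 0 - b k 0 * v i 0)%:M.
  rewrite /w mulmxBl -!scalemxAl -!rowE -[row k v]/(row k v).
  by apply/matrixP => r s; rewrite !ord1 !mxE eqxx mulr1n.
have hb : w *m b = 0.
  by rewrite e mulrC subrr raddf0.
have /matrixP/(_ 0 0) := h _ hb; rewrite e !mxE eqxx mulr1n => /eqP.
rewrite subr_eq0 => /eqP hk.
by apply: (mulfI bi); rewrite hk; field.
Qed.

Let formD A x y : ((x + y) *m A *m (x + y)^T) 0 0 = (x *m A *m x^T) 0 0 +
  (x *m A *m y^T) 0 0 + ((y *m A *m x^T) 0 0 + (y *m A *m y^T) 0 0).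
Proof.
have D (P Q : 'M[C]_1) : (P + Q) 0 0 = P 0 0 + Q 0 0 by rewrite mxE.
by rewrite linearD /= mulmxDr !mulmxDl !D addrACA.
Qed.

Let formC A x y : A^T = A -> (y *m A *m x^T) 0 0 = (x *m A *m y^T) 0 0.
Proof.
move=> As; have -> : y *m A *m x^T = (x *m A *m y^T)^T by rewrite !trmx_mul trmxK As mulmxA.
by rewrite mxE.
Qed.

(** Polarisation: if all vectors were isotropic, evaluating on sums of two basis vectors would give
    [A i j = 0]. *)
Lemma anisotropic_vector A : A^T = A -> A != 0 -> exists y, (y *m A *m y^T) 0 0 != 0.
Proof.
move=> As A0; apply: contrapT => h.
have h0 y : (y *m A *m y^T) 0 0 = 0 by apply: contrapT => /eqP hy; apply: h; exists y.
have /eqP := A0; apply; apply/matrixP => i j; rewrite [RHS]mxE.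
pose d k : 'rV[C]_n := delta_mx 0 k.
have e k l : (d k *m A *m (d l)^T) 0 0 = A k l.
  by rewrite -rowE trmx_delta -colE !mxE.
have := h0 (d i + d j); rewrite formD !h0 add0r addr0 (formC (d i)) // e.
by move/eqP; rewrite -mulr2n mulrn_eq0 /= => /eqP.
Qed.

(* The product of the two roots is [c / a]. *)
Lemma small_root (a b c : C) : a != 0 ->
  exists t, a * t ^+ 2 + b * t + c = 0 /\ `|t| ^+ 2 <= `|c / a|.
Proof.
move=> a0; pose r := sqrtC (b ^+ 2 - 4 * a * c).
have r2 : r ^+ 2 = b ^+ 2 - 4 * a * c by rewrite sqrtCK.
have two0 : (2 : C) != 0 by rewrite pnatr_eq0.
pose t1 := (- b + r) / (2 * a); pose t2 := (- b - r) / (2 * a).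
have root s : s ^+ 2 = b ^+ 2 - 4 * a * c ->
    a * ((- b + s) / (2 * a)) ^+ 2 + b * ((- b + s) / (2 * a)) + c = 0.
  move=> s2; have -> : a * ((- b + s) / (2 * a)) ^+ 2 + b * ((- b + s) / (2 * a)) + c =
    (s ^+ 2 - (b ^+ 2 - 4 * a * c)) / (4 * a) by field; rewrite a0 ?two0.
  by rewrite s2 subrr mul0r.
have t12 : t1 * t2 = c / a.
  have -> : t1 * t2 = (b ^+ 2 - r ^+ 2) / (4 * a ^+ 2) by rewrite /t1 /t2; field; rewrite a0 ?two0.
  by rewrite r2; field.
have [h|h] := boolP (`|t1| ^+ 2 <= `|c / a|).
  by exists t1; split => //; exact: root.
exists t2; split; first by apply: root; rewrite sqrrN.
have h1 : `|c / a| < `|t1| ^+ 2 by rewrite real_ltNge ?realX ?normr_real.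
rewrite -t12 normrM in h1 *; rewrite expr2 in h1 *.
have t10 : 0 < `|t1|.
  by rewrite lt_neqAle normr_ge0 andbT; apply: contraTneq h1 => <-; rewrite !mul0r ltxx.
rewrite ltr_pM2l // in h1.
by rewrite ler_wpM2r // ltW.
Qed.

(* Gram-Schmidt: the orthogonal complement of the vectors already found is not
   totally isotropic, since the form is nondegenerate. *)
Lemma orthonormal_basis A : A^T = A -> A \in unitmx ->
  exists V : 'M[C]_n, V *m A *m V^T = 1%:M.
Proof.
move=> As Au.
suff H k : (k <= n)%N -> exists V : 'M[C]_(k, n), V *m A *m V^T = 1%:M by exact: H.
elim: k => [_|k IH kn]; first by exists 0; apply/matrixP => -[].
have [V VV] := IH (ltnW kn).
have [x [x0 xV]] : exists x : 'rV[C]_n, x != 0 /\ x *m A *m V^T = 0.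
  have /rowV0Pn[x /sub_kermxP xK x0] : kermx (A *m V^T) != 0.
    rewrite kermx_eq0 -row_leq_rank -ltnNge; apply: leq_ltn_trans (rank_leq_col _) kn.
  by exists x => //; rewrite -mulmxA.
have [y [yV yy]] : exists y, y *m A *m V^T = 0 /\ (y *m A *m y^T) 0 0 != 0.
  apply: contrapT => h.
  have h0 y : y *m A *m V^T = 0 -> (y *m A *m y^T) 0 0 = 0.
    by move=> hy; apply: contrapT => /eqP hyy; apply: h; exists y.
  have /negP := x0; apply; apply/eqP.
  have xA : x *m A = 0.
    apply/matrixP => i j; rewrite ord1 [RHS]mxE.
    (* [z] is the component of [e] orthogonal to the rows of [V]. Under the assumption that this
       complement is totally isotropic, polarising [x + z] shows that [x] is orthogonal to [z],
       hence to every basis vector. *)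
    pose e : 'rV[C]_n := delta_mx 0 j; pose z := e - e *m A *m V^T *m V.
    have zV : z *m A *m V^T = 0.
      rewrite /z mulmxBl mulmxBl -(mulmxA _ V) -(mulmxA _ (V *m A)) VV mulmx1 subrr //.
    have xz : (x *m A *m z^T) 0 0 = (x *m A) 0 j.
      rewrite /z linearB /= mulmxBr !trmx_mul !mulmxA xV !mul0mx subr0.
      by rewrite /e trmx_delta -colE mxE.
    rewrite -xz; have xzV : (x + z) *m A *m V^T = 0 by rewrite (mulmxDl x z) (mulmxDl (x *m A)) xV zV addr0.
    have := h0 _ xzV; rewrite formD (h0 _ xV) (h0 _ zV) add0r addr0 (formC x) //.
    by move/eqP; rewrite -mulr2n mulrn_eq0 /= => /eqP.
  by rewrite -[x]mulmx1 -(mulmxV Au) mulmxA xA mul0mx.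
pose r := sqrtC ((y *m A *m y^T) 0 0).
have r0 : r != 0 by rewrite sqrtC_eq0.
pose x' := r^-1 *: y.
have x'V : x' *m A *m V^T = 0 by rewrite /x' -!scalemxAl yV scaler0.
have Vx' : V *m A *m x'^T = 0.
  by apply: trmx_inj; rewrite !trmx_mul trmxK As mulmxA x'V trmx0.
have x'x' : x' *m A *m x'^T = 1%:M.
  apply/matrixP => i j; rewrite !ord1 /x' linearZ /= -scalemxAr -!scalemxAl scalerA.
  rewrite mxE [RHS]mxE eqxx mulr1n -[X in _ * X](sqrtCK) -/r expr2.
  by field.
suff [V' hV'] : exists V' : 'M[C]_(1 + k, n), V' *m A *m V'^T = 1%:M by exists V'.
exists (col_mx x' V); rewrite tr_col_mx mul_col_mx mul_col_row x'x' x'V Vx' VV.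
by rewrite -scalar_mx_block.
Qed.

End LinearAlgebra.

(** * Centre, points at infinity and dual equation of the quadric *)

Section QuadricGeometry.
Context {C : numClosedFieldType} {n : nat}.
Variables (f : mpoly n C) (Q : 'M[C]_(1 + n)).
Hypotheses (Qs : Q^T = Q) (f_hom : homogenization f = qform hom_var Q)
  (f_aff : f = qform aff_var Q) (f3 : msize f = 3%N).
Hypotheses (f_smooth : smooth_closure f) (f_transversal : closure_transversal_at_infinity f).
Local Notation form x y := ((x *m Q *m y^T) 0 0).
Local Notation A := (drsubmx Q).

Let formDl (x y z : 'rV[C]_(1 + n)) : form (x + y) z = form x z + form y z.
Proof. by rewrite !mulmxDl mxE. Qed.
Let formDr (x y z : 'rV[C]_(1 + n)) : form x (y + z) = form x y + form x z.
Proof. by rewrite linearD /= mulmxDr mxE. Qed.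
Let formZl c (x y : 'rV[C]_(1 + n)) : form (c *: x) y = c * form x y.
Proof. by rewrite -!scalemxAl mxE. Qed.
Let formZr c (x y : 'rV[C]_(1 + n)) : form x (c *: y) = c * form x y.
Proof. by rewrite linearZ /= -scalemxAr mxE. Qed.
Let formC (x y : 'rV[C]_(1 + n)) : form y x = form x y.
Proof.
have -> : y *m Q *m x^T = (x *m Q *m y^T)^T by rewrite !trmx_mul trmxK Qs mulmxA.
by rewrite mxE.
Qed.

Let row0Q (y : 'rV[C]_n) : row_mx 0 y *m Q = row_mx (y *m dlsubmx Q) (y *m A).
Proof. by rewrite -{1}[Q]submxK mul_row_block !mul0mx !add0r. Qed.

Let form_dir (y w : 'rV[C]_n) : form (row_mx 0 y) (row_mx 0 w) = (y *m A *m w^T) 0 0.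
Proof. by rewrite row0Q tr_row_mx mul_row_col trmx0 mulmx0 add0r. Qed.

Let As : A^T = A. Proof. by rewrite trmx_drsub Qs. Qed.

Let zero_setE z : zero_set f z <-> form (row_mx 1%:M z) (row_mx 1%:M z) = 0.
Proof. by rewrite /zero_set /= {1}f_aff affine_meval. Qed.

Let tangent_homE x v : tangent_space (homogenization f) x v <-> form x v = 0.
Proof.
rewrite /tangent_space /= f_hom; have -> : \sum_(i < 1 + n)
    meval (x 0) (mderiv i (qform hom_var Q)) * v 0 i = 2 * form x v.
  by rewrite mxE mulr_sumr; apply: eq_bigr => i _; rewrite homogenization_mderiv // [v^T i 0]mxE mulrA.
by split=> [/eqP|->]; rewrite ?mulr0 // mulf_eq0 pnatr_eq0 /= => /eqP.
Qed.

Let tangent_affE z w : tangent_space f z w <-> form (row_mx 1%:M z) (row_mx 0 w) = 0.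
Proof.
rewrite /tangent_space /= f_aff; have -> : \sum_(i < n)
    meval (z 0) (mderiv i (qform aff_var Q)) * w 0 i = 2 * form (row_mx 1%:M z) (row_mx 0 w).
  rewrite [in RHS]mxE big_split_ord /= big_ord1 [(row_mx 0 w)^T _ _]mxE row_mxEl.
  rewrite [(0 : 'M_(1,1)) 0 _]mxE mulr0 add0r mulr_sumr; apply: eq_bigr => i _.
  by rewrite affine_mderiv // [(row_mx 0 w)^T _ _]mxE row_mxEr mulrA.
by split=> [/eqP|->]; rewrite ?mulr0 // mulf_eq0 pnatr_eq0 /= => /eqP.
Qed.

Let smoothE x : zero_closure f x -> hcoord x *m Q != 0.
Proof.
move=> clx; have [k] := (f_smooth clx); rewrite f_hom homogenization_mderiv //.
by apply: contra => /eqP ->; rewrite mxE mulr0.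
Qed.

Let form_cvg (x : 'rV[C]_(1 + n)) : continuous_at x (fun v => form v v).
Proof.
rewrite (_ : (fun v => _) = fun v : 'rV[C]_(1 + n) => \sum_j (\sum_i v 0 i * Q i j) * v 0 j).
  have cc i : continuous_at x (fun v : 'rV[C]_(1 + n) => v 0 i) by exact: coord_cont.
  apply: sum_cvg => j; have c1 : continuous_at x (fun v : 'rV[C]_(1 + n) => \sum_i v 0 i * Q i j).
    by apply: sum_cvg => i; exact: (cvgM (cc i) (@cst_continuous _ _ (Q i j) x)).
  exact: (cvgM c1 (cc j)).
by apply/funext => v; rewrite mxE; apply: eq_bigr => j _; rewrite !mxE.
Qed.

Let form_class (v : 'rV[C]_(1 + n)) (v0 : v != 0) : form (hcoord (proj_class v0)) (hcoord (proj_class v0)) = 0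
  <-> form v v = 0.
Proof.
have [c c0 ->] := proj_class_hcoord v0; rewrite formZl formZr.
by split=> [/eqP|->]; rewrite ?mulr0 // !mulf_eq0 (negbTE c0) /= => /eqP.
Qed.

Let closure_form x : zero_closure f x -> form (hcoord x) (hcoord x) = 0.
Proof.
move=> clx; apply: contrapT => /eqP hx.
pose D : set (CP C n) := [set x | form (hcoord x) (hcoord x) != 0].
have oD : open D.
  apply: open_projP => a a0 /= /eqP Da.
  have fa : form a a != 0 by apply/eqP => h; exact: (Da ((form_class a0).2 h)).
  have nf : nbhs a ((fun v : 'rV[C]_(1 + n) => form v v) @^-1` [set c | c != 0]).
    by apply: form_cvg; exact: nbhs_neq0.
  apply: filterS nf => b /= fb b0.
  by apply/eqP => h; move/eqP: fb; apply; exact: (form_class b0).1 h.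
have [y [[z /zero_setE zz <-] Dy]] := clx D (open_nbhs_nbhs (conj oD hx)).
by move/eqP: Dy; apply; apply/form_class.
Qed.

Let A_neq0 : A != 0.
Proof.
apply/eqP => A0; have := msize_affine A0; rewrite -f_aff f3; by [].
Qed.

Let row0_neq0 (x : 'rV[C]_n) : x != 0 -> row_mx (0 : 'M[C]_1) x != 0.
Proof. by apply: contra => /eqP h; rewrite -(row_mxKr (0 : 'M[C]_1) x) h linear0. Qed.

(* Perturbing [0 : x] to [s : x + t y] with [s] small, the equation becomes
   quadratic in [t] with a small root. *)
Let closure_infinity (x : 'rV[C]_n) (v0 : row_mx (0 : 'M[C]_1) x != 0) :
  (x *m A *m x^T) 0 0 = 0 -> zero_closure f (proj_class v0).
Proof.
move=> xx U nU; have [y yy] := anisotropic_vector As A_neq0.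
have nN := near_proj_class nU.
pose g (w : C * C) : 'rV[C]_(1 + n) := row_mx w.1%:M (x + w.2 *: y).
have g0 : g (0, 0) = row_mx 0 x by rewrite /g scale0r addr0 raddf0.
have cg : continuous_at (0, 0) g.
  have c1 := @cont_fst C C (0, 0); have c2 := @cont_snd C C (0, 0).
  apply: cvg_mx => i j; case: (splitP j) => k jk.
    have {jk} -> : j = lshift n 0 by apply: val_inj; rewrite /= jk ord1.
    rewrite (_ : (fun w => _) = fun w : C * C => w.1) //.
    by apply/funext => w; rewrite /g row_mxEl !mxE ord1 eqxx mulr1n.
  have {jk} -> : j = rshift 1 k by apply: val_inj; rewrite /= jk.
  rewrite (_ : (fun w => _) = fun w : C * C => x i k + w.2 * y i k).
    exact: (cvgD (@cst_continuous _ _ (x i k) (0, 0)) (cvgM c2 (@cst_continuous _ _ (y i k) (0, 0)))).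
  by apply/funext => w; rewrite /g row_mxEr !mxE.
have ng : nbhs (0, 0) (g @^-1` [set w | forall w0 : w != 0, U (proj_class w0)]).
  by apply: cg; rewrite g0.
have [e /= e0 he] := (nbhs_ballP ((0, 0) : C * C) _).1 ng.
(* The product of the two roots of the equation in [t]. It tends to 0 with [s] because [x] is
   isotropic, and a value below [e ^+ 2] forces a root below [e]. *)
pose h s : C := form (row_mx s%:M x) (row_mx s%:M x) / (y *m A *m y^T) 0 0.
have hE s : row_mx s%:M x = s *: row_mx 1%:M 0 + row_mx 0 x :> 'rV[C]_(1 + n).
  by rewrite scale_row_mx add_row_mx scaler0 add0r addr0 scalemx1.
have ch : continuous_at 0 h.
  have c1 : continuous_at (0 : C) (fun s : C => row_mx s%:M x).
    apply: cvg_mx => i j; case: (splitP j) => k jk.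
      have {jk} -> : j = lshift n 0 by apply: val_inj; rewrite /= jk ord1.
      rewrite (_ : (fun w => _) = fun w : C => w); first exact: cont_id.
      by apply/funext => w; rewrite row_mxEl !mxE ord1 eqxx mulr1n.
    have {jk} -> : j = rshift 1 k by apply: val_inj; rewrite /= jk.
    rewrite (_ : (fun w => _) = fun w : C => x i k); first exact: cst_continuous.
    by apply/funext => w; rewrite row_mxEr.
  have c2 : continuous_at (0 : C) (fun s : C => form (row_mx s%:M x) (row_mx s%:M x)).
    exact: (continuous_comp c1 (@form_cvg _)).
  exact: (cvgM c2 (@cst_continuous _ _ ((y *m A *m y^T) 0 0)^-1 (0 : C))).
have h0 : h 0 = 0 by rewrite /h raddf0 form_dir xx mul0r.
have nh : nbhs (0 : C) (h @^-1` ball (0 : C) (e ^+ 2)).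
  by apply: ch; rewrite h0; apply: nbhsx_ballx; rewrite exprn_gt0.
have [r /= r0 hr] := (nbhs_ballP (0 : C) _).1 (filterI nh (nbhsx_ballx (0 : C) e e0)).
(* Nonzero, so that the perturbed point lies in the affine chart. *)
pose s := r / 2.
have s0 : 0 < s by rewrite divr_gt0.
have [hs se] : ball (0 : C) (e ^+ 2) (h s) /\ ball (0 : C) e s.
  apply: hr; rewrite /ball /= sub0r normrN gtr0_norm // /s.
  by rewrite ltr_pdivrMr // mulr_natr mulr2n ltrDl.
have [t [tE tle]] := small_root (2 * form (row_mx s%:M x) (row_mx 0 y))
  (form (row_mx s%:M x) (row_mx s%:M x)) yy.
have te : ball (0 : C) e t.
  rewrite /ball /= sub0r normrN -(@ltr_pXn2r _ 2) ?nnegrE ?normr_ge0 ?(ltW e0) //.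
  by apply: le_lt_trans tle _; move: hs; rewrite /ball /= sub0r normrN.
pose b : 'rV[C]_(1 + n) := g (s, t).
have bE : b = row_mx s%:M x + t *: row_mx 0 y.
  by rewrite /b /g scale_row_mx add_row_mx scaler0 addr0.
have bb : form b b = 0.
  rewrite bE !formDl !formDr !formZl !formZr form_dir.
  rewrite (formC (row_mx s%:M x) (row_mx 0 y)) -[RHS]tE; ring.
pose z := s^-1 *: (x + t *: y).
have bz : b = s *: row_mx 1%:M z.
  rewrite /b /g scale_row_mx scalemx1 /= /z scalerA mulfV ?scale1r //.
  by rewrite gt_eqF.
have b0 : b != 0.
  by rewrite bz scaler_eq0 negb_or gt_eqF //=; exact: affine_point_subproof.
have Ub : U (proj_class b0) := he (s, t) (conj se te) b0.
exists (proj_class b0); split => //.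
exists z.
  apply/zero_setE; move: bb; rewrite bz formZl formZr => bb.
  have s00 : s != 0 by rewrite gt_eqF.
  by apply: (mulfI s00); apply: (mulfI s00); rewrite bb !mulr0.
have [d d0 hd] := proj_class_hcoord b0.
have [d' d0' hd'] := proj_class_hcoord (affine_point_subproof z).
apply: (@hcoord_eq _ _ _ _ _ (d * s / d')).
by rewrite hd /affine_point hd' bz !scalerA divfK.
Qed.


Let HinfE (v : 'rV[C]_(1 + n)) : hyperplane_cone (Hinf C n) v <-> lsubmx v = 0.
Proof.
have [c c0 cE] := proj_class_hcoord (Hinf_subproof C n).
rewrite /hyperplane_cone /= /Hinf cE -scalemxAr -[v in v *m _]hsubmxK mul_row_col mulmx0 mulmx1 addr0.
split=> [/eqP|->]; last by rewrite scaler0.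
by rewrite scaler_eq0 (negbTE c0) => /eqP.
Qed.

Let CPinfE (x : 'rV[C]_n) (v0 : row_mx (0 : 'M[C]_1) x != 0) : CPinf (proj_class v0).
Proof.
have [c c0 cE] := proj_class_hcoord v0.
by rewrite -hyperplane_points_Hinf; apply/HinfE; rewrite cE linearZ /= row_mxKl scaler0.
Qed.

(** A kernel vector [x] gives a point at infinity of the closure at which the differential vanishes
    on all directions at infinity. Transversality writes the remaining direction as a sum of two
    vectors on which it vanishes, so the differential is zero, against smoothness. *)
Lemma quadric_unit : A \in unitmx.
Proof.
rewrite -row_free_unit -kermx_eq0; apply: contraT => /rowV0Pn[x /sub_kermxP xA x0].
have v0 := row0_neq0 x0; have [c c0 cE] := proj_class_hcoord v0.
have cl : zero_closure f (proj_class v0) by apply: closure_infinity; rewrite xA mul0mx mxE.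
have [u [w [/tangent_homE hu /HinfE hw e]]] := f_transversal cl (@CPinfE _ v0) (row_mx 1%:M 0).
have /eqP := smoothE cl; case; rewrite cE -scalemxAl row0Q xA.
suff -> : x *m dlsubmx Q = 0 by rewrite row_mx0 scaler0.
apply: mx11_eq0; transitivity (form (row_mx 0 x) (row_mx 1%:M 0)).
  by rewrite row0Q tr_row_mx mul_row_col trmx1 mulmx1 trmx0 mulmx0 addr0.
rewrite e formDr; move: hu; rewrite cE formZl => /eqP; rewrite mulf_eq0 (negbTE c0) /= => /eqP ->.
by rewrite -[w]hsubmxK hw form_dir xA mul0mx mxE addr0.
Qed.

Let A_unit : A \in unitmx := quadric_unit.

(** The unique critical point of [f]: by [centerQ] the gradient vanishes there. Around it [f] is a
    constant, [quadric_value], plus a quadratic form. *)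
Definition quadric_center : 'rV[C]_n := - (ursubmx Q *m invmx A).
Definition quadric_value : C := form (row_mx 1%:M quadric_center) (row_mx 1%:M quadric_center).
Local Notation z0 := quadric_center.
Local Notation d := quadric_value.

Let centerQ : row_mx 1%:M z0 *m Q = row_mx d%:M 0.
Proof.
have e : row_mx 1%:M z0 *m Q = row_mx (ulsubmx Q + z0 *m dlsubmx Q) 0.
  rewrite -{1}[Q]submxK mul_row_block !mul1mx; congr row_mx.
  by rewrite /quadric_center mulNmx mulmxKV // subrr.
rewrite e; congr row_mx; rewrite [LHS]mx11_scalar /quadric_value e.
by rewrite tr_row_mx mul_row_col trmx1 mulmx1 mul0mx addr0.
Qed.

Let affine_split (z : 'rV[C]_n) : row_mx 1%:M z = row_mx 1%:M z0 + row_mx 0 (z - z0).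
Proof. by rewrite add_row_mx addr0 addrC subrK. Qed.

Let form_center (w : 'rV[C]_n) : form (row_mx 1%:M z0) (row_mx 0 w) = 0.
Proof. by rewrite centerQ tr_row_mx mul_row_col trmx0 mulmx0 mul0mx addr0 mxE. Qed.

Let form_aff_dir (z w : 'rV[C]_n) :
  form (row_mx 1%:M z) (row_mx 0 w) = ((z - z0) *m A *m w^T) 0 0.
Proof. by rewrite affine_split formDl form_center add0r form_dir. Qed.

Let form_aff (z : 'rV[C]_n) :
  form (row_mx 1%:M z) (row_mx 1%:M z) = d + ((z - z0) *m A *m (z - z0)^T) 0 0.
Proof.
rewrite affine_split !formDl !formDr form_center (formC _ (row_mx 0 _)) form_center.
by rewrite form_dir addr0 add0r.
Qed.

(** Otherwise the centre would lie on the quadric and be a singular point of it. *)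
Lemma quadric_value_neq0 : d != 0.
Proof.
apply/eqP => d0.
have cl : zero_closure f (affine_point z0).
  by apply: subset_closure; exists z0 => //; apply/zero_setE.
have /eqP := smoothE cl; case.
have [c c0 cE] := proj_class_hcoord (affine_point_subproof z0).
by rewrite /affine_point cE -scalemxAl centerQ d0 raddf0 row_mx0 scaler0.
Qed.

(** The quadratic form inverse to the leading part, evaluated on the normal covector of the
    hyperplane; together with the value [center_offset] of its equation at the centre it decides
    general position. *)
Definition dual_form (b : 'cV[C]_(1 + n)) : C := ((dsubmx b)^T *m invmx A *m dsubmx b) 0 0.
Definition center_offset (b : 'cV[C]_(1 + n)) : C := usubmx b 0 0 + (z0 *m dsubmx b) 0 0.

Local Notation p := dual_form.
Local Notation e := center_offset.

Let coneE (L : dualCP C n) (x : 'rV[C]_n) : hyperplane_cone L (row_mx 0 x) <-> x *m dsubmx (hcoord L) = 0.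
Proof.
by rewrite /hyperplane_cone /= -{1}[hcoord L]vsubmxK mul_row_col mul0mx add0r.
Qed.

Let affE (L : dualCP C n) (z : 'rV[C]_n) : hyperplane_points L (affine_point z) <->
  e (hcoord L) + ((z - z0) *m dsubmx (hcoord L)) 0 0 = 0.
Proof.
have [c c0 cE] := proj_class_hcoord (affine_point_subproof z).
rewrite /hyperplane_points /hyperplane_cone /= /affine_point cE -scalemxAl.
rewrite -{1}[hcoord L]vsubmxK mul_row_col mul1mx.
have -> : e (hcoord L) + ((z - z0) *m dsubmx (hcoord L)) 0 0 =
    (usubmx (hcoord L) + z *m dsubmx (hcoord L)) 0 0.
  by rewrite /center_offset mulmxBl !mxE -!addrA; congr (_ + _); rewrite addrC subrK.
split=> [/eqP|/mx11_eq0->]; last by rewrite scaler0.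
by rewrite scaler_eq0 (negbTE c0) => /eqP ->; rewrite mxE.
Qed.

Let pE (L : dualCP C n) (x : 'rV[C]_n) c : dsubmx (hcoord L) = c *: (A *m x^T) ->
  p (hcoord L) = c ^+ 2 * (x *m A *m x^T) 0 0.
Proof.
move=> h; have h2 : (c *: (A *m x^T))^T = c *: (x *m A) by rewrite linearZ /= trmx_mul trmxK As.
rewrite /dual_form h h2 -!scalemxAl -scalemxAr scalerA.
by rewrite mulmxK // mulmxA [LHS]mxE expr2.
Qed.

Let kernelE (L : dualCP C n) (x : 'rV[C]_n) : x != 0 ->
  (forall w : 'rV[C]_n, (x *m A *m w^T) 0 0 = 0 -> w *m dsubmx (hcoord L) = 0) ->
  exists c, dsubmx (hcoord L) = c *: (A *m x^T).
Proof.
move=> x0 h; apply: kernel_proportional.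
  apply: contra x0 => /eqP h0; rewrite -(trmxK x) -[x^T](mulKmx A_unit) h0.
  by rewrite mulmx0 trmx0.
move=> w hw; apply: h.
have -> : x *m A *m w^T = (w *m (A *m x^T))^T by rewrite !trmx_mul trmxK As.
by rewrite hw trmx0 mxE.
Qed.

(** The vector [y] dual to the normal covector [a] is the only candidate for a direction of
    tangency. If [dual_form] vanishes, [y] is isotropic and gives an asymptotic point; otherwise the
    only possible point of tangency lies on the line through the centre along [y]. Conversely,
    equality of tangent spaces makes [a] proportional to the covector of the contact point, by
    [kernelE]. *)
Lemma general_positionE (L : dualCP C n) : general_position f L <->
  p (hcoord L) != 0 /\ e (hcoord L) ^+ 2 != - d * p (hcoord L).
Proof.
pose a := dsubmx (hcoord L); pose y := a^T *m invmx A.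
have yA (w : 'rV[C]_n) : y *m A *m w^T = (w *m a)^T by rewrite /y mulmxKV // trmx_mul.
have yy : (y *m A *m y^T) 0 0 = p (hcoord L).
  by rewrite yA mxE /dual_form /y -mulmxA.
split=> [gp|[p0 ep]].
  have a0 : a != 0.
    apply/eqP => a0; apply: gp; right; right => /=.
    have [c c0 cE] := proj_class_hcoord (Hinf_subproof C n).
    apply/esym; apply: (@hcoord_eq _ _ _ _ _ (usubmx (hcoord L) 0 0 / c)).
    rewrite cE scalerA divfK // -[LHS]vsubmxK -/a a0 scale_col_mx scaler0; congr col_mx.
    by rewrite [LHS]mx11_scalar scalemx1.
  have y0 : y != 0.
    apply: contra a0 => /eqP y0; have := yA 0.
    by rewrite -(trmxK a) -[a^T](mulmxKV A_unit) -/y y0 mul0mx trmx0.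
  have p0 : p (hcoord L) != 0.
    apply/eqP => p0; apply: gp; right; left.
    have v0 := row0_neq0 y0; have [c c0 cE] := proj_class_hcoord v0; split.
      move=> LH; move/eqP: a0; apply; rewrite /a LH.
      have [c' c0' ->] := proj_class_hcoord (Hinf_subproof C n).
      by rewrite linearZ /= col_mxKd scaler0.
    exists (proj_class v0); split; [|exact: CPinfE| |].
    - by apply: closure_infinity; rewrite yy.
    - rewrite /hyperplane_points /= cE /hyperplane_cone /= -scalemxAl.
      have -> : row_mx 0 y *m hcoord L = 0 by apply: (coneE L y).2; exact: mx11_eq0.
      by rewrite scaler0.
    - apply/seteqP; split=> v [h1 /HinfE h2]; split; try exact/HinfE; move: h1.
        move=> /tangent_homE; rewrite cE formZl -[v]hsubmxK h2 form_dir yA => /eqP.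
        by rewrite mulf_eq0 (negbTE c0) mxE /= => /eqP/mx11_eq0 h; apply/coneE.
      rewrite -[v]hsubmxK h2 => /coneE h; apply/tangent_homE.
      by rewrite cE formZl form_dir yA h trmx0 mxE mulr0.
  split => //; apply/eqP => ep; apply: gp; left.
  (* The point [z0 - k *: y] is where the hyperplane meets the line through the centre along [y];
     the value of [f] there is [d + k ^+ 2 * p], which is 0 under the assumed equality. *)
  pose k := e (hcoord L) / p (hcoord L).
  have k0 : k != 0.
    rewrite mulf_neq0 ?invr_eq0 //; apply/eqP => e0; move/eqP: ep.
    rewrite e0 expr0n /= eq_sym; apply/negP.
    by rewrite mulf_neq0 // oppr_eq0 quadric_value_neq0.
  have zz : z0 - k *: y - z0 = - k *: y by rewrite addrAC subrr add0r scaleNr.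
  have zT : (- k *: y)^T = - k *: y^T by rewrite linearZ.
  exists (z0 - k *: y); split.
  - apply/zero_setE; rewrite form_aff zz zT -!scalemxAl -scalemxAr scalerA mxE yy.
    by rewrite mulrNN -expr2 /k expr_div_n ep; field.
  - apply/affE; rewrite zz -scalemxAl mxE -/a -[X in _ * X]/(p (hcoord L)) /k.
    by field.
  - apply/seteqP; split=> w; rewrite /tangent_space.
      move=> /tangent_affE; rewrite form_aff_dir zz -!scalemxAl mxE yA mxE => /eqP.
      by rewrite mulf_eq0 oppr_eq0 (negbTE k0) /= => /eqP/mx11_eq0 h; apply/coneE.
    move=> /coneE h; apply/tangent_affE.
    by rewrite form_aff_dir zz -!scalemxAl mxE yA h trmx0 mxE mulr0.
case=> [[z [/zero_setE hz /affE hL hT]]|[[_ [x [cl /[dup] inf hx0 hL hT]]]|LH]].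
- pose x := z - z0; have xx : (x *m A *m x^T) 0 0 = - d.
    by apply/eqP; rewrite -subr_eq0 opprK addrC -form_aff hz.
  have x0 : x != 0.
    apply: contra quadric_value_neq0 => /eqP x0.
    by move/eqP: xx; rewrite x0 !mul0mx mxE eq_sym oppr_eq0.
  have [c cE] : exists c, a = c *: (A *m x^T).
    apply: kernelE => // w hw; apply/coneE.
    suff : tangent_space f z w by rewrite hT.
    by apply/tangent_affE; rewrite form_aff_dir.
  move/eqP: ep; apply; rewrite (pE cE) xx.
  have -> : e (hcoord L) = - (c * - d).
    apply/eqP; rewrite -subr_eq0 opprK -hL -/a -/x cE -scalemxAr mulmxA mxE xx.
    by [].
  ring.
- have inf' := inf; rewrite -hyperplane_points_Hinf in inf'.
  have /HinfE x0 := inf'; pose x' := rsubmx (hcoord x).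
  have xE : hcoord x = row_mx 0 x' by rewrite -x0 hsubmxK.
  have x'0 : x' != 0.
    by apply: contra (hcoord_neq0 x) => /eqP x'0; rewrite xE x'0 row_mx0.
  have [c cE] : exists c, a = c *: (A *m x'^T).
    apply: kernelE => // w hw; apply/coneE.
    suff : (tangent_space (homogenization f) (hcoord x) `&` hyperplane_cone (Hinf C n)) (row_mx 0 w).
      by rewrite hT => -[].
    split; first by apply/tangent_homE; rewrite xE form_dir.
    by apply/HinfE; rewrite row_mxKl.
  move/eqP: p0; apply; rewrite (pE cE).
  by have := closure_form cl; rewrite xE form_dir => ->; rewrite mulr0.
- move/eqP: p0; apply; have [c c0 cE] := proj_class_hcoord (Hinf_subproof C n).
  by rewrite LH /dual_form /Hinf cE linearZ /= col_mxKd scaler0 trmx0 !mul0mx mxE.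
Qed.

End QuadricGeometry.

(** The basis [V] is orthonormal for the inverse form, so that [dual_form] becomes the sum of
    squares of the direction; [d] is a square root of [- quadric_value], so that tangency becomes
    [z ^+ 2] equal to that sum. Dividing by its square root lands in the product with the sphere. *)
Lemma general_position_pencil (R : realType) (n : nat) (f : mpoly n (complexes R)) :
  nondegenerate_quadric f ->
  exists (d : complexes R) (w : 'rV[complexes R]_n) (W : 'M[complexes R]_n),
    [/\ d != 0, W \in unitmx &
        general_position f = pencil d w W @` (@twice_punctured R `*` @complex_sphere R n)].
Proof.
case=> f3 sm tr; have [Q [Qs f_hom f_aff]] := quadratic_matrix f3.
have Au : drsubmx Q \in unitmx by exact: (quadric_unit Qs f_hom f_aff f3 sm tr).
have As : (drsubmx Q)^T = drsubmx Q by rewrite trmx_drsub Qs.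
have [V VV] : exists V : 'M[complexes R]_n, V *m invmx (drsubmx Q) *m V^T = 1%:M.
  by apply: (orthonormal_basis (A := invmx _)); rewrite ?unitmx_inv // trmx_inv As.
pose d := sqrtC (- quadric_value Q); pose w := quadric_center Q.
have d2 : d ^+ 2 = - quadric_value Q by rewrite sqrtCK.
have d0 : d != 0 by rewrite sqrtC_eq0 oppr_eq0; exact: (quadric_value_neq0 Qs f_hom f_aff f3 sm tr).
have Wu : V^T \in unitmx by have [] := mulmx1_unit VV.
exists d, w, V^T; split => //.
have pE c z u : dual_form Q (c *: frame d w V^T z u) = c ^+ 2 * \sum_i u i 0 ^+ 2.
  rewrite /dual_form /frame -frameZ /frame col_mxKd.
  have -> : (V^T *m (c *: u))^T = c *: (u^T *m V).
    by rewrite -scalemxAr linearZ /= trmx_mul trmxK.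
  rewrite -scalemxAr -!scalemxAl -scalemxAr scalerA -!mulmxA (mulmxA V) (mulmxA (V *m _)).
  rewrite VV mul1mx mxE expr2; congr (_ * _); rewrite mxE.
  by apply: eq_bigr => i _; rewrite mxE expr2.
have eE c z u : center_offset Q (c *: frame d w V^T z u) = c * (d * z).
  by rewrite /center_offset -frameZ /frame col_mxKd col_mxKu mxE eqxx mulr1n subrK mulrCA.
have gpE L : general_position f L <->
    dual_form Q (hcoord L) != 0 /\ center_offset Q (hcoord L) ^+ 2 != d ^+ 2 * dual_form Q (hcoord L).
  by rewrite d2; exact: (general_positionE Qs f_hom f_aff f3 sm tr).
apply/seteqP; split=> L.
  move=> /gpE; rewrite -(frameK w d0 Wu (hcoord L)).
  set z := frame_offset _ _ _; set u := frame_dir _ _.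
  rewrite -[frame _ _ _ _ _]scale1r pE eE mul1r expr1n mul1r exprMn => -[p0 ez].
  pose r := sqrtC (\sum_i u i 0 ^+ 2).
  have r0 : r != 0 by rewrite sqrtC_eq0.
  have r2 : r ^+ 2 = \sum_i u i 0 ^+ 2 by rewrite sqrtCK.
  have zr : (z / r) ^+ 2 != 1.
    apply: contra ez => /eqP zr; rewrite -r2 -[r ^+ 2]mul1r -zr.
    by apply/eqP; field.
  exists ((re (z / r), im (z / r)), r^-1 *: u); first split => /=.
  - have zc : cplx (re (z / r)) (im (z / r)) = z / r by rewrite cplxK.
    move: zr; rewrite -zc; move: (re _) (im _) => x y {zc} xy.
    split=> -[ex ey]; move/eqP: xy; apply; rewrite ex ey.
      by rewrite (_ : cplx 1 0 = 1) ?expr1n.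
    by rewrite (_ : cplx (-1) 0 = - 1) ?sqrrN ?expr1n //; apply: complexes_eq; rewrite ?reN ?imN ?re_cplx ?im_cplx //= oppr0.
  - rewrite /complex_sphere /=; transitivity (r^-1 ^+ 2 * r ^+ 2); last by rewrite -exprMn mulVf // expr1n.
    by rewrite r2 mulr_sumr; apply: eq_bigr => i _; rewrite mxE exprMn.
  rewrite /pencil /= cplxK -[RHS]hyperplane_hcoord -(frameK w d0 Wu (hcoord L)).
  by rewrite -[RHS](@hyperplaneZ _ _ r^-1) ?invr_eq0 // mulrC frameZ.
move=> [[t u] [/= Tt Su] <-]; apply/gpE; rewrite /pencil /=.
have u0 : u != 0.
  apply: contraPneq Su => ->; rewrite /complex_sphere /= big1 => [/eqP|i _].
    by rewrite eq_sym oner_eq0.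
  by rewrite mxE expr0n.
have [c c0 ->] := hcoord_hyperplane (frame_neq0 d w Wu (cplx t.1 t.2) u0).
rewrite pE eE Su mulr1; split; first by rewrite expf_neq0.
apply/eqP; rewrite !exprMn mulrCA => /(mulfI (expf_neq0 2 d0)) h.
have /eqP : cplx t.1 t.2 ^+ 2 = 1 by apply: (mulfI (expf_neq0 2 c0)); rewrite h mulr1.
case: Tt => t1 t2; rewrite sqrf_eq1 => /orP[]/eqP e.
  by apply: t1; rewrite (surjective_pairing t) -(re_cplx t.1 t.2) -{2}(im_cplx t.1 t.2) e.
apply: t2; rewrite (surjective_pairing t) -(re_cplx t.1 t.2) -{2}(im_cplx t.1 t.2) e.
by rewrite reN imN /= oppr0.
Qed.

(** * Loops in the subspace and path classes in the ambient space *)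

Section SubspaceLoops.
Context {R : realType} {B : topologicalType} {E : set B} (x : E).
Local Notation I := (unit_interval R).
Local Notation path := (@path_in R B E (set_val x) (set_val x)).

Let incl_cont : continuous (set_val : E -> B).
Proof. exact: (@initial_continuous _ _ set_val). Qed.

Let lift (T : Type) (p : T -> B) (pE : forall s, E (p s)) : T -> E := fun s => SigSub (mem_set (pE s)).

Let lift_cont (T : topologicalType) (p : T -> B) (pE : forall s, E (p s)) :
  continuous p -> continuous (lift pE).
Proof. by move=> cp; apply: (@continuous_comp_initial _ _ _ (set_val : E -> B)). Qed.

Let path_of_loop (f : loop R x) : path.
Proof.
exists (fun s => set_val (f (ui_clamp s))).
- apply: (cont_comp incl_cont); apply: (@comp_clamp R R E f id); first exact: loop_cont.
  exact: cont_id.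
- by move=> s; exact: set_valP.
- by rewrite ui_clamp_le0 // loop0.
- by rewrite ui_clamp_ge1 // loop1.
Defined.

Let loop_of_path (p : path) : exists f : loop R x, forall s : I, set_val (f s) = p (ui_val s).
Proof.
have pE (s : I) : E (p (ui_val s)) by exact: path_val.
have cl : continuous (lift pE).
  by apply: lift_cont; apply: (cont_comp (path_cont p)); exact: ui_val_continuous.
have l0 : lift pE zero = x by apply: val_inj; rewrite /= ui_val0 path_src.
have l1 : lift pE one = x by apply: val_inj; rewrite /= ui_val1 path_tgt.
by exists (mk_loop cl l0 l1).
Qed.

Let path_of_loop_homotopic (f g : loop R x) :
  loop_homotopic f g <-> path_homotopic E (path_of_loop f) (path_of_loop g).
Proof.
have inI (s : I) : 0 <= ui_val s <= 1 by rewrite ui_ge0 ui_le1.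
split=> [/asboolP[H [cH H0 H1 He]]|[H [cH HE H0 H1 He]]].
  exists (fun w => set_val (H (ui_clamp w.1, ui_clamp w.2))); split.
  - apply: (cont_comp incl_cont); apply: comp_clamp2 => //; [exact: cont_fst|exact: cont_snd].
  - by move=> w; exact: set_valP.
  - by move=> s _ /=; rewrite (ui_clamp_le0 (lexx 0)) H0.
  - by move=> s _ /=; rewrite (ui_clamp_ge1 (lexx 1)) H1.
  - move=> t _ /=; rewrite (ui_clamp_le0 (lexx 0)) (ui_clamp_ge1 (lexx 1)).
    by have [-> ->] := He (ui_clamp t); rewrite loop0 loop1.
apply/asboolP; have HE' (w : I * I) : E (H (ui_val w.1, ui_val w.2)) by exact: HE.
exists (lift HE'); split.
- apply: lift_cont; apply: (cont_comp cH).
  by apply: cont_pair; [exact: ui_cont_fst|exact: ui_cont_snd].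
- by move=> s; apply: val_inj; rewrite /= ui_val0 H0 //= ui_valK.
- by move=> s; apply: val_inj; rewrite /= ui_val1 H1 //= ui_valK.
- move=> t; have [h0 h1] := He _ (inI t).
  split; apply: val_inj; rewrite /= ?ui_val0 ?ui_val1 ?h0 ?h1 /=.
    by rewrite ui_clamp_le0 // loop0.
  by rewrite ui_clamp_ge1 // loop1.
Qed.

Lemma fundamental_group_subspace :
  exists F : fundamental_group R x -> pi1 R E (set_val x) (set_val x),
    bijective F /\ forall a b, F (a * b)%g = pmul (F a) (F b).
Proof.
pose cls := (\pi_({eq_quot (@loop_homotopic R E x)}) : loop R x -> fundamental_group R x).
pose F (a : fundamental_group R x) := pcls (path_of_loop (repr a)).
have FE f : F (cls f) = pcls (path_of_loop f).
  by apply/pclsP/path_of_loop_homotopic; exact: repr_cls.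
exists F; split; last first.
  elim/fundamental_group_ind=> f; elim/fundamental_group_ind=> g.
  rewrite [(_ * _)%g]fundamental_group_mulE !FE pmulE; apply: eq_pcls => s hs /=.
  rewrite -[X in set_val X]/(loop_cat_fun f g (ui_clamp s)) /loop_cat_fun /cat_fun ui_clampK //.
  by case: ifP.
have F_inj : injective F.
  elim/fundamental_group_ind=> f; elim/fundamental_group_ind=> g.
  rewrite !FE => /pclsP/path_of_loop_homotopic h; exact/clsP.
have F_surj b : exists a, F a = b.
  have [p ->] := pcls_surj b; have [f fE] := loop_of_path p.
  exists (cls f); rewrite FE; apply: eq_pcls => s hs.
  by rewrite /= fE ui_clampK.
have [G GK] := choice F_surj.
by exists G => // a; apply: F_inj; rewrite GK.
Qed.

End SubspaceLoops.

Theorem theorem1 (R : realType) (n : nat) (f : mpoly n R[i])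
    (hn : (3 <= n)%N) (hf : nondegenerate_quadric f)
    (L0 : general_position f) :
  exists phi : {multiplicative quadric_group -> fundamental_group R L0},
    bijective phi.
Proof.
have [d [w [W [d0 Wu gpE]]]] := @general_position_pencil R n f hf.
pose E : set (dualCP (complexes R) n) := general_position f.
have [F [F_bij FM]] := @fundamental_group_subspace R _ E L0.
have sph_neg (u : 'cV[complexes R]_n) : complex_sphere u -> complex_sphere (- u).
  rewrite /complex_sphere /= => <-; apply: eq_bigr => i _; by rewrite mxE sqrrN.
have neg_cont : continuous (fun u : 'cV[complexes R]_n => - u).
  move=> u; apply: cvg_mx => i j.
  rewrite (_ : (fun t => _) = fun u : 'cV[complexes R]_n => - u i j).
    exact: (cvgN (@coord_cont _ _ _ i j u)).
  by apply/funext => v; rewrite mxE.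
have [psi [psi_bij psiM]] : exists psi : pi1 R E (set_val L0) (set_val L0) -> quadric_group,
    bijective psi /\ forall a b, psi (pmul a b) = (psi a * psi b)%g.
  have : E (set_val L0) by exact: set_valP.
  move: (set_val L0); rewrite /E gpE => x Ex.
  (* The real and imaginary parts of the coordinates are odd and have no common zero on the
     sphere. *)
  pose sgn (k : 'I_n * bool) (u : 'cV[complexes R]_n) : R :=
    if k.2 then re (u k.1 0) else im (u k.1 0).
  apply: (@cylinder_pi1 R 'cV[complexes R]_n (dualCP (complexes R) n) _ (@complex_sphere R n)
    (fun u => - u) sgn (pencil d w W)).
  - exact: complex_sphere_simply_connected.
  - exact: sph_neg.
  - exact: neg_cont.
  - exact: opprK.
  - move=> [i b] u; have cu : continuous_at u (fun v : 'cV[complexes R]_n => v i 0) by exact: coord_cont.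
    by case: b; [exact: (continuous_comp cu (@re_cont R _))|exact: (continuous_comp cu (@im_cont R _))].
  - by move=> [i []] u; rewrite /sgn /= mxE ?reN ?imN.
  - move=> u Su; apply: contrapT => h; have /eqP := Su; apply/negP.
    rewrite /complex_sphere big1 ?[0 == _]eq_sym ?oner_eq0 // => i _.
    suff -> : u i 0 = 0 by rewrite expr0n.
    apply: complexes_eq; apply: contrapT => /eqP hi; apply: h.
      by exists (i, true).
    by exists (i, false).
  - exact: pencil_cont.
  - by move=> *; exact: pencil_open.
  - by move=> *; exact: pencil_neg.
  - exact: pencil_fibre.
  - exact: Ex.
(* Holonomy runs from loops to the presented group; its inverse is the required isomorphism. *)
pose theta a := psi (F a).
have thetaM a b : theta (a * b)%g = (theta a * theta b)%g by rewrite /theta FM psiM.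
have [phi thetaK phiK] : bijective theta by exact: bij_comp.
have phiM : {morph phi : a b / (a * b)%g}.
  by move=> a b; rewrite -{1}(phiK a) -{1}(phiK b) -thetaM thetaK.
pose mphi := isMultiplicative.Build _ _ phi phiM.
pose pphi : {multiplicative quadric_group -> fundamental_group R L0} := HB.pack phi mphi.
by exists pphi; exists theta.
Qed.
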